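(* Let $G$ be a discrete free Fuchsian group of rank two with invariant disc $\Delta$, without parabolic elements, whose generators have disjoint axes; let $A,B$ be stopping generators and let $H=\mathbb H^3/G$. Let $s>0$. Let $p(s)$ and $p_A(s)$ be the intersection points with $Rec_A(s)$ of the rays $L_p$ and $L_{A_p}$; let $q(s)$ and $q_B(s)$ be the intersection points with $Rec_B(s)$ of the rays $L_q$ and $L_{B_q}$; and let $q_A(s)$ and $p_B(s)$ be the intersection points with $Rec_{A^{-1}B}(s)$ of the rays $L_{A_q}$ and $L_{B_p}$. Then the projections to $H$ of the points $p(s),q(s),p_A(s),q_A(s),p_B(s),q_B(s)$ lie on the surface $\mathcal S(s)\subset H$ and comprise the set of fixed points of the hyperelliptic isometry $j$ restricted to $\mathcal S(s)$.
   Context: $\mathbb H^3$ is upper half-space with boundary $\hat{\mathbb C}$; $\Delta=\{|z|<1\}$; $\mathbb P\subset\mathbb H^3$ is the hyperbolic plane with boundary $\partial\Delta$. $G$ acts on $\mathbb H^3$ preserving $\mathbb P$ and each of its two sides (the exterior side faces $\{|z|>1\}$, the interior side faces $\Delta$). $Ax_W$ denotes the axis of $W\in G$ in $\mathbb H^3$; it lies in $\mathbb P$. For a hyperbolic line $M$, $H_M$ is the half-turn about $M$. Stopping generators: generators $A,B$ of $G$ with disjoint axes; $L\subset\mathbb P$ is the line orthogonal to $Ax_A$ and $Ax_B$, and $L_A,L_B\subset\mathbb P$ are the lines with $A=H_LH_{L_A}$, $B=H_LH_{L_B}$; the pair is stopping if $L,L_A,L_B$ bound a domain in $\mathbb P$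 (none separates the other two). $L_A$ is orthogonal to $Ax_A$ and $Ax_{A^{-1}B}$, and $L_B$ is orthogonal to $Ax_B$ and $Ax_{A^{-1}B}$. The involution $j$: $G$ is a normal subgroup of index two in $\langle H_L,H_{L_A},H_{L_B}\rangle$, and $H_L,H_{L_A},H_{L_B}$ differ by elements of $G$; $j:H\to H$ is the order two isometry they all induce. The surface $\mathcal S(s)$: $\mathcal C\subset\mathbb P$ is the hyperbolic convex hull in $\mathbb H^3$ of the limit set of $G$. For $x\in\mathbb P$ let $V_x(t)$, $t\in\mathbb R$, be the arclength-parameterized line orthogonal to $\mathbb P$ with $V_x(0)=x$, directed so that $t>0$ is on the exterior side. Put $\Pi(\pm s)=\{V_x(\pm s):x\in\mathbb P\}$, $\mathcal C_{ext}(s)=\{V_x(s):x\in\mathcal C\}$, $\mathcal C_{int}(s)=\{V_x(-s):x\in\mathcal C\}$, $N_{ext}(s)=\mathcal C_{ext}(s)/G$, $N_{int}(s)=\mathcal C_{int}(s)/G$. For an axis $Ax_W\subset\partial\mathcal C$ (boundary taken in $\mathbb P$), let $Eq_W(s)$ be the set of points at distance $s$ from $Ax_W$; the curves $Eq_W(s)\cap\Pi(\pm s)$, which are the orthogonal projections $\{V_x(\pm s):x\in Ax_W\}$ of $Ax_W$, divide $Eq_W(s)$ into two strips, exactly one of which is disjoint from $\mathcal C$; call that one $Rec_W(s)$. The boundary of $\mathcal C$ in $\mathbb P$ consists of the axes of $A,B,A^{-1}B$ and all their conjugates; $F_A(s),F_B(s),F_{A^{-1}B}(s)$ are the images in $H$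 of $Rec_A(s),Rec_B(s),Rec_{A^{-1}B}(s)$, and $\mathcal S(s)=N_{ext}(s)\cup N_{int}(s)\cup F_A(s)\cup F_B(s)\cup F_{A^{-1}B}(s)$. The rays: the complement in $L$ of the segment lying in $\mathcal C$ (between $Ax_A$ and $Ax_B$) consists of two rays, $L_p$ starting on $Ax_A$ and $L_q$ starting on $Ax_B$. Similarly $L_A\setminus\mathcal C$ consists of $L_{A_p}$ starting on $Ax_A$ and $L_{A_q}$ starting on $Ax_{A^{-1}B}$; $L_B\setminus\mathcal C$ consists of $L_{B_q}$ starting on $Ax_B$ and $L_{B_p}$ starting on $Ax_{A^{-1}B}$. *)

(* Defs.v *)
From HB Require Import structures.
From mathcomp Require Import all_boot all_order all_algebra.
From mathcomp Require Import all_classical all_reals all_analysis.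
From mathcomp Require Import complex.

Set Implicit Arguments.
Unset Strict Implicit.
Unset Printing Implicit Defensive.

Import Order.TTheory GRing.Theory Num.Theory.
Import numFieldNormedType.Exports Normc.

Local Open Scope classical_set_scope.
Local Open Scope ring_scope.
Local Open Scope complex_scope.

(* Upper half-space {(x, y, t) | t > 0}, with the topology induced by R^3. *)
Definition H3 (R : realType) : Type := set_type [set p : R * R * R | 0 < p.2].

HB.instance Definition _ (R : realType) :=
  Topological.copy (H3 R) (set_type [set p : R * R * R | 0 < p.2]).

Section Hyperbolic_space.
Variable R : realType.
Implicit Types (x y : H3 R) (M N : set (H3 R)) (gamma delta : R -> H3 R).

Definition hx x : R := (set_val x).1.1.
Definition hy x : R := (set_val x).1.2.
Definition ht x : R := (set_val x).2.
Definition hz x : R[i] := hx x +i* hy x.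

Definition hdist x y : R :=
  let u := 1 + (normc (hz x - hz y) ^+ 2 + (ht x - ht y) ^+ 2)
                 / (2 * ht x * ht y) in
  ln (u + Num.sqrt (u ^+ 2 - 1)). (* arcosh u *)

Definition geodesic gamma := forall a b, hdist (gamma a) (gamma b) = `|a - b|.

Definition hline M := exists2 gamma, geodesic gamma & M = range gamma.

(* The half-space metric is conformal to the Euclidean one, so Euclidean
   orthogonality of velocities is hyperbolic orthogonality. *)
Definition perp_at0 gamma delta : Prop :=
  derive1 (hx \o gamma) 0 * derive1 (hx \o delta) 0 +
  derive1 (hy \o gamma) 0 * derive1 (hy \o delta) 0 +
  derive1 (ht \o gamma) 0 * derive1 (ht \o delta) 0 = 0.

Definition perp_lines M N := exists gamma delta,
  [/\ geodesic gamma, geodesic delta, M = range gamma, N = range delta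
    & gamma 0 = delta 0 /\ perp_at0 gamma delta].

Definition segment x y : set (H3 R) :=
  [set z | hdist x z + hdist z y = hdist x y].

Definition hconvex (K : set (H3 R)) :=
  forall x y, K x -> K y -> segment x y `<=` K.

Definition dist_set x M : R := inf [set hdist x y | y in M].

(* Points of the Riemann sphere; None is infinity. *)
Definition sphere := option R[i].

Definition disc : set sphere :=
  [set p | if p is Some z then normc z < 1 else False].

(* Convergence of points of H^3 to a point of the sphere at infinity. *)
Definition cvg_ideal (T : Type) (F : set_system T) (u : T -> H3 R)
    (p : sphere) : Prop :=
  if p is Some w
  then (fun n => normc (hz (u n) - w) ^+ 2 + ht (u n) ^+ 2) @ F --> (0 : R)
  else (fun n => normc (hz (u n)) ^+ 2 + ht (u n) ^+ 2) @ F --> +oo.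

Definition planeP : set (H3 R) :=
  [set x | normc (hz x) ^+ 2 + ht x ^+ 2 = 1].

Definition exteriorP : set (H3 R) :=
  [set x | 1 < normc (hz x) ^+ 2 + ht x ^+ 2].

(* Boundary relative to planeP, which is closed in H^3. *)
Definition frontierP M : set (H3 R) := closure M `&` closure (planeP `\` M).

(* A frontier made of all three lines forces that none separates the others. *)
Definition bound_domain (L LA LB : set (H3 R)) := exists D : set (H3 R),
  [/\ D `<=` planeP, D !=set0, connected D, D `&` frontierP D = set0
    & frontierP D = L `|` LA `|` LB].

(* gamma is the parametrization V_x *)
Definition normal_line x gamma :=
  [/\ planeP x, geodesic gamma, gamma 0 = x,
      forall delta, geodesic delta -> range delta `<=` planeP ->
        delta 0 = x -> perp_at0 gamma delta
    & forall t, 0 < t -> exteriorP (gamma t)].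

(* {V_x(s) | x in M}, for s of either sign *)
Definition normal_shift (s : R) M : set (H3 R) :=
  [set y | exists x gamma, [/\ M x, normal_line x gamma & y = gamma s]].

End Hyperbolic_space.

Section Moebius.
Variable R : realType.
Implicit Types (M : 'M[R[i]]_2) (g h : H3 R -> H3 R) (G : set (H3 R -> H3 R)).

Definition moebius M (p : sphere R) : sphere R :=
  match p with
  | Some z => let d := M 1 0 * z + M 1 1 in
              if d == 0 then None else Some ((M 0 0 * z + M 0 1) / d)
  | None => if M 1 0 == 0 then None else Some (M 0 0 / M 1 0)
  end.

(* For det M = 1: g is the Poincare extension of moebius M to H^3. *)
Definition poincare_ext M g := forall x,
  let n := M 0 0 * hz x + M 0 1 in
  let d := M 1 0 * hz x + M 1 1 in
  let k := normc d ^+ 2 + normc (M 1 0) ^+ 2 * ht x ^+ 2 in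
  hz (g x) = (n * d^* + M 0 0 * (M 1 0)^* * (ht x ^+ 2)%:C) / k%:C /\
  ht (g x) = ht x / k.

(* The element of PSL(2, C) represented by M is g. *)
Definition represents M g := \det M = 1 /\ poincare_ext M g.

Definition inv_map g : H3 R -> H3 R := 'pinv_id setT g.

Definition is_group G :=
  [/\ G id, forall g h, G g -> G h -> G (g \o h)
    & forall g, G g -> exists2 h, G h & g \o h = id /\ h \o g = id].

Definition preserves_disc G := forall g, G g ->
  exists2 M, represents M g & moebius M @` (@disc R) = @disc R.

(* The identity is isolated in G for the topology of PSL(2, C). *)
Definition discrete_group G := exists2 e : R, 0 < e & forall M g,
  represents M g -> G g ->
  (forall i j, normc (M i j - (1%:M : 'M[R[i]]_2) i j) < e) -> g = id.

Definition fuchsian G :=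
  [/\ is_group G, preserves_disc G & discrete_group G].

Definition parabolic M := exists p, forall q, moebius M q = q <-> q = p.

Definition no_parabolic G :=
  forall M g, represents M g -> G g -> ~ parabolic M.

(* A letter (b, e) stands for X or Y (b = true or false), inverted when e. *)
Definition eval_letter g h (l : bool * bool) : H3 R -> H3 R :=
  let f := if l.1 then g else h in if l.2 then inv_map f else f.

Definition eval_word g h (w : seq (bool * bool)) : H3 R -> H3 R :=
  foldr (fun l f => eval_letter g h l \o f) id w.

Definition reduced_word (w : seq (bool * bool)) : bool :=
  sorted (fun l m => ~~ ((l.1 == m.1) && (l.2 != m.2))) w.

Definition generate G g h :=
  [/\ G g, G h & forall f, G f -> exists w, f = eval_word g h w].

Definition free_of_rank_two G := exists X Y,
  generate G X Y /\
  forall w, reduced_word w -> w <> [::] -> eval_word X Y w <> id.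

(* The line along which g is a translation (empty if there is none). *)
Definition axis g : set (H3 R) := [set x | exists gamma (l : R),
  [/\ geodesic gamma, 0 < l, forall t, g (gamma t) = gamma (t + l)
    & range gamma x]].

Definition half_turn (L : set (H3 R)) h :=
  [/\ exists M, represents M h, h \o h = id, h <> id
    & forall x, L x -> h x = x].

Definition limit_set G : set (sphere R) := [set p |
  exists x (u : nat -> H3 R -> H3 R),
    [/\ forall n, G (u n), injective u & cvg_ideal \oo (fun n => u n x) p]].

(* Hyperbolic convex hull of the limit set. *)
Definition hull G : set (H3 R) := [set x | forall K, hconvex K ->
  (forall gamma p q, geodesic gamma -> limit_set G p -> limit_set G q ->
     cvg_ideal -oo gamma p -> cvg_ideal +oo gamma q ->
     range gamma `<=` K) -> K x].

Definition equidistant (W : H3 R -> H3 R) (s : R) : set (H3 R) :=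
  [set x | dist_set x (axis W) = s].

(* The closed strip: its two bounding curves together with the points whose
   component in the complement of these curves is disjoint from the hull. *)
Definition Rec G (W : H3 R -> H3 R) (s : R) : set (H3 R) :=
  let edges := normal_shift s (axis W) `|` normal_shift (- s) (axis W) in
  let open_strips := equidistant W s `\` edges in
  edges `|` [set x | open_strips x /\
                     connected_component open_strips x `&` hull G = set0].

(* The part of L outside the hull that starts on the axis of W. *)
Definition ray G (L : set (H3 R)) (W : H3 R -> H3 R) : set (H3 R) :=
  [set x | (L `\` hull G) x /\
           closure (connected_component (L `\` hull G) x) `&` axis W !=set0].

Definition gorbit G (x : H3 R) : set (H3 R) := [set g x | g in G].

Definition orbit_space G : Type :=
  {Q : set (H3 R) | exists x, Q = gorbit G x}.

Definition qproj G (x : H3 R) : orbit_space G :=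
  exist _ (gorbit G x) (ex_intro _ x erefl).

Definition induces G h (j : orbit_space G -> orbit_space G) :=
  forall x, j (qproj G x) = qproj G (h x).

Definition surface G (A B : H3 R -> H3 R) (s : R) : set (orbit_space G) :=
  qproj G @` normal_shift s (hull G) `|` qproj G @` normal_shift (- s) (hull G) `|`
  qproj G @` Rec G A s `|` qproj G @` Rec G B s `|`
  qproj G @` Rec G (inv_map A \o B) s.

Definition stopping_generators G (A B : H3 R -> H3 R)
    (L LA LB : set (H3 R)) (HL HLA HLB : H3 R -> H3 R) :=
  [/\ [/\ generate G A B, axis A !=set0, axis B !=set0
        & axis A `&` axis B = set0],
      [/\ hline L, L `<=` @planeP R, perp_lines L (axis A)
        & perp_lines L (axis B)],
      [/\ hline LA, LA `<=` @planeP R, hline LB & LB `<=` @planeP R],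
      [/\ half_turn L HL, half_turn LA HLA, half_turn LB HLB,
          A = HL \o HLA & B = HL \o HLB]
    & bound_domain L LA LB].

End Moebius.

Arguments surface {R} G A B s.
Arguments induces {R} G h j.

(* Main.v *)
(* In the hyperboloid model, where [planeP] is [c3 = 0], the half-turn about a line
   of [planeP] with unit normal [n] is [refl n]: it restricts to the reflection of
   [planeP] in that line and reverses the sign of [c3]. As [L], [LA], [LB] bound a
   domain and [G] has no parabolics, the half-planes beyond them are disjoint, also
   at infinity. So [G] consists of the even words in three reflections, and ping-pong
   describes the orbits of points of the chamber between the three lines.
   The axes of [A], [B], [A^-1 B] are the common perpendiculars of pairs of lines;
   the distance beyond such a wall is bounded on each [G]-orbit, so the hull does not
   cross it, and hence [Rec] is the part of the tube around the axis beyond the wall.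
   A point of the surface fixed by [j] lifts to a fixed point of an odd word. Odd words
   change the sign of [c3], so this point lies in [planeP], hence in some [Rec] at
   distance [s] beyond a wall; an even word takes it to one of the two lines that
   cross the wall, where the distance to the wall leaves only the stated points. *)

(* On the hyperboloid, isometries are linear maps preserving [ip], distances are read off from [ip],
   and half-spaces are inequalities [ip _ Y <= 0]. Such an inequality also makes sense at ideal
   points, through null vectors, so a half-space contains the hull as soon as [ip _ Y] is bounded
   above on every orbit. Unit normals of two lines, neither of which is crossed by the other,
   satisfy [1 <= ip n m ^+ 2]. The value 1 would make the product of the two half-turns parabolic
   unless it is the identity. Once it is excluded, the sum of two outer normals is timelike and
   their product is below -1; the signs in ping-pong and in the position of the walls all come from
   this. The obstacle is that [Rec] is defined by a component disjoint from the hull: the bound on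
   the hull clears the outer strip, but the inner strip must be shown to meet the hull. It does
   because the hull also contains a neighbouring axis, which goes arbitrarily deep on the inner
   side, and because the tube meets [planeP] at depth [sinh s]. *)
From HB Require Import structures.
Require Import Defs.
From mathcomp Require Import all_boot all_order all_algebra.
From mathcomp Require Import all_classical all_reals all_analysis.
From mathcomp Require Import complex ring lra.

Set Implicit Arguments.
Unset Strict Implicit.
Unset Printing Implicit Defensive.

Import Order.TTheory GRing.Theory Num.Theory.
Import numFieldNormedType.Exports.

Local Open Scope classical_set_scope.
Local Open Scope ring_scope.

(** * Hyperbolic functions *)

Section HyperbolicFunctions.
Variable R : realType.
Implicit Types a b t x : R.

(* Locked, otherwise unification in the ring lemmas unfolds them. *)
Fact hyperbolic_key : unit. Proof. exact: tt. Qed.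
Definition cosh t : R := locked_with hyperbolic_key ((expR t + expR (- t)) / 2).
Definition sinh t : R := locked_with hyperbolic_key ((expR t - expR (- t)) / 2).

Lemma coshE t : cosh t = (expR t + expR (- t)) / 2.
Proof. by rewrite /cosh unlock. Qed.

Lemma sinhE t : sinh t = (expR t - expR (- t)) / 2.
Proof. by rewrite /sinh unlock. Qed.

Lemma coshN t : cosh (- t) = cosh t.
Proof. by rewrite !coshE opprK addrC. Qed.

Lemma sinhN t : sinh (- t) = - sinh t.
Proof. by rewrite !sinhE opprK -mulNr opprB. Qed.

Lemma cosh0 : cosh 0 = 1.
Proof. by rewrite coshE oppr0 expR0; lra. Qed.

Lemma sinh0 : sinh 0 = 0.
Proof. by rewrite sinhE oppr0 expR0; lra. Qed.

Lemma coshD a b : cosh (a + b) = cosh a * cosh b + sinh a * sinh b.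
Proof. by rewrite !coshE !sinhE opprD !expRD; lra. Qed.

Lemma sinhD a b : sinh (a + b) = sinh a * cosh b + cosh a * sinh b.
Proof. by rewrite !coshE !sinhE opprD !expRD; lra. Qed.

Lemma coshB a b : cosh (a - b) = cosh a * cosh b - sinh a * sinh b.
Proof. by rewrite coshD coshN sinhN mulrN. Qed.

Lemma sinhB a b : sinh (a - b) = sinh a * cosh b - cosh a * sinh b.
Proof. by rewrite sinhD coshN sinhN mulrN. Qed.

Lemma cosh2Bsinh2 t : cosh t ^+ 2 - sinh t ^+ 2 = 1.
Proof. by rewrite -cosh0 -(subrr t) coshB !expr2. Qed.

Lemma sinh2E t : sinh t ^+ 2 = cosh t ^+ 2 - 1.
Proof. by have := cosh2Bsinh2 t; lra. Qed.

Lemma cosh_gt0 t : 0 < cosh t.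
Proof. by rewrite coshE divr_gt0 ?addr_gt0 ?expR_gt0. Qed.

Lemma cosh_norm t : cosh `|t| = cosh t.
Proof. by case: (ger0P t) => // _; rewrite coshN. Qed.

Lemma ltr_sinh : {mono sinh : a b / a < b}.
Proof.
apply: leW_mono; apply: le_mono => a b ab; rewrite !sinhE.
have := ab; rewrite -ltr_expR => ?.
have : expR (- b) < expR (- a) by rewrite ltr_expR ltrN2.
lra.
Qed.

Lemma sinh_gt0 t : (0 < sinh t) = (0 < t).
Proof. by rewrite -[in LHS]sinh0 ltr_sinh. Qed.

Lemma sinh_lt0 t : (sinh t < 0) = (t < 0).
Proof. by rewrite -[in LHS]sinh0 ltr_sinh. Qed.

Lemma sinh_ge0 t : (0 <= sinh t) = (0 <= t).
Proof. by rewrite leNgt sinh_lt0 -leNgt. Qed.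

Lemma sinh_inj : injective sinh.
Proof.
move=> a b; apply: contra_eq => /lt_total /orP[]; rewrite -ltr_sinh => h.
  by rewrite lt_eqF.
by rewrite gt_eqF.
Qed.

Lemma cosh_inj a b : 0 <= a -> 0 <= b -> cosh a = cosh b -> a = b.
Proof.
move=> a0 b0 eq_ab; apply: sinh_inj; apply/eqP.
by rewrite -(eqrXn2 (n := 2)) ?sinh_ge0 // !sinh2E eq_ab.
Qed.

(** Written exactly as in [hdist], so that the two agree by unfolding. *)
Definition arcosh x : R := ln (x + Num.sqrt (x ^+ 2 - 1)).

Lemma arcoshK x : 1 <= x -> cosh (arcosh x) = x /\ 0 <= arcosh x.
Proof.
rewrite /arcosh => x1; have q0 : 0 <= x ^+ 2 - 1 by rewrite subr_ge0 exprn_ege1.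
have s0 := sqrtr_ge0 (x ^+ 2 - 1).
have s2 := sqr_sqrtr q0; set s := Num.sqrt _ in s0 s2 *.
have xs1 : 1 <= x + s by lra.
have xs : (x + s) != 0 by lra.
split; last exact: ln_ge0.
rewrite coshE expRN lnK ?posrE; last by lra.
have -> : (x + s)^-1 = x - s.
  by apply: (mulfI xs); rewrite mulfV // mulrC -subr_sqr s2; ring.
lra.
Qed.

Lemma sinh_surj x : exists t, sinh t = x.
Proof.
have [|h h0] := @arcoshK (Num.sqrt (1 + x ^+ 2)).
  by rewrite -{1}sqrtr1 ler_sqrt ?addr_ge0 ?sqr_ge0 // lerDl sqr_ge0.
have s2 : sinh (arcosh (Num.sqrt (1 + x ^+ 2))) ^+ 2 = x ^+ 2.
  by rewrite sinh2E h sqr_sqrtr ?addr_ge0 ?sqr_ge0 //; lra.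
move/eqP: s2; rewrite eqf_sqr => /orP[]/eqP e; first by eexists; exact: e.
by exists (- arcosh (Num.sqrt (1 + x ^+ 2))); rewrite sinhN e opprK.
Qed.

Lemma cosh_surj x : 1 <= x -> exists2 t, 0 <= t & cosh t = x.
Proof. by move=> /arcoshK[? ?]; exists (arcosh x). Qed.

Lemma is_derive_cosh t : is_derive t 1 cosh (sinh t).
Proof.
rewrite sinhE (_ : cosh = fun u => (expR u + expR (- u)) / 2); last first.
  by apply/funext => u; rewrite coshE.
have h : is_derive t 1 (fun u : R => expR (- u)) (- expR (- t)).
  have h1 : is_derive t 1 (@GRing.opp R) (-1) by apply: is_deriveN.
  have h2 := @is_derive_expR R (- t).
  by have := is_derive1_comp h2 h1; rewrite mulrN1.
have -> : (fun u => (expR u + expR (- u)) / 2) =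
  (2^-1 : R) *: ((fun u => expR u) + (fun u => expR (- u))).
  by apply/funext => u /=; rewrite mulrC.
by apply: is_derive_eq; rewrite /GRing.scale /= mulrC.
Qed.

End HyperbolicFunctions.

Section HyperbolicDerivatives.
Variable R : realType.

Lemma is_derive_sinh (t : R) : is_derive t 1 (@sinh R) (cosh t).
Proof.
rewrite coshE (_ : (@sinh R) = fun u => (expR u - expR (- u)) / 2); last first.
  by apply/funext => u; rewrite sinhE.
have h : is_derive t 1 (fun u : R => expR (- u)) (- expR (- t)).
  have h1 : is_derive t 1 (@GRing.opp R) (-1) by apply: is_deriveN.
  have h2 := @is_derive_expR R (- t).
  by have := is_derive1_comp h2 h1; rewrite mulrN1.
have -> : (fun u => (expR u - expR (- u)) / 2) =
  (2^-1 : R) *: ((fun u => expR u) - (fun u => expR (- u))).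
  by apply/funext => u /=; rewrite mulrC.
by apply: is_derive_eq; rewrite opprK /GRing.scale /= mulrC.
Qed.

Lemma continuous_cosh : continuous (@cosh R).
Proof.
move=> t; apply: differentiable_continuous; apply/derivable1_diffP.
by case: (is_derive_cosh t).
Qed.

Lemma continuous_sinh : continuous (@sinh R).
Proof.
move=> t; apply: differentiable_continuous; apply/derivable1_diffP.
by case: (is_derive_sinh t).
Qed.

End HyperbolicDerivatives.

(** * The hyperboloid model *)

Section Minkowski.
Variable R : realType.

Definition mink := (R * R * R * R)%type.
HB.instance Definition _ := GRing.Lmodule.on mink.
Implicit Types X Y Z U W : mink.

Definition c0 X : R := X.1.1.1.
Definition c1 X : R := X.1.1.2.
Definition c2 X : R := X.1.2.
Definition c3 X : R := X.2.

Lemma c0D X Y : c0 (X + Y) = c0 X + c0 Y. Proof. by []. Qed.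
Lemma c1D X Y : c1 (X + Y) = c1 X + c1 Y. Proof. by []. Qed.
Lemma c2D X Y : c2 (X + Y) = c2 X + c2 Y. Proof. by []. Qed.
Lemma c3D X Y : c3 (X + Y) = c3 X + c3 Y. Proof. by []. Qed.
Lemma c0N X : c0 (- X) = - c0 X. Proof. by []. Qed.
Lemma c1N X : c1 (- X) = - c1 X. Proof. by []. Qed.
Lemma c2N X : c2 (- X) = - c2 X. Proof. by []. Qed.
Lemma c3N X : c3 (- X) = - c3 X. Proof. by []. Qed.
Lemma c0Z a X : c0 (a *: X) = a * c0 X. Proof. by []. Qed.
Lemma c1Z a X : c1 (a *: X) = a * c1 X. Proof. by []. Qed.
Lemma c2Z a X : c2 (a *: X) = a * c2 X. Proof. by []. Qed.
Lemma c3Z a X : c3 (a *: X) = a * c3 X. Proof. by []. Qed.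
Lemma c00 : c0 0 = 0. Proof. by []. Qed.
Lemma c10 : c1 0 = 0. Proof. by []. Qed.
Lemma c20 : c2 0 = 0. Proof. by []. Qed.
Lemma c30 : c3 0 = 0. Proof. by []. Qed.

Lemma c0T (a b c d : R) : c0 (a, b, c, d) = a. Proof. by []. Qed.
Lemma c1T (a b c d : R) : c1 (a, b, c, d) = b. Proof. by []. Qed.
Lemma c2T (a b c d : R) : c2 (a, b, c, d) = c. Proof. by []. Qed.
Lemma c3T (a b c d : R) : c3 (a, b, c, d) = d. Proof. by []. Qed.

Definition cT := (c0T, c1T, c2T, c3T).

Definition cE := (c0D, c1D, c2D, c3D, c0N, c1N, c2N, c3N,
  c0Z, c1Z, c2Z, c3Z, c00, c10, c20, c30).

Lemma minkP X Y :
  c0 X = c0 Y -> c1 X = c1 Y -> c2 X = c2 Y -> c3 X = c3 Y -> X = Y.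
Proof.
by case: X Y => [[[? ?] ?] ?] [[[? ?] ?] ?]; rewrite /c0 /c1 /c2 /c3 /= => -> -> -> ->.
Qed.

(** The Lorentz form, with [c0] as time coordinate. *)
Definition ip X Y : R := c1 X * c1 Y + c2 X * c2 Y + c3 X * c3 Y - c0 X * c0 Y.

Lemma ipC X Y : ip X Y = ip Y X. Proof. by rewrite /ip; ring. Qed.
Lemma ipDl X Y Z : ip (X + Y) Z = ip X Z + ip Y Z.
Proof. by rewrite /ip !cE; ring. Qed.
Lemma ipZl a X Y : ip (a *: X) Y = a * ip X Y.
Proof. by rewrite /ip !cE; ring. Qed.
Lemma ipNl X Y : ip (- X) Y = - ip X Y.
Proof. by rewrite /ip !cE; ring. Qed.
Lemma ipDr X Y Z : ip Z (X + Y) = ip Z X + ip Z Y.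
Proof. by rewrite /ip !cE; ring. Qed.
Lemma ipZr a X Y : ip Y (a *: X) = a * ip Y X.
Proof. by rewrite /ip !cE; ring. Qed.
Lemma ipNr X Y : ip Y (- X) = - ip Y X.
Proof. by rewrite /ip !cE; ring. Qed.
Lemma ip0l X : ip 0 X = 0.
Proof. by rewrite /ip !cE; ring. Qed.

Definition ipE := (ipDl, ipZl, ipNl, ipDr, ipZr, ipNr).

Definition e3 : mink := (0, 0, 0, 1).

Lemma ip_e3 X : ip X e3 = c3 X.
Proof. by rewrite /ip /e3 /c0 /c1 /c2 /c3 /=; ring. Qed.

Lemma ip_e3l X : ip e3 X = c3 X. Proof. by rewrite ipC ip_e3. Qed.

Lemma ip_e3e3 : ip e3 e3 = 1. Proof. by rewrite ip_e3. Qed.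

Lemma ltr_sqr_pos (a b : R) : 0 < b -> a ^+ 2 < b ^+ 2 -> a < b.
Proof.
move=> b0 ab; case: (ltP a 0) => [a0|a0]; first exact: lt_trans b0.
by rewrite -(ltr_pXn2r (n := 2)) ?nnegrE // ltW.
Qed.

Definition hyp X := ip X X = -1 /\ 0 < c0 X.

Definition timelike X := ip X X < 0 /\ 0 < c0 X.

Lemma hyp_timelike X : hyp X -> timelike X.
Proof. by case=> XX X0; split; rewrite ?XX // ltrN10. Qed.

Lemma hyp_c0_ge1 X : hyp X -> 1 <= c0 X.
Proof.
case=> XX X0; rewrite -[leLHS](expr1n _ 2) -(ler_pXn2r (n := 2)) ?nnegrE ?expr1n //; last exact: ltW.
have := sqr_ge0 (c1 X); have := sqr_ge0 (c2 X); have := sqr_ge0 (c3 X).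
move: XX; rewrite /ip; lra.
Qed.

(** The reversed Cauchy-Schwarz inequality: Lagrange's identity bounds the product of the space
    parts strictly by the product of the time parts. *)
Lemma timelike_causal_lt0 X Y :
  timelike X -> ip Y Y <= 0 -> 0 < c0 Y -> ip X Y < 0.
Proof.
case=> XX X0 YY Y0.
have cs : (c1 X * c1 Y + c2 X * c2 Y + c3 X * c3 Y) ^+ 2 < (c0 X * c0 Y) ^+ 2.
  have lagrange : (c1 X * c1 Y + c2 X * c2 Y + c3 X * c3 Y) ^+ 2 =
    (c1 X ^+ 2 + c2 X ^+ 2 + c3 X ^+ 2) * (c1 Y ^+ 2 + c2 Y ^+ 2 + c3 Y ^+ 2)
    - (c1 X * c2 Y - c2 X * c1 Y) ^+ 2 - (c1 X * c3 Y - c3 X * c1 Y) ^+ 2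
    - (c2 X * c3 Y - c3 X * c2 Y) ^+ 2 by ring.
  have := sqr_ge0 (c1 X * c2 Y - c2 X * c1 Y).
  have := sqr_ge0 (c1 X * c3 Y - c3 X * c1 Y).
  have := sqr_ge0 (c2 X * c3 Y - c3 X * c2 Y).
  suff : (c1 X ^+ 2 + c2 X ^+ 2 + c3 X ^+ 2) * (c1 Y ^+ 2 + c2 Y ^+ 2 + c3 Y ^+ 2)
    < (c0 X * c0 Y) ^+ 2 by rewrite lagrange; lra.
  apply: (@le_lt_trans _ _ ((c1 X ^+ 2 + c2 X ^+ 2 + c3 X ^+ 2) * c0 Y ^+ 2)).
    rewrite ler_wpM2l ?addr_ge0 ?sqr_ge0 //; move: YY; rewrite /ip; lra.
  rewrite exprMn ltr_pM2r ?exprn_gt0 //; move: XX; rewrite /ip; lra.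
suff : c1 X * c1 Y + c2 X * c2 Y + c3 X * c3 Y < c0 X * c0 Y by rewrite /ip; lra.
by apply: ltr_sqr_pos => //; exact: mulr_gt0.
Qed.

Lemma timelike_ip_lt0 X Y : timelike X -> timelike Y -> ip X Y < 0.
Proof. by move=> tX [YY Y0]; apply: timelike_causal_lt0 => //; exact: ltW. Qed.

(** Otherwise [W] or [- W] would be causal and future-pointing, hence not orthogonal to [X], or
    [c0 W = 0] and the form is a sum of squares. *)
Lemma ip_orth_gt0 X W : timelike X -> ip X W = 0 -> W != 0 -> 0 < ip W W.
Proof.
move=> tX XW W0; rewrite ltNge; apply/negP => WW.
have [w0|w0|w0] := ltgtP (c0 W) 0.
- have := timelike_causal_lt0 tX (Y := - W).
  rewrite !ipE c0N opprK XW oppr0 ltxx oppr_gt0 => h; by have := h WW w0.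
- by have := timelike_causal_lt0 tX WW w0; rewrite XW ltxx.
- have := sqr_ge0 (c1 W); have := sqr_ge0 (c2 W); have := sqr_ge0 (c3 W) => h3 h2 h1.
  move: WW; rewrite /ip w0 => WW.
  have z (a : R) : 0 <= a ^+ 2 -> a ^+ 2 <= 0 -> a = 0.
    by move=> ? ?; apply/eqP; rewrite -sqrf_eq0; apply/eqP; lra.
  move/eqP: W0; apply; apply: minkP; rewrite ?cE //; apply: z => //; lra.
Qed.

Lemma ip_orth_ge0 X W : timelike X -> ip X W = 0 -> 0 <= ip W W.
Proof.
move=> tX XW; have [->|W0] := eqVneq W 0; first by rewrite ip0l.
exact/ltW/(ip_orth_gt0 tX).
Qed.

Lemma ip_orth_eq0 X W : timelike X -> ip X W = 0 -> ip W W = 0 -> W = 0.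
Proof.
move=> tX XW WW; apply/eqP/negPn/negP => W0.
by have := ip_orth_gt0 tX XW W0; rewrite WW ltxx.
Qed.

Lemma hyp_ip_leN1 X Y : hyp X -> hyp Y -> ip X Y <= -1.
Proof.
move=> hX hY; have k0 := timelike_ip_lt0 (hyp_timelike hX) (hyp_timelike hY).
have [[XX _] [YY _]] := (hX, hY).
have := ip_orth_ge0 (W := Y + ip X Y *: X) (hyp_timelike hX).
rewrite !ipE XX YY (ipC Y X) => h; have {}h := h ltac:(ring).
suff : 1 <= - ip X Y by lra.
rewrite -(ler_pXn2r (n := 2)) ?nnegrE ?expr1n ?sqrrN //; [lra|lra].
Qed.

Lemma hyp_ip_eqN1 X Y : hyp X -> hyp Y -> ip X Y = -1 -> X = Y.
Proof.
move=> hX hY XY; have [[XX _] [YY _]] := (hX, hY).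
have := @ip_orth_eq0 X (Y - X) (hyp_timelike hX).
rewrite !ipE XX YY (ipC Y X) XY => h.
by apply/esym/eqP; rewrite -subr_eq0; apply/eqP; apply: h; ring.
Qed.

Definition normalize X := (Num.sqrt (- ip X X))^-1 *: X.

Lemma hyp_normalize X : timelike X -> hyp (normalize X).
Proof.
case=> XX X0; have p : 0 < - ip X X by rewrite oppr_gt0.
have s0 : 0 < Num.sqrt (- ip X X) by rewrite sqrtr_gt0.
split; last by rewrite c0Z mulr_gt0 ?invr_gt0.
rewrite /normalize !ipE mulrA -invfM -expr2 sqr_sqrtr ?(ltW p) //.
by rewrite invrN mulNr mulVf // lt_eqF.
Qed.

(* [c3 = 0] cuts out R^{2,1}; Cramer's rule for an orthonormal frame. *)
Lemma frame_eq0 X Y Z W : c3 X = 0 -> c3 Y = 0 -> c3 Z = 0 -> c3 W = 0 ->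
  ip X X = -1 -> ip Y Y = 1 -> ip Z Z = 1 ->
  ip X Y = 0 -> ip X Z = 0 -> ip Y Z = 0 ->
  ip W X = 0 -> ip W Y = 0 -> ip W Z = 0 -> W = 0.
Proof.
move=> X3 Y3 Z3 W3 XX YY ZZ XY XZ YZ WX WY WZ.
pose d := c0 X * (c1 Y * c2 Z - c2 Y * c1 Z) - c1 X * (c0 Y * c2 Z - c2 Y * c0 Z)
          + c2 X * (c0 Y * c1 Z - c1 Y * c0 Z).
have d2 : d ^+ 2 = - (ip X X * ip Y Y * ip Z Z + 2 * ip X Y * ip Y Z * ip X Z
    - ip X X * ip Y Z ^+ 2 - ip Y Y * ip X Z ^+ 2 - ip Z Z * ip X Y ^+ 2).
  by rewrite /d /ip X3 Y3 Z3; ring.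
have d0 : d != 0.
  by rewrite -sqrf_eq0 d2 XX YY ZZ XY XZ YZ; apply/eqP; lra.
have w0 : d * c0 W = - (ip W X * (c1 Y * c2 Z - c2 Y * c1 Z)
   - ip W Y * (c1 X * c2 Z - c2 X * c1 Z) + ip W Z * (c1 X * c2 Y - c2 X * c1 Y)).
  by rewrite /d /ip X3 Y3 Z3 W3; ring.
have w1 : d * c1 W = - (ip W X * (c0 Y * c2 Z - c2 Y * c0 Z)
   - ip W Y * (c0 X * c2 Z - c2 X * c0 Z) + ip W Z * (c0 X * c2 Y - c2 X * c0 Y)).
  by rewrite /d /ip X3 Y3 Z3 W3; ring.
have w2 : d * c2 W = (ip W X * (c0 Y * c1 Z - c1 Y * c0 Z)
   - ip W Y * (c0 X * c1 Z - c1 X * c0 Z) + ip W Z * (c0 X * c1 Y - c1 X * c0 Y)).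
  by rewrite /d /ip X3 Y3 Z3 W3; ring.
have z a : d * a = 0 -> a = 0.
  by move/eqP; rewrite mulf_eq0 (negPf d0) => /eqP.
by apply: minkP; rewrite ?cE ?W3 //; apply: z; rewrite ?w0 ?w1 ?w2 WX WY WZ; ring.
Qed.

(** The difference of the two sides has [c3 = 0] and is orthogonal to the frame. The sign of the
    first coefficient comes from [ip X X = -1]. *)
Lemma frame_expand X Y Z W : c3 X = 0 -> c3 Y = 0 -> c3 Z = 0 ->
  ip X X = -1 -> ip Y Y = 1 -> ip Z Z = 1 ->
  ip X Y = 0 -> ip X Z = 0 -> ip Y Z = 0 ->
  W = - ip W X *: X + ip W Y *: Y + ip W Z *: Z + c3 W *: e3.
Proof.
move=> X3 Y3 Z3 XX YY ZZ XY XZ YZ; apply/eqP; rewrite -subr_eq0; apply/eqP.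
have e : c3 e3 = 1 by [].
by apply: (@frame_eq0 X Y Z); rewrite ?cE ?ipE ?ip_e3l ?(ipC Y X) ?(ipC Z X)
  ?(ipC Z Y) ?XX ?YY ?ZZ ?XY ?XZ ?YZ ?X3 ?Y3 ?Z3 ?e //; ring.
Qed.

(** The vector product of R^{2,1}, with signs adapted to [ip]. For a point of [planeP] and a unit
    tangent vector there, it is a unit normal of the line they span. *)
Definition cross X Y : mink := (- (c1 X * c2 Y - c2 X * c1 Y),
  c2 X * c0 Y - c0 X * c2 Y, c0 X * c1 Y - c1 X * c0 Y, 0).

Lemma c3_cross X Y : c3 (cross X Y) = 0. Proof. by []. Qed.

Lemma ip_crossl X Y : ip X (cross X Y) = 0.
Proof. by rewrite /ip /cross /c0 /c1 /c2 /c3 /=; ring. Qed.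

Lemma ip_crossr X Y : ip Y (cross X Y) = 0.
Proof. by rewrite /ip /cross /c0 /c1 /c2 /c3 /=; ring. Qed.

Lemma ip_cross X Y : c3 X = 0 -> c3 Y = 0 ->
  ip (cross X Y) (cross X Y) = ip X Y ^+ 2 - ip X X * ip Y Y.
Proof.
by move=> X3 Y3; rewrite /ip X3 Y3 /cross /c0 /c1 /c2 /c3 /=; ring.
Qed.

End Minkowski.

Arguments c0 {R} X : simpl never.
Arguments c1 {R} X : simpl never.
Arguments c2 {R} X : simpl never.
Arguments c3 {R} X : simpl never.

(** * Distances, geodesics and segments in the hyperboloid model *)

Section Hyperboloid.
Variable R : realType.
Notation mink := (mink R).
Implicit Types (x y z : H3 R) (X Y V W : mink) (gamma : R -> H3 R).

Lemma ht_gt0 x : 0 < ht x.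
Proof. exact: (set_mem (valP x)). Qed.

Lemma H3P x y : hx x = hx y -> hy x = hy y -> ht x = ht y -> x = y.
Proof.
rewrite /hx /hy /ht => ex ey et; apply: val_inj; rewrite -!set_valE.
move: ex ey et; move: (set_val x) (set_val y).
by move=> [[? ?] ?] [[? ?] ?] /= -> -> ->.
Qed.

(* From the half-space to the hyperboloid [hyp], which carries [planeP] to [c3 = 0]. *)
Definition emb x : mink :=
  let r2 := hx x ^+ 2 + hy x ^+ 2 + ht x ^+ 2 in
  ((1 + r2) / (2 * ht x), hx x / ht x, hy x / ht x, (r2 - 1) / (2 * ht x)).

Lemma c0Bc3_emb x : c0 (emb x) - c3 (emb x) = (ht x)^-1.
Proof. by have t0 := ht_gt0 x; rewrite /c0 /c3 /=; field; rewrite gt_eqF. Qed.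

Lemma htE x : ht x = (c0 (emb x) - c3 (emb x))^-1.
Proof. by rewrite c0Bc3_emb invrK. Qed.

Lemma hxE x : hx x = c1 (emb x) / (c0 (emb x) - c3 (emb x)).
Proof. by rewrite c0Bc3_emb invrK /c1 /= divfK // gt_eqF ?ht_gt0. Qed.

Lemma hyE x : hy x = c2 (emb x) / (c0 (emb x) - c3 (emb x)).
Proof. by rewrite c0Bc3_emb invrK /c2 /= divfK // gt_eqF ?ht_gt0. Qed.

Lemma emb_inj : injective emb.
Proof. by move=> x y e; apply: H3P; rewrite ?hxE ?hyE ?htE e. Qed.

Lemma hyp_emb x : hyp (emb x).
Proof.
have t0 := ht_gt0 x; split.
  by rewrite /ip /c0 /c1 /c2 /c3 /=; field; rewrite gt_eqF.
rewrite /c0 /= divr_gt0 ?mulr_gt0 // -!addrA ltr_pwDl ?addr_ge0 ?sqr_ge0 //.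
Qed.

Lemma emb_surj X : hyp X -> exists x, emb x = X.
Proof.
move=> [XX X0].
have d0 : 0 < c0 X - c3 X.
  have : c3 X < c0 X.
    apply: ltr_sqr_pos => //; have := sqr_ge0 (c1 X); have := sqr_ge0 (c2 X).
    by move: XX; rewrite /ip; lra.
  by rewrite subr_gt0.
have p0 : [set p : R * R * R | 0 < p.2]
    (c1 X / (c0 X - c3 X), c2 X / (c0 X - c3 X), (c0 X - c3 X)^-1).
  by rewrite /= invr_gt0.
exists (SigSub (mem_set p0)).
have n0 : c0 X - c3 X != 0 by rewrite gt_eqF.
have e : c1 X ^+ 2 + c2 X ^+ 2 = (c0 X - c3 X) * (c0 X + c3 X) - 1.
  by move: XX; rewrite /ip; lra.
have e' : (c1 X / (c0 X - c3 X)) ^+ 2 + (c2 X / (c0 X - c3 X)) ^+ 2 =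
  ((c0 X - c3 X) * (c0 X + c3 X) - 1) / (c0 X - c3 X) ^+ 2.
  by rewrite -e; field.
apply: minkP; rewrite /emb /c0 /c1 /c2 /c3 /= /hx /hy /ht !set_valE /= -/(c0 X)
  -/(c1 X) -/(c2 X) -/(c3 X) ?e'; field; rewrite ?n0 //.
Qed.

Lemma origin_subproof : [set p : R * R * R | 0 < p.2] (0, 0, 1).
Proof. exact: ltr01. Qed.

(** Inverse to [emb]; off the hyperboloid the value is the arbitrary point (0, 0, 1). *)
Definition pt X : H3 R :=
  xget (SigSub (mem_set origin_subproof) : H3 R) [set x | emb x = X].

Lemma ptK X : hyp X -> emb (pt X) = X.
Proof. by move=> /emb_surj[x xX]; rewrite /pt; case: xgetP => [y _ ->//|/(_ x)]. Qed.

Lemma sqr_normc (a b : R) : Normc.normc (a +i* b)%C ^+ 2 = a ^+ 2 + b ^+ 2.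
Proof. by rewrite /= sqr_sqrtr // addr_ge0 ?sqr_ge0. Qed.

Lemma hdistE x y : hdist x y = arcosh (- ip (emb x) (emb y)).
Proof.
have t0 := ht_gt0 x; have t1 := ht_gt0 y.
suff e : - ip (emb x) (emb y) = 1 + (Normc.normc (hz x - hz y) ^+ 2
    + (ht x - ht y) ^+ 2) / (2 * ht x * ht y) by rewrite /hdist /arcosh e.
rewrite (_ : hz x - hz y = ((hx x - hx y) +i* (hy x - hy y))%C) // sqr_normc.
by rewrite /ip /c0 /c1 /c2 /c3 /=; field; rewrite !gt_eqF.
Qed.

Lemma hdistP x y : cosh (hdist x y) = - ip (emb x) (emb y) /\ 0 <= hdist x y.
Proof.
rewrite hdistE; apply: arcoshK.
by have := hyp_ip_leN1 (hyp_emb x) (hyp_emb y); lra.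
Qed.

Lemma cosh_hdist x y : cosh (hdist x y) = - ip (emb x) (emb y).
Proof. by case: (hdistP x y). Qed.

Lemma hdist_ge0 x y : 0 <= hdist x y.
Proof. by case: (hdistP x y). Qed.

Lemma hdist_eq x y a : 0 <= a -> - ip (emb x) (emb y) = cosh a -> hdist x y = a.
Proof.
by move=> a0 e; apply: cosh_inj => //; rewrite ?hdist_ge0 // cosh_hdist.
Qed.

Lemma normc_hz2 x : Normc.normc (hz x) ^+ 2 + ht x ^+ 2 = hx x ^+ 2 + hy x ^+ 2 + ht x ^+ 2.
Proof. by rewrite /hz sqr_normc. Qed.

Lemma planePE x : @planeP R x <-> c3 (emb x) = 0.
Proof.
have t0 := ht_gt0 x; rewrite /planeP /= normc_hz2 /c3 /=; split => [->|].
  by rewrite subrr mul0r.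
by move/eqP; rewrite mulf_eq0 invr_eq0 mulf_eq0 !(gt_eqF t0) pnatr_eq0 !orbF subr_eq0 => /eqP.
Qed.

Lemma exteriorPE x : @exteriorP R x <-> 0 < c3 (emb x).
Proof.
have t0 := ht_gt0 x; rewrite /exteriorP /= normc_hz2 /c3 /=.
by rewrite pmulr_lgt0 ?subr_gt0 // invr_gt0 mulr_gt0.
Qed.

Definition line X V t : mink := cosh t *: X + sinh t *: V.

(* [X] a point of the hyperboloid and [V] a unit tangent vector at [X]. *)
Definition frame X V := [/\ hyp X, ip V V = 1 & ip X V = 0].

Lemma ip_line X V Y t : ip (line X V t) Y = cosh t * ip X Y + sinh t * ip V Y.
Proof. by rewrite /line !ipE. Qed.

Lemma ip_liner X V Y t : ip Y (line X V t) = cosh t * ip X Y + sinh t * ip V Y.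
Proof. by rewrite ipC ip_line. Qed.

Lemma ip_line_line X V a b : frame X V -> ip (line X V a) (line X V b) = - cosh (a - b).
Proof.
move=> [[XX _] VV XV].
by rewrite ip_line !ip_liner (ipC V X) XX VV XV coshB; ring.
Qed.

Lemma c3_line X V t : c3 X = 0 -> c3 V = 0 -> c3 (line X V t) = 0.
Proof. by move=> X3 V3; rewrite /line !cE X3 V3 !mulr0 addr0. Qed.

Lemma hyp_line X V t : frame X V -> hyp (line X V t).
Proof.
move=> fXV; have [hX VV XV] := fXV.
have e : ip (line X V t) (line X V t) = -1 by rewrite ip_line_line // subrr cosh0.
split => //.
(* On the lower sheet, [- line X V t] would be timelike, but its product with [X] is [cosh t], which
   is positive. *)
have tl : timelike (- line X V t) -> False.
  move=> tl; have := timelike_ip_lt0 tl (hyp_timelike hX).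
  case: hX => XX _; rewrite ipNl ip_line XX (ipC V) XV.
  by have := cosh_gt0 t; lra.
have [h|//|h] := ltgtP (c0 (line X V t)) 0.
  by exfalso; apply: tl; split; rewrite ?ipNl ?ipNr ?c0N ?opprK ?e ?ltrN10 // oppr_gt0.
exfalso; move: e; rewrite /ip h.
have := sqr_ge0 (c1 (line X V t)); have := sqr_ge0 (c2 (line X V t)).
have := sqr_ge0 (c3 (line X V t)); lra.
Qed.

Lemma emb_pt_line X V t : frame X V -> emb (pt (line X V t)) = line X V t.
Proof. by move=> f; rewrite ptK //; exact: hyp_line. Qed.

Lemma geodesic_line X V gamma : frame X V ->
  (forall t, emb (gamma t) = line X V t) -> geodesic gamma.
Proof.
move=> f e a b; apply: hdist_eq; first exact: normr_ge0.
by rewrite !e ip_line_line // opprK cosh_norm.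
Qed.

Lemma geodesic_pt X V : frame X V -> geodesic (fun t => pt (line X V t)).
Proof. by move=> f; apply: (geodesic_line f) => t; exact: emb_pt_line. Qed.

(* A point at distances [|a|] and [|a - b|] from [line 0] and [line b] lies on
   the line: the component of [Y] orthogonal to the frame has norm zero. *)
Lemma line_uniq X V Y a b : frame X V -> hyp Y -> b != 0 ->
  ip Y X = - cosh a -> ip Y (line X V b) = - cosh (a - b) -> Y = line X V a.
Proof.
move=> f hY b0 YX; rewrite ip_liner (ipC X) YX coshB => e.
have [hX VV XV] := f; have [XX _] := hX; have [YY _] := hY.
have sb0 : sinh b != 0 by apply: contra_neq b0; rewrite -[X in _ = X](@sinh0 R) => /sinh_inj.
have YV : ip Y V = sinh a.
  by apply: (mulfI sb0); rewrite (ipC Y V); lra.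
apply/eqP; rewrite -subr_eq0; apply/eqP.
apply: (@ip_orth_eq0 _ X) => //; first exact: hyp_timelike.
  by rewrite /line !ipE (ipC X Y) YX XX XV; ring.
rewrite ipDl !ipDr !ipNl !ipNr ip_line_line // subrr cosh0 YY ip_line ip_liner.
rewrite (ipC X) YX (ipC V) YV.
by have := cosh2Bsinh2 a; lra.
Qed.

(** The velocity [V] is read off from [gamma 1]; every other point is determined by its distances to
    [gamma 0] and [gamma 1], by [line_uniq]. *)
Lemma geodesicE gamma : geodesic gamma ->
  exists V, frame (emb (gamma 0)) V /\ forall t, emb (gamma t) = line (emb (gamma 0)) V t.
Proof.
move=> g.
have ipg a b : ip (emb (gamma a)) (emb (gamma b)) = - cosh (a - b).
  by apply: oppr_inj; rewrite -cosh_hdist g cosh_norm opprK.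
set X := emb (gamma 0).
have s1 : sinh (1 : R) != 0 by rewrite gt_eqF // sinh_gt0.
pose V := (sinh (1 : R))^-1 *: (emb (gamma 1) - cosh 1 *: X).
have hX : hyp X := hyp_emb _.
have [XX _] := hX.
have l1 : line X V 1 = emb (gamma 1).
  by rewrite /line /V scalerA mulfV // scale1r addrC subrK.
have f : frame X V.
  have e1 := ipg 1 0; rewrite -/X subr0 in e1.
  have e2 := ipg 1 1; rewrite subrr cosh0 in e2.
  split => //; rewrite /V !ipE ?(ipC X) e1 XX; last first.
    by ring.
  rewrite e2.
  apply: (mulfI s1); apply: (mulfI s1); rewrite mulr1 -expr2 sinh2E; field.
  done.
exists V; split => // t; apply: (line_uniq (b := 1) f) => //; first exact: hyp_emb.
  by rewrite ipg subr0.
by rewrite l1 ipg.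
Qed.

Lemma hdistxx x : hdist x x = 0.
Proof. by apply: hdist_eq => //; rewrite cosh0; case: (hyp_emb x) => -> _; rewrite opprK. Qed.

Lemma hdist_eq0 x y : hdist x y = 0 -> x = y.
Proof.
move/(congr1 (@cosh R)); rewrite cosh_hdist cosh0 => h.
by apply/emb_inj/(hyp_ip_eqN1 (hyp_emb x) (hyp_emb y)); lra.
Qed.

Lemma line_through x y : hdist x y != 0 ->
  exists2 V, frame (emb x) V & emb y = line (emb x) V (hdist x y).
Proof.
move=> xy0; set d := hdist x y in xy0 *.
have d0 : 0 < d by rewrite lt_def xy0 hdist_ge0.
have sd : sinh d != 0 by rewrite gt_eqF // sinh_gt0.
have [hX hY] := (hyp_emb x, hyp_emb y); have [[XX _] [YY _]] := (hX, hY).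
have XY : ip (emb x) (emb y) = - cosh d by apply: oppr_inj; rewrite -cosh_hdist opprK.
exists ((sinh d)^-1 *: (emb y - cosh d *: emb x)); last first.
  by rewrite /line scalerA mulfV // scale1r addrC subrK.
split => //; rewrite !ipE ?(ipC (emb y) (emb x)) XX ?YY XY; last by ring.
by apply: (mulfI sd); apply: (mulfI sd); rewrite mulr1 -expr2 sinh2E; field.
Qed.

Lemma line_comb X V a d : sinh d != 0 ->
  line X V a = (sinh (d - a) / sinh d) *: X + (sinh a / sinh d) *: line X V d.
Proof.
by move=> sd; apply: minkP; rewrite /line !cE sinhB; field.
Qed.

(** Segments lie in the cone spanned by their ends; this is what makes half-spaces [ip _ Y <= 0]
    convex. *)
Lemma segmentE x y z : segment x y z ->
  exists a b, [/\ 0 <= a, 0 <= b & emb z = a *: emb x + b *: emb y].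
Proof.
rewrite /segment /= => e.
have [[h1 h2] h3] := (hdist_ge0 x z, hdist_ge0 z y, hdist_ge0 x y).
have [xy0|xy0] := eqVneq (hdist x y) 0.
  exists 1, 0; split => //; rewrite scale1r scale0r addr0.
  by rewrite (@hdist_eq0 x z) //; lra.
have [V f yE] := line_through xy0.
set d := hdist x y in e xy0 h3 yE.
have sd : sinh d != 0 by rewrite gt_eqF // sinh_gt0 lt_def xy0.
have ez : emb z = line (emb x) V (hdist x z).
  apply: (line_uniq f _ xy0); rewrite -?yE; first exact: hyp_emb.
    by rewrite ipC; apply: oppr_inj; rewrite -cosh_hdist opprK.
  apply: oppr_inj; rewrite -cosh_hdist opprK -coshN; congr cosh; lra.
exists (sinh (hdist z y) / sinh d), (sinh (hdist x z) / sinh d); split.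
- by rewrite divr_ge0 ?sinh_ge0.
- by rewrite divr_ge0 ?sinh_ge0.
have -> : hdist z y = d - hdist x z by lra.
by rewrite yE ez; exact: line_comb.
Qed.

Lemma segment_line X V a b t : frame X V -> a <= t <= b ->
  segment (pt (line X V a)) (pt (line X V b)) (pt (line X V t)).
Proof.
move=> f /andP[at_ tb]; have geo := geodesic_pt f.
rewrite /segment /= !geo !ler0_norm ?subr_le0 //; [by ring|exact: le_trans tb].
Qed.

End Hyperboloid.

(** * Moebius transformations and half-turns *)

Section MoebiusAction.
Variable R : realType.
Notation mink := (mink R).
Notation C := (complex R).
Implicit Types (x y z : H3 R) (X Y V W : mink) (a b c d : C) (M N : 'M[C]_2).
Implicit Types (g h : H3 R -> H3 R).

Local Notation Re := (@complex.Re R).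
Local Notation Im := (@complex.Im R).

(* [X] stands for the Hermitian matrix [P] with rows [(X0+X3, X1+iX2)] and
   [(X1-iX2, X0-X3)]; these are entries of [M P M^*] for [M] with rows
   [(a, b)] and [(c, d)], so that [act M X] represents [M P M^*]. *)
Definition act11 a b X : R :=
  (Re a ^+ 2 + Im a ^+ 2) * (c0 X + c3 X) + (Re b ^+ 2 + Im b ^+ 2) * (c0 X - c3 X)
  + 2 * Re (a * conjc b * (c1 X +i* c2 X)%C).

Definition act12 a b c d X : C :=
  a * conjc c * ((c0 X + c3 X) +i* 0)%C + b * conjc d * ((c0 X - c3 X) +i* 0)%C
  + a * conjc d * (c1 X +i* c2 X)%C + b * conjc c * (c1 X -i* c2 X)%C.

Definition act M X : mink :=
  let h11 := act11 (M 0 0) (M 0 1) X in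
  let h12 := act12 (M 0 0) (M 0 1) (M 1 0) (M 1 1) X in
  let h22 := act11 (M 1 0) (M 1 1) X in
  ((h11 + h22) / 2, Re h12, Im h12, (h11 - h22) / 2).

Lemma det2 M : \det M = M 0 0 * M 1 1 - M 0 1 * M 1 0.
Proof.
rewrite (expand_det_row _ 0) !big_ord_recl big_ord0 /cofactor !det_mx11 !mxE.
rewrite (_ : lift 0 0 = 1 :> 'I_2); last exact: val_inj.
rewrite (_ : lift 1 0 = 0 :> 'I_2); last exact: val_inj.
rewrite /= addr0 expr0 expr1; ring.
Qed.

(** [- ip X X] is the determinant of the Hermitian matrix of [X], which the action multiplies by the
    squared modulus of [\det M], the factor displayed in the proof. *)
Lemma ip_act M X Y : \det M = 1 -> ip (act M X) (act M Y) = ip X Y.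
Proof.
rewrite det2 /act /ip.
case: (M 0 0) (M 0 1) (M 1 0) (M 1 1) => [a1 a2] [b1 b2] [c1' c2'] [d1 d2].
move: X Y => [[[x0 x1] x2] x3] [[[y0 y1] y2] y3].
rewrite /act11 /act12 /c0 /c1 /c2 /c3 /=.
case=> er ei.
transitivity (((a1 * d1 - a2 * d2 - (b1 * c1' - b2 * c2')) ^+ 2 +
    (a1 * d2 + a2 * d1 - (b1 * c2' + b2 * c1')) ^+ 2) *
    (x1 * y1 + x2 * y2 + x3 * y3 - x0 * y0)); first by field.
by rewrite er ei; ring.
Qed.

Lemma actM M N X : act (M *m N) X = act M (act N X).
Proof.
rewrite /act !mxE !big_ord_recl !big_ord0 !addr0.
rewrite (_ : lift ord0 ord0 = 1 :> 'I_2); last exact: val_inj.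
move: (M _ _) (M _ _) (M _ _) (M _ _) => [a1 a2] [b1 b2] [c1' c2'] [d1 d2].
move: (N _ _) (N _ _) (N _ _) (N _ _) => [p1 p2] [q1 q2] [r1 r2] [s1 s2].
move: X => [[[x0 x1] x2] x3].
rewrite /act11 /act12 /c0 /c1 /c2 /c3 /=.
by congr (_, _, _, _); field.
Qed.

Lemma act_linear M t X Y : act M (t *: X + Y) = t *: act M X + act M Y.
Proof.
rewrite /act /act11 /act12.
move: (M _ _) (M _ _) (M _ _) (M _ _) => [a1 a2] [b1 b2] [c1' c2'] [d1 d2].
by apply: minkP; rewrite !cE !cT /=; field.
Qed.

Lemma actD M X Y : act M (X + Y) = act M X + act M Y.
Proof. by rewrite -{1}(scale1r X) act_linear scale1r. Qed.

Lemma act0 M : act M 0 = 0.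
Proof. by apply: (addrI (act M 0)); rewrite -actD !addr0. Qed.

Lemma actZ M t X : act M (t *: X) = t *: act M X.
Proof. by rewrite -{1}(addr0 (t *: X)) act_linear act0 addr0. Qed.

(** The denominator and the numerator of the half-space formula, divided by [ht x], are the
    coordinates [c0 - c3] and [c1 + i c2] of the transformed vector. *)
Lemma emb_poincare M g : \det M = 1 ->
  poincare_ext M g <-> forall x, emb (g x) = act M (emb x).
Proof.
move=> dM.
have h22 x : let d := M 1 0 * hz x + M 1 1 in
    act11 (M 1 0) (M 1 1) (emb x) =
    (Normc.normc d ^+ 2 + Normc.normc (M 1 0) ^+ 2 * ht x ^+ 2) / ht x.
  have t0 := ht_gt0 x.
  rewrite /= /act11 /hz.
  move: (M 1 0) (M 1 1) => [c1' c2'] [d1 d2].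
  rewrite !sqr_normc /= /emb !cT; field.
  by rewrite gt_eqF.
have h12 x : let d := M 1 0 * hz x + M 1 1 in
    act12 (M 0 0) (M 0 1) (M 1 0) (M 1 1) (emb x) =
    ((M 0 0 * hz x + M 0 1) * conjc d + M 0 0 * conjc (M 1 0) * (ht x ^+ 2 +i* 0)%C)
     * ((ht x)^-1 +i* 0)%C.
  have t0 := ht_gt0 x.
  rewrite /= /act12 /hz.
  move: (M _ _) (M _ _) (M _ _) (M _ _) => [a1 a2] [b1 b2] [c1' c2'] [d1 d2].
  by apply/eqP; rewrite eq_complex /= /emb !cT; apply/andP; split; apply/eqP; field;
    rewrite gt_eqF.
have c03 x : c0 (act M (emb x)) - c3 (act M (emb x)) = act11 (M 1 0) (M 1 1) (emb x).
  by rewrite /act !cT; field.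
have c12 x : (c1 (act M (emb x)) +i* c2 (act M (emb x)))%C =
    act12 (M 0 0) (M 0 1) (M 1 0) (M 1 1) (emb x).
  by rewrite /act !cT; case: (act12 _ _ _ _ _).
have k0 x : let d := M 1 0 * hz x + M 1 1 in
    Normc.normc d ^+ 2 + Normc.normc (M 1 0) ^+ 2 * ht x ^+ 2 != 0.
  move: (h22 x) (c03 x) => /=; set k := _ + _ => e22; rewrite e22 => e03.
  apply/eqP => k0; move: (hyp_emb x) => [+ _]; rewrite -(ip_act _ _ dM) /ip.
  move: e03; rewrite k0 mul0r; set Y := act _ _ => e03.
  have -> : c0 Y = c3 Y by lra.
  have := sqr_ge0 (c1 Y); have := sqr_ge0 (c2 Y); lra.
have key x y : hz y = ((M 0 0 * hz x + M 0 1) * conjc (M 1 0 * hz x + M 1 1)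
      + M 0 0 * conjc (M 1 0) * (ht x ^+ 2)%:C%C) /
      (Normc.normc (M 1 0 * hz x + M 1 1) ^+ 2 +
       Normc.normc (M 1 0) ^+ 2 * ht x ^+ 2)%:C%C /\
    ht y = ht x / (Normc.normc (M 1 0 * hz x + M 1 1) ^+ 2 +
       Normc.normc (M 1 0) ^+ 2 * ht x ^+ 2) <-> emb y = act M (emb x).
  move: (h22 x) (h12 x) (c03 x) (c12 x) (k0 x) => /=; set k := _ + _.
  rewrite -[(ht x ^+ 2 +i* 0)%C]/((ht x ^+ 2)%:C%C).
  set n := _ + (_ * ((ht x ^+ 2)%:C)%C) => e22 e12 e03 ec12 kn0.
  have t0 := ht_gt0 x; have tn0 : ht x != 0 by rewrite gt_eqF.
  rewrite e22 in e03; rewrite e12 in ec12.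
  have nk : n / k%:C%C = (c1 (act M (emb x)) +i* c2 (act M (emb x)))%C
                         * (ht x / k)%:C%C.
    rewrite ec12; case: (n) => n1 n2; apply/eqP; rewrite eq_complex /=.
    by apply/andP; split; apply/eqP; field; apply/andP.
  have ipY : ip (act M (emb x)) (act M (emb x)) = -1.
    by rewrite ip_act //; case: (hyp_emb x).
  set Y := act M (emb x) in e03 ec12 nk ipY *.
  rewrite nk; split => [[ez et]|ey].
  - have ipy : ip (emb y) (emb y) = -1 by case: (hyp_emb y).
    have e03y : c0 (emb y) - c3 (emb y) = k / ht x by rewrite c0Bc3_emb et invf_div.
    move: ez; rewrite /hz => -[].
    rewrite !mulr0 subr0 add0r hxE hyE e03y invf_div.
    have q0 : ht x / k != 0 by rewrite mulf_neq0 ?invr_eq0.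
    have d0 : k / ht x != 0 by rewrite mulf_neq0 ?invr_eq0.
    move=> /(mulIf q0) e1 /(mulIf q0) e2.
    (* The last coordinate follows from the others, as both vectors have square -1 and [c0 - c3] is
       nonzero. *)
    have sum : c0 (emb y) + c3 (emb y) = c0 Y + c3 Y.
      apply: (mulfI d0); rewrite -{1}e03y -e03; move: ipy ipY; rewrite /ip e1 e2; lra.
    by apply: minkP => //; lra.
  - rewrite [hz y]/hz (hxE y) (hyE y) (htE y) ey e03 invf_div; split => //.
    by apply/eqP; rewrite eq_complex /= !mulr0 subr0 add0r !eqxx.
split => [gP x|e x]; first by apply/key; apply: gP.
exact/key.
Qed.

Lemma emb_represents M g : represents M g -> forall x, emb (g x) = act M (emb x).
Proof. by case=> dM /(emb_poincare g dM). Qed.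

Lemma represents_comp M N g h :
  represents M g -> represents N h -> represents (M *m N) (g \o h).
Proof.
move=> rM rN; have [[dM _] [dN _]] := (rM, rN).
have dMN : \det (M *m N) = 1 by rewrite det_mulmx dM dN mulr1.
split=> //; apply/emb_poincare => // x.
by rewrite /= (emb_represents rM) (emb_represents rN) actM.
Qed.

Definition e0 : mink := (1, 0, 0, 0).
Definition e1 : mink := (0, 1, 0, 0).
Definition e2 : mink := (0, 0, 1, 0).

Definition trace (T : mink -> mink) : R :=
  c0 (T e0) + c1 (T e1) + c2 (T e2) + c3 (T (e3 R)).

(** The action is the tensor product of [M] and its complex conjugate. The trace serves to recognize
    half-turns (trace 0) and parabolic products (trace 4). *)
Lemma trace_act M : trace (act M) = Normc.normc (M 0 0 + M 1 1) ^+ 2.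
Proof.
rewrite /trace /act /act11 /act12 /e0 /e1 /e2 /e3 !cT.
move: (M _ _) (M _ _) (M _ _) (M _ _) => [a1 a2] [b1 b2] [c1' c2'] [d1 d2].
by rewrite sqr_normc /=; field.
Qed.

(* The half-turn about the line of [planeP] with unit normal [n]. *)
Definition refl (n X : mink) : mink := X - (2 * ip X n) *: n - (2 * c3 X) *: e3 R.

End MoebiusAction.

(** * Half-turns as linear reflections *)

Section HalfTurns.
Variable R : realType.
Notation mink := (mink R).
Notation C := (complex R).
Implicit Types (x y z : H3 R) (X Y V W : mink) (a b c d : C) (M N : 'M[C]_2).
Implicit Types (g h : H3 R -> H3 R).

Local Notation e0 := (e0 R).
Local Notation e1 := (e1 R).
Local Notation e2 := (e2 R).
Local Notation e3 := (e3 R).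

Lemma mink_basis X : X = c0 X *: e0 + c1 X *: e1 + c2 X *: e2 + c3 X *: e3.
Proof.
by apply: minkP; rewrite !cE /e0 /e1 /e2 /e3 !cT; ring.
Qed.

Definition linear_map (T : mink -> mink) :=
  forall t X Y, T (t *: X + Y) = t *: T X + T Y.

Lemma linear_mapD T X Y : linear_map T -> T (X + Y) = T X + T Y.
Proof. by move=> lT; rewrite -{1}(scale1r X) lT scale1r. Qed.

Lemma linear_mapZ T t X : linear_map T -> T (t *: X) = t *: T X.
Proof.
move=> lT; have T0 : T 0 = 0.
  by apply: (addrI (T 0)); rewrite -(linear_mapD _ _ lT) !addr0.
by rewrite -{1}(addr0 (t *: X)) lT T0 addr0.
Qed.

Lemma linear_map_eq T S : linear_map T -> linear_map S ->
  (forall x, T (emb x) = S (emb x)) -> T =1 S.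
Proof.
move=> lT lS TS.
have hTS X : hyp X -> T X = S X by case/emb_surj => x <-.
have he0 : hyp e0 by split; rewrite /ip /e0 ?cT //; ring.
have spatial E : ip E E = 1 -> c0 E = 0 -> T E = S E.
  move=> EE E0.
  (* A rational pair of cosh and sinh: the squares of 5/4 and 3/4 differ by 1. Together with [e0],
     such points of the hyperboloid span the space. *)
  have hE : hyp ((5 / 4) *: e0 + (3 / 4) *: E).
    split; last by rewrite !cE E0 /e0 !cT; lra.
    have -> : ip ((5 / 4) *: e0 + (3 / 4) *: E) ((5 / 4) *: e0 + (3 / 4) *: E) =
      9 / 16 * ip E E - 25 / 16 by rewrite /ip !cE E0 /e0 !cT; field.
    by rewrite EE; lra.
  have := hTS _ hE; rewrite !lT !lS !(linear_mapZ _ _ lT) !(linear_mapZ _ _ lS) (hTS _ he0).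
  move/addrI/(congr1 (fun Y => (4 / 3) *: Y)); rewrite !scalerA.
  by rewrite (_ : 4 / 3 * (3 / 4) = 1 :> R) ?scale1r //; field.
move=> X; rewrite (mink_basis X) !(linear_mapD _ _ lT) !(linear_mapD _ _ lS).
rewrite !(linear_mapZ _ _ lT) !(linear_mapZ _ _ lS) (hTS _ he0).
by rewrite !spatial // /ip /e1 /e2 /e3 ?cT //; ring.
Qed.

Lemma represents_id N : represents N id ->
  [/\ N 0 1 = 0, N 1 0 = 0 & N 0 0 = N 1 1].
Proof.
move=> rN; have idN : act N =1 id.
  apply: linear_map_eq => [? ? ?|//|x]; first exact: act_linear.
  by rewrite -(emb_represents rN).
have := idN e0; have := idN e1; have := idN e3.
rewrite /act /act11 /act12 /e0 /e1 /e3 !cT.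
move: (N _ _) (N _ _) (N _ _) (N _ _) => [a1 a2] [b1 b2] [p1 p2] [d1 d2] /=.
move=> -[h1 _ _ h4] [_ k2 _ _] [l1 _ _ l4].
have sq0 (u v : R) : u ^+ 2 + v ^+ 2 = 0 -> u = 0 /\ v = 0.
  move/eqP; rewrite paddr_eq0 ?sqr_ge0 // !sqrf_eq0.
  by move=> /andP[/eqP -> /eqP ->].
have /sq0[p10 p20] : p1 ^+ 2 + p2 ^+ 2 = 0 by lra.
have /sq0[b10 b20] : b1 ^+ 2 + b2 ^+ 2 = 0 by lra.
move: h1 h4 k2 l1 l4; rewrite p10 p20 b10 b20 => h1 h4 k2 l1 l4.
have /sq0[/subr0_eq -> /subr0_eq ->] : (d1 - a1) ^+ 2 + (d2 - a2) ^+ 2 = 0 by lra.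
by [].
Qed.

(** [H] fixes [X] and [V], so it acts on the plane of [n] and [e3]. Its total trace 0 leaves trace
    -2 on this plane, while the images of [n] and [e3] are unit vectors there, so both diagonal
    entries are -1 and the others vanish. *)
Lemma half_turn_refl L H X V : half_turn L H -> frame X V ->
  c3 X = 0 -> c3 V = 0 -> (forall t, L (pt (line X V t))) ->
  forall x, emb (H x) = refl (cross X V) (emb x).
Proof.
case=> -[M rM] HH Hid HL f X3 V3 XVL; have [hX VV XV] := f; have [XX _] := hX.
have [dM _] := rM; have T := emb_represents rM.
set n := cross X V; have n3 : c3 n = 0 by [].
have nX : ip X n = 0 := ip_crossl X V.
have nV : ip V n = 0 := ip_crossr X V.
have nn : ip n n = 1 by rewrite ip_cross // XX VV XV; ring.
have fixL t : act M (line X V t) = line X V t.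
  by rewrite -(emb_pt_line t f) -T HL.
have TX : act M X = X by have := fixL 0; rewrite /line cosh0 sinh0 scale1r scale0r addr0.
have TV : act M V = V.
  have s1 : sinh (1 : R) != 0 by rewrite gt_eqF // sinh_gt0.
  have := fixL 1; rewrite /line actD !actZ TX => /addrI/(congr1 (fun Y => (sinh 1)^-1 *: Y)).
  by rewrite !scalerA mulVf // !scale1r.
(* [M *m M] is scalar; if the trace of [M] were nonzero, then [M] would be plus or minus the
   identity and [H = id]. *)
have tr0 : trace (act M) = 0.
  rewrite trace_act; apply/eqP; rewrite sqrf_eq0.
  have [e01 e10 e0011] : [/\ (M *m M) 0 1 = 0, (M *m M) 1 0 = 0 & (M *m M) 0 0 = (M *m M) 1 1].
    by apply: represents_id; rewrite -HH; exact: represents_comp.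
  rewrite !mxE !big_ord_recl !big_ord0 !addr0 in e01 e10 e0011.
  rewrite (_ : lift ord0 ord0 = 1 :> 'I_2) in e01 e10 e0011; last exact: val_inj.
  rewrite -[ord0]/(0 : 'I_2) in e01 e10 e0011.
  suff t0 : M 0 0 + M 1 1 = 0 by rewrite t0 Normc.normc0.
  apply/eqP/negPn/negP => t0; apply: Hid; apply/funext => x; apply: emb_inj; rewrite T.
  have cancel a b : a != 0 -> a * b = 0 -> b = 0.
    by move=> a0 /eqP; rewrite mulf_eq0 (negPf a0) => /eqP.
  have b0 : M 0 1 = 0.
    by apply: (cancel _ _ t0); rewrite -e01 mulrDl (mulrC (M 1 1)).
  have c0' : M 1 0 = 0.
    by apply: (cancel _ _ t0); rewrite -e10 mulrDl (mulrC (M 0 0)).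
  have ad : M 0 0 = M 1 1.
    apply/subr0_eq; apply: (cancel _ _ t0); rewrite mulrC -subr_sqr.
    by move: e0011; rewrite b0 c0' !mul0r addr0 add0r !expr2 => ->; rewrite subrr.
  have /eqP : M 1 1 ^+ 2 = 1 by rewrite expr2 -{1}ad -dM det2 b0 mul0r subr0.
  move: (emb x) => Y; rewrite sqrf_eq1 => /orP[] /eqP d1; rewrite /act /act11 /act12 ad b0 c0' d1;
    apply: minkP; by rewrite !cT /=; field.
have trE : trace (act M) = 2 + ip n (act M n) + ip e3 (act M e3).
  have expand Y : act M Y = - ip Y X *: X + ip Y V *: V + ip Y n *: act M n + c3 Y *: act M e3.
    by rewrite {1}(frame_expand Y X3 V3 n3 XX VV nn XV nX nV) !actD !actZ TX TV.
  move: expand; set Tn := act M n; set Te := act M e3 => expand.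
  rewrite /trace (expand e0) (expand e1) (expand e2) (expand e3) !cE.
  transitivity (ip V V - ip X X + ip n (act M n) + ip e3 (act M e3)); last first.
    by rewrite XX VV; ring.
  by rewrite /ip X3 V3 n3 /e0 /e1 /e2 /e3 !cT; ring.
have TnX : ip (act M n) X = 0 by rewrite -TX ip_act // ipC.
have TnV : ip (act M n) V = 0 by rewrite -TV ip_act // ipC.
have TeX : ip (act M e3) X = 0 by rewrite -TX ip_act // ip_e3l.
have TeV : ip (act M e3) V = 0 by rewrite -TV ip_act // ip_e3l.
have En := frame_expand (act M n) X3 V3 n3 XX VV nn XV nX nV.
have Ee := frame_expand (act M e3) X3 V3 n3 XX VV nn XV nX nV.
have nTn : ip (act M n) (act M n) = 1 by rewrite ip_act.
have eTe : ip (act M e3) (act M e3) = 1 by rewrite ip_act // ip_e3e3.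
rewrite TnX TnV oppr0 !scale0r !add0r in En.
rewrite TeX TeV oppr0 !scale0r !add0r in Ee.
set al := ip (act M n) n in En *; set be := c3 (act M n) in En *.
set ga := ip (act M e3) n in Ee *; set de := c3 (act M e3) in Ee *.
have nsum : al ^+ 2 + be ^+ 2 = 1.
  by rewrite -nTn En !ipE nn ip_e3e3 ip_e3 ip_e3l n3; ring.
have esum : ga ^+ 2 + de ^+ 2 = 1.
  by rewrite -eTe Ee !ipE nn ip_e3e3 ip_e3 ip_e3l n3; ring.
have alde : al + de = - 2.
  move: trE; rewrite tr0 (ipC n) ip_e3l -/al -/de; lra.
have aln : al = -1.
  have := sqr_ge0 (al + 1); have := sqr_ge0 (de + 1).
  have := sqr_ge0 be; have := sqr_ge0 ga => ? ? ? ?.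
  have /eqP : (al + 1) ^+ 2 = 0 by lra.
  by rewrite sqrf_eq0 addr_eq0 => /eqP.
have den : de = -1 by lra.
have be0 : be = 0 by apply/eqP; rewrite -sqrf_eq0; apply/eqP; move: nsum; rewrite aln; lra.
have ga0 : ga = 0 by apply/eqP; rewrite -sqrf_eq0; apply/eqP; move: esum; rewrite den; lra.
move=> x; rewrite T {1}(frame_expand (emb x) X3 V3 n3 XX VV nn XV nX nV).
rewrite !actD !actZ TX TV En Ee aln den be0 ga0 !scale0r addr0 add0r.
rewrite /refl {5}(frame_expand (emb x) X3 V3 n3 XX VV nn XV nX nV).
by apply: minkP; rewrite !cE; ring.
Qed.

End HalfTurns.

(** For determinant 1 and trace [2 E] with [E] a sign, the quadratic equation for fixed points has
    discriminant 0, with double root [(a - E) / c]. *)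
Lemma double_fixpoint (F : fieldType) (a b c d E : F) :
  a * d - b * c = 1 -> E * E = 1 -> d = E + E - a -> c != 0 ->
  c * ((a - E) / c) + d = E /\
  forall z, (a * z + b) - z * (c * z + d) = - c * (z - (a - E) / c) ^+ 2.
Proof.
move=> det EE dE c0; set r := (a - E) / c.
have cr : c * r = a - E by rewrite mulrC divfK.
split=> [|z]; first by rewrite cr dE; ring.
have bc : b * c = - (a - E) ^+ 2.
  have -> : b * c = a * (E + E - a) - 1.
    by rewrite -det dE; ring.
  by rewrite -EE; ring.
apply: (mulfI c0); transitivity (- (c * z - c * r) ^+ 2); last by ring.
rewrite cr dE; transitivity (- (c * z) ^+ 2 + 2 * (c * z) * (a - E) + b * c); first by ring.
by rewrite bc; ring.
Qed.

(** * Products of half-turns about asymptotic lines *)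

Section Parabolics.
Variable R : realType.
Notation mink := (mink R).
Notation C := (complex R).
Implicit Types (x y z : H3 R) (X Y V W : mink) (a b c d : C) (M N : 'M[C]_2).
Implicit Types (g h : H3 R -> H3 R).

Local Notation e0 := (e0 R).
Local Notation e1 := (e1 R).
Local Notation e2 := (e2 R).
Local Notation e3 := (e3 R).

Lemma refl_linear n : linear_map (@refl R n).
Proof. by move=> t X Y; apply: minkP; rewrite /refl !cE !ipE; ring. Qed.

Lemma trace_refl2 n m : c3 n = 0 -> c3 m = 0 -> ip n n = 1 -> ip m m = 1 ->
  trace (@refl R n \o @refl R m) = 4 * ip n m ^+ 2.
Proof.
move=> n3 m3 nn mm.
transitivity (4 - 2 * ip n n - 2 * ip m m + 4 * ip n m ^+ 2); last by rewrite nn mm; ring.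
rewrite /trace /refl /= !(cE, ipE) ?ip_e3l ?cE n3 m3 /ip n3 m3.
by rewrite /e0 /e1 /e2 /e3 !cT; ring.
Qed.

(** A trace of modulus 2 alone does not make [M] parabolic. But [act M] fixes [e3], so [M] lies in
    SU(1,1), where the trace is real, hence 2 or -2. *)
Lemma refl2_parabolic M g n m : represents M g ->
  (forall x, emb (g x) = refl n (refl m (emb x))) -> g <> id ->
  c3 n = 0 -> c3 m = 0 -> ip n n = 1 -> ip m m = 1 -> ip n m ^+ 2 = 1 ->
  parabolic M.
Proof.
move=> rM gE gid n3 m3 nn mm nm; have [dM _] := rM.
have actE : act M =1 @refl R n \o @refl R m.
  apply: linear_map_eq => [t X Y|t X Y|x]; first exact: act_linear.
    by rewrite /= !refl_linear.
  by rewrite -(emb_represents rM) gE.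
have tr4 : Normc.normc (M 0 0 + M 1 1) ^+ 2 = 4.
  rewrite -trace_act; transitivity (trace (@refl R n \o @refl R m)).
    by rewrite /trace !actE.
  by rewrite trace_refl2 // nm mulr1.
have Me3 : act M e3 = e3.
  rewrite actE /= /refl !ipE !ip_e3l n3 m3.
  by apply: minkP; rewrite !cE ?n3 ?m3 /e3 !cT; ring.
have Mid : M 1 0 <> 0.
  move=> M10; apply: gid; apply/funext => x; apply: emb_inj.
  rewrite (emb_represents rM); move: (emb x) => X.
  move: dM tr4 Me3; rewrite det2 /act /act11 /act12 M10.
  case: (M 0 0) (M 0 1) (M 1 1) => [a1 a2] [b1 b2] [d1 d2].
  rewrite sqr_normc /= => -[D1 D2] tr4 [h0 h1 h2 h3].
  have sq0 (u v : R) : u ^+ 2 + v ^+ 2 = 0 -> u = 0 /\ v = 0.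
    move/eqP; rewrite paddr_eq0 ?sqr_ge0 // !sqrf_eq0.
    by move=> /andP[/eqP -> /eqP ->].
  move: h0 h1 h2 h3; rewrite /e3 !cT => h0 h1 h2 h3.
  have dd : d1 ^+ 2 + d2 ^+ 2 = 1 by lra.
  have /sq0[b10 b20] : b1 ^+ 2 + b2 ^+ 2 = 0.
    have e1 : b1 * d1 + b2 * d2 = 0 by lra.
    have e2 : b2 * d1 - b1 * d2 = 0 by lra.
    transitivity ((b1 * d1 + b2 * d2) ^+ 2 + (b2 * d1 - b1 * d2) ^+ 2).
      by rewrite -[LHS]mulr1 -dd; ring.
    by rewrite e1 e2; ring.
  move: D1 D2 tr4 h0 h3; rewrite b10 b20 => D1 D2 tr4 h0 h3.
  have /sq0[/subr0_eq <- /subr0_eq <-] : (a1 - d1) ^+ 2 + (a2 - d2) ^+ 2 = 0 by lra.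
  have aa : a1 ^+ 2 + a2 ^+ 2 = 1 by lra.
  have e t : (a1 ^+ 2 + a2 ^+ 2) * t = t by rewrite aa mul1r.
  by apply: minkP; rewrite !cT -[RHS]e; field.
(* Fixing [e3] forces [M 1 1] to be the conjugate of [M 0 0], so [E] is the real part of [M 0 0]. *)
have [E EE tr] : exists2 E : C, E * E = 1 & M 1 1 = E + E - M 0 0.
  move: dM tr4 Me3; rewrite det2 /act /act11 /act12 {Mid}.
  case: (M 0 0) (M 0 1) (M 1 0) (M 1 1) => [a1 a2] [b1 b2] [p1 p2] [d1 d2].
  rewrite sqr_normc /= => -[D1 D2] tr4 [h0 h1 h2 h3].
  move: h0 h1 h2 h3; rewrite /e3 !cT => h0 h1 h2 h3.
  have A : a1 ^+ 2 + a2 ^+ 2 - (b1 ^+ 2 + b2 ^+ 2) = 1 by lra.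
  have E1 : a1 * p1 + a2 * p2 - b1 * d1 - b2 * d2 = 0 by lra.
  have E2 : a2 * p1 - a1 * p2 - (b2 * d1 - b1 * d2) = 0 by lra.
  have ad1 : a1 = d1.
    transitivity (a1 * (a1 * d1 - a2 * d2 - (b1 * p1 - b2 * p2)) +
                  a2 * (a1 * d2 + a2 * d1 - (b1 * p2 + b2 * p1))).
      by rewrite D1 D2; ring.
    transitivity ((a1 ^+ 2 + a2 ^+ 2 - (b1 ^+ 2 + b2 ^+ 2)) * d1
      - b1 * (a1 * p1 + a2 * p2 - b1 * d1 - b2 * d2)
      - b2 * (a2 * p1 - a1 * p2 - (b2 * d1 - b1 * d2))); first by ring.
    by rewrite A E1 E2; ring.
  have ad2 : - a2 = d2.
    transitivity (a1 * (a1 * d2 + a2 * d1 - (b1 * p2 + b2 * p1)) -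
                  a2 * (a1 * d1 - a2 * d2 - (b1 * p1 - b2 * p2))).
      by rewrite D1 D2; ring.
    transitivity ((a1 ^+ 2 + a2 ^+ 2 - (b1 ^+ 2 + b2 ^+ 2)) * d2
      - b2 * (a1 * p1 + a2 * p2 - b1 * d1 - b2 * d2)
      + b1 * (a2 * p1 - a1 * p2 - (b2 * d1 - b1 * d2))); first by ring.
    by rewrite A E1 E2; ring.
  exists (a1 +i* 0)%C; apply/eqP; rewrite eq_complex /=; apply/andP; split; apply/eqP.
  - by move: tr4; rewrite -ad1 -ad2; lra.
  - by ring.
  - by rewrite -ad1; ring.
  - by rewrite -ad2; ring.
have M10 : M 1 0 != 0 by apply/eqP.
have [] := double_fixpoint (etrans (esym (det2 M)) dM) EE tr M10.
set r := _ / _ => rE key.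
exists (Some r) => -[z|]; rewrite /moebius; last first.
  by rewrite (negPf M10); split.
case: ifPn => [/eqP dz|dz].
  split=> // -[zr]; move: dz; rewrite zr rE => E0.
  by move: EE; rewrite E0 mul0r => /esym/eqP; rewrite oner_eq0.
split=> -[zE].
  congr Some; apply/eqP; rewrite -subr_eq0 -sqrf_eq0; apply/eqP.
  have num : M 0 0 * z + M 0 1 = z * (M 1 0 * z + M 1 1).
    by move: zE => /(congr1 (fun u => u * (M 1 0 * z + M 1 1))); rewrite divfK.
  have /esym/eqP := key z; rewrite num subrr.
  by rewrite mulf_eq0 oppr_eq0 (negPf M10) => /eqP.
congr Some; apply: (mulIf dz); rewrite divfK //; apply/subr0_eq.
by rewrite key zE subrr expr0n mulr0.
Qed.

End Parabolics.

(** * Three lines with disjoint outer half-planes *)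

Section TimelikeMore.
Variable R : realType.
Notation mink := (mink R).

Lemma timelike_same_cone (U Y : mink) :
  timelike U -> ip Y Y < 0 -> ip U Y < 0 -> timelike Y.
Proof.
move=> tU YY UY; split => //; have [Y0|//|Y0] := ltgtP (c0 Y) 0.
  have tN : timelike (- Y) by split; rewrite ?ipNl ?ipNr ?opprK // c0N oppr_gt0.
  by have := timelike_ip_lt0 tU tN; rewrite ipNr; lra.
move: YY; rewrite /ip Y0; have := sqr_ge0 (c1 Y); have := sqr_ge0 (c2 Y).
by have := sqr_ge0 (c3 Y); lra.
Qed.

End TimelikeMore.

(* Outer normals of three lines of [planeP]; [timelike] says that the half-planes
   [0 < ip X (nrm i)] are disjoint, also at infinity. *)
Record three_lines (R : realType) := ThreeLines {
  nrm :> 'I_3 -> mink R;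
  nrm_c3 : forall i, c3 (nrm i) = 0;
  nrm_unit : forall i, ip (nrm i) (nrm i) = 1;
  nrm_timelike : forall i j, i != j -> timelike (nrm i + nrm j) }.

Section ThreeLinesTheory.
Variables (R : realType) (n : three_lines R).
Notation mink := (mink R).
Let n3 i : c3 (n i) = 0. Proof. exact: nrm_c3. Qed.
Let nn i : ip (n i) (n i) = 1. Proof. exact: nrm_unit. Qed.
Let tn i j : i != j -> timelike (n i + n j). Proof. exact: nrm_timelike. Qed.
Implicit Types (X Y : mink) (i j k : 'I_3).

Local Notation c i j := (ip (n i) (n j)).

Lemma cC i j : c i j = c j i. Proof. exact: ipC. Qed.

Lemma c_ltN1 i j : i != j -> c i j < -1.
Proof. by move=> /tn[+ _]; rewrite !ipE !nn (cC j i); lra. Qed.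

(** Hence a point on or beyond one line is strictly on the inner side of the other two. *)
Lemma f_sum_lt0 i j X : i != j -> hyp X -> ip X (n i) + ip X (n j) < 0.
Proof.
by move=> ij hX; rewrite -ipDr; apply: timelike_ip_lt0; [exact: hyp_timelike|exact: tn].
Qed.

Lemma c2_gt1 i j : i != j -> 0 < c i j ^+ 2 - 1.
Proof. by move=> /c_ltN1 h; nra. Qed.

Lemma cofactor_gt0 i j k : i != j -> i != k -> j != k -> 0 < c i j * c i k - c j k.
Proof.
move=> /c_ltN1 p /c_ltN1 q /c_ltN1 r; have : 0 < c i j * c i k by rewrite nmulr_rgt0; lra.
lra.
Qed.

(* [raw i j k] is orthogonal to [n i] and [n j]; its square is [(c i j ^+ 2 - 1)]
   times the opposite of the Gram determinant. *)
Definition raw i j k : mink :=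
  (c i j * c j k - c i k) *: n i + (c i j * c i k - c j k) *: n j
  - (c i j ^+ 2 - 1) *: n k.

Definition gram i j k : R :=
  c i j ^+ 2 + c i k ^+ 2 + c j k ^+ 2 - 2 * c i j * c i k * c j k - 1.

Lemma gram_gt0 i j k : i != j -> i != k -> j != k -> 0 < gram i j k.
Proof.
move=> /c_ltN1 ij /c_ltN1 ik /c_ltN1 jk; rewrite /gram.
have h : 0 < c i j * c i k by nra.
have : c i j * c i k * c j k < 0 by rewrite pmulr_rlt0 //; lra.
by have := sqr_ge0 (c i k); have := sqr_ge0 (c j k); nra.
Qed.

Lemma raw_l i j k : ip (raw i j k) (n i) = 0.
Proof. by rewrite /raw !ipE !nn (cC j i) (cC k i); ring. Qed.

Lemma raw_r i j k : ip (raw i j k) (n j) = 0.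
Proof. by rewrite /raw !ipE !nn (cC k j); ring. Qed.

Lemma raw_raw i j k : ip (raw i j k) (raw i j k) = (c i j ^+ 2 - 1) * gram i j k.
Proof.
rewrite {2}/raw !ipDr ipNr !ipZr raw_l raw_r /raw /gram !ipE.
by rewrite ?nn ?(cC k j) ?(cC k i) ?(cC j i) ?nn; ring.
Qed.

(* The unit normal of the common perpendicular of the lines [n i] and [n j] that is
   negative on the line [n k]; locked because unification tends to unfold it. *)
Fact wn_key : unit. Proof. exact: tt. Qed.
Definition wn i j k : mink := locked_with wn_key
  ((Num.sqrt (ip (raw i j k) (raw i j k)))^-1 *: raw i j k).

Lemma wnE i j k :
  wn i j k = (Num.sqrt (ip (raw i j k) (raw i j k)))^-1 *: raw i j k.
Proof. by rewrite /wn unlock. Qed.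

Section Triple.
Variables i j k : 'I_3.
Hypotheses (ij : i != j) (ik : i != k) (jk : j != k).
Local Notation N := (Num.sqrt (ip (raw i j k) (raw i j k))).
Local Notation w := (wn i j k).

Lemma raw_gt0 : 0 < ip (raw i j k) (raw i j k).
Proof. by rewrite raw_raw mulr_gt0 ?c2_gt1 ?gram_gt0. Qed.

Lemma N_gt0 : 0 < N. Proof. by rewrite sqrtr_gt0 raw_gt0. Qed.

Lemma w_l : ip w (n i) = 0. Proof. by rewrite wnE ipZl raw_l mulr0. Qed.
Lemma w_r : ip w (n j) = 0. Proof. by rewrite wnE ipZl raw_r mulr0. Qed.
Lemma c3_w : c3 w = 0.
Proof. by rewrite wnE /raw !cE !n3; ring. Qed.

Lemma w_w : ip w w = 1.
Proof.
rewrite wnE ipZl ipZr mulrA -invfM -expr2 sqr_sqrtr ?(ltW raw_gt0) //.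
by rewrite mulVf // gt_eqF ?raw_gt0.
Qed.

(** [al], [be] and [ga] are the coefficients of [w] in [n i], [n j] and [- n k]; what matters is
    that all three are positive. *)
Definition al := N^-1 * (c i j * c j k - c i k).
Definition be := N^-1 * (c i j * c i k - c j k).
Definition ga := N^-1 * (c i j ^+ 2 - 1).

Lemma al_gt0 : 0 < al.
Proof.
have ji : j != i by rewrite eq_sym.
rewrite mulr_gt0 ?invr_gt0 ?N_gt0 //.
by have := cofactor_gt0 ji jk ik; rewrite (cC j i).
Qed.

Lemma be_gt0 : 0 < be.
Proof.
rewrite mulr_gt0 ?invr_gt0 ?N_gt0 //.
exact: cofactor_gt0.
Qed.

Lemma ga_gt0 : 0 < ga.
Proof. by rewrite mulr_gt0 ?invr_gt0 ?N_gt0 ?c2_gt1. Qed.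

Lemma ip_w X : ip X w = al * ip X (n i) + be * ip X (n j) - ga * ip X (n k).
Proof. by rewrite wnE /al /be /ga ipZr; move: N^-1 => z; rewrite /raw !ipE; ring. Qed.

Lemma wn_ge0 X : (0 <= ip X w) = (0 <= ip X (raw i j k)).
Proof. by rewrite wnE ipZr pmulr_rge0 // invr_gt0 N_gt0. Qed.

(** Beyond the third line the other two products are negative, so no term of [ip_w] is positive. *)
Lemma w_beyond X : hyp X -> 0 <= ip X (n k) -> ip X w < 0.
Proof.
move=> hX fk; have := f_sum_lt0 ik hX; have := f_sum_lt0 jk hX => fj fi.
have a0 := al_gt0; have b0 := be_gt0; have g0 := ga_gt0.
have : al * ip X (n i) < 0 by rewrite pmulr_rlt0 //; lra.
have : be * ip X (n j) < 0 by rewrite pmulr_rlt0 //; lra.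
have : 0 <= ga * ip X (n k) by rewrite mulr_ge0 // ltW.
by rewrite ip_w; lra.
Qed.

Lemma f_third_lt0 X : hyp X -> 0 <= ip X w -> ip X (n k) < 0.
Proof.
move=> hX h; rewrite ltNge; apply/negP => /(w_beyond hX).
by rewrite ltNge h.
Qed.

End Triple.

(** [b] times the first inequality plus [a1] times the second eliminates [v]. *)
Lemma obtuse_rays (b a1 a2 u v : R) : 0 < b -> 0 < a1 -> u < 0 ->
  0 <= b * u - a1 * v -> 0 <= b * v - a2 * u -> b ^+ 2 - a1 * a2 <= 0.
Proof.
move=> b0 a10 u0 h1 h2.
have e1 : 0 <= b * (b * u - a1 * v) by rewrite mulr_ge0 // ltW.
have e2 : 0 <= a1 * (b * v - a2 * u) by rewrite mulr_ge0 // ltW.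
have : 0 <= (b ^+ 2 - a1 * a2) * u.
  have -> : (b ^+ 2 - a1 * a2) * u = b * (b * u - a1 * v) + a1 * (b * v - a2 * u) by ring.
  exact: addr_ge0.
by rewrite nmulr_lge0.
Qed.

(** On the line [n i], both walls that it crosses are linear forms in the products with [n j] and
    [n k]. The determinant of these two forms is [gram], which [obtuse_rays] would make
    nonpositive. *)
Lemma w_disjoint i j k X : i != j -> i != k -> j != k -> hyp X ->
  ip X (n i) = 0 -> 0 <= ip X (wn i j k) -> ip X (wn i k j) < 0.
Proof.
move=> ij ik jk hX fi; have kj : k != j by rewrite eq_sym.
rewrite ltNge => h1; apply/negP => h2; move: h1 h2.
have gr := gram_gt0 ij ik jk.
rewrite (wn_ge0 ij ik jk) (wn_ge0 ik ij kj) // => h1 h2.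
have e1 : ip X (raw i j k) = (c i j * c i k - c j k) * ip X (n j) - (c i j ^+ 2 - 1) * ip X (n k).
  by rewrite /raw ipDr ipDr ipNr !ipZr fi; ring.
have e2 : ip X (raw i k j) = (c i j * c i k - c j k) * ip X (n k) - (c i k ^+ 2 - 1) * ip X (n j).
  by rewrite /raw ipDr ipDr ipNr !ipZr fi (cC k j); ring.
rewrite e1 in h1; rewrite e2 in h2.
have fj0 := f_sum_lt0 ij hX; rewrite fi add0r in fj0.
have := obtuse_rays (cofactor_gt0 ij ik jk) (c2_gt1 ij) fj0 h1 h2.
move: gr; rewrite /gram; move: (c i j) (c i k) (c j k) => p q r; clear; lra.
Qed.

End ThreeLinesTheory.

Section Reflections.
Variable R : realType.
Notation mink := (mink R).
Local Notation e3 := (e3 R).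
Implicit Types (X Y n : mink).

Lemma c3_refl n X : c3 n = 0 -> c3 (refl n X) = - c3 X.
Proof. by move=> n3; rewrite /refl !cE n3 /e3 !cT; ring. Qed.

Lemma ip_refl n X Y : c3 n = 0 -> ip n n = 1 -> ip (refl n X) (refl n Y) = ip X Y.
Proof.
move=> n3 nn; rewrite /refl !ipE !ip_e3 !ip_e3l n3 nn /e3 !cT (ipC n Y); ring.
Qed.

Lemma reflK n : c3 n = 0 -> ip n n = 1 -> involutive (refl n).
Proof.
move=> n3 nn X; rewrite {1}/refl c3_refl // /refl !ipE ip_e3l n3 nn.
by apply: minkP; rewrite !cE; ring.
Qed.

Lemma ip_refl_swap n X Y : c3 n = 0 -> ip n n = 1 -> ip (refl n X) Y = ip X (refl n Y).
Proof. by move=> n3 nn; rewrite -{1}(reflK n3 nn Y) ip_refl. Qed.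

Lemma hyp_refl n X : c3 n = 0 -> ip n n = 1 -> hyp X -> hyp (refl n X).
Proof.
move=> n3 nn hX; have [XX _] := hX.
have e : ip (refl n X) (refl n X) = -1 by rewrite ip_refl.
split=> //; suff [] : timelike (refl n X) by [].
apply: (timelike_same_cone (hyp_timelike hX)); first by rewrite e ltrN10.
rewrite /refl !ipE XX ip_e3.
by have := sqr_ge0 (ip X n); have := sqr_ge0 (c3 X); lra.
Qed.

End Reflections.

(** * Common perpendiculars and coordinates along them *)

Section Axes.
Variables (R : realType) (n : three_lines R).
Notation mink := (mink R).
Let n3 i : c3 (n i) = 0. Proof. exact: nrm_c3. Qed.
Let nn i : ip (n i) (n i) = 1. Proof. exact: nrm_unit. Qed.
Implicit Types (X Y : mink) (i j k : 'I_3) (x y : H3 R).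
Local Notation c i j := (ip (n i) (n j)).

(** The distance between two disjoint lines, whose outer normals have product minus its cosh. *)
Definition dst i j : R := arcosh (- c i j).

Lemma cosh_dst i j : i != j -> cosh (dst i j) = - c i j.
Proof. by move=> /(c_ltN1 n) h; case: (@arcoshK R (- c i j)) => //; lra. Qed.

Lemma dst_gt0 i j : i != j -> 0 < dst i j.
Proof.
move=> ij; have h := c_ltN1 n ij; rewrite lt_def.
case: (@arcoshK R (- c i j)); first by lra.
move=> e -> ; rewrite andbT; apply: contra_eqN (e) => /eqP; rewrite -/(dst i j) => ->.
by rewrite cosh0; apply/eqP => ?; lra.
Qed.

Lemma sinh_dst_gt0 i j : i != j -> 0 < sinh (dst i j).
Proof. by move=> ij; rewrite sinh_gt0 dst_gt0. Qed.

(* The foot on the line [n i] of the common perpendicular to [n i] and [n j]. *)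
Definition foot i j : mink := (sinh (dst i j))^-1 *: (n j - c i j *: n i).

Section Pair.
Variables i j : 'I_3.
Hypothesis ij : i != j.
Local Notation o := (foot i j).
Local Notation d := (dst i j).

Let sd0 : sinh d != 0. Proof. by rewrite gt_eqF ?sinh_dst_gt0. Qed.
Let cE' : c i j = - cosh d. Proof. by rewrite cosh_dst // opprK. Qed.

Lemma foot_n : ip o (n i) = 0.
Proof. by rewrite /foot !ipE nn (cC n j i); ring. Qed.

Lemma c3_foot : c3 o = 0.
Proof. by rewrite /foot !cE !n3; ring. Qed.

Lemma foot_n' : ip o (n j) = - sinh d.
Proof.
rewrite /foot !ipE nn cE'; apply: (mulfI sd0); rewrite mulrA mulfV //.
by have := sinh2E d; lra.
Qed.

Lemma foot_foot : ip o o = -1.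
Proof.
rewrite {2}/foot ipZr ipDr ipNr ipZr foot_n foot_n' mulr0 subr0.
by rewrite mulrN mulVf.
Qed.

Lemma hyp_foot : hyp o.
Proof.
have t := nrm_timelike n ij.
suff [] : timelike o by split => //; exact: foot_foot.
apply: (timelike_same_cone t); rewrite ?foot_foot ?ltrN10 //.
by rewrite ipC ipDr foot_n foot_n' add0r oppr_lt0 sinh_dst_gt0.
Qed.

Lemma frame_foot : frame o (n i).
Proof. by split; [exact: hyp_foot|exact: nn|exact: foot_n]. Qed.

Lemma n_foot : n j = sinh d *: o - cosh d *: n i.
Proof.
rewrite /foot scalerA mulfV // scale1r cE' scaleNr opprK addrK; done.
Qed.

Section Third.
Variable k : 'I_3.
Hypotheses (ik : i != k) (jk : j != k).
Local Notation w := (wn n i j k).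

Lemma foot_w : ip o w = 0.
Proof. by rewrite ipC /foot !ipE w_l w_r; ring. Qed.

(** Fermi coordinates of [planeP]: [t] is arclength along the wall from the foot [o], and [s] the
    signed distance to the wall, positive beyond it. The lines [n i] and [n j] are [t = 0] and
    [t = - d], and their reflections change only [t]. *)
Definition at_ t s : mink := cosh s *: line o (n i) t + sinh s *: w.

Lemma c3_at t s : c3 (at_ t s) = 0.
Proof. by rewrite /at_ c3D !c3Z c3_line ?c3_foot // c3_w; ring. Qed.

Lemma at_w t s : ip (at_ t s) w = sinh s.
Proof.
by rewrite /at_ ipDl 2!ipZl ip_line foot_w (ipC (n i)) w_l w_w //; ring.
Qed.

Lemma at_l t s : ip (at_ t s) (n i) = cosh s * sinh t.
Proof. by rewrite /at_ ipDl 2!ipZl ip_line foot_n nn w_l; ring. Qed.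

Lemma at_r t s : ip (at_ t s) (n j) = - (cosh s * sinh (t + d)).
Proof. by rewrite /at_ ipDl 2!ipZl ip_line foot_n' w_r cE' sinhD; ring. Qed.

Lemma atP X : hyp X -> c3 X = 0 -> exists t s, X = at_ t s.
Proof.
move=> hX X3; have [s sE] := sinh_surj (ip X w).
have [t tE] := sinh_surj (ip X (n i) / cosh s).
have cs0 := cosh_gt0 s; have ct0 := cosh_gt0 t.
have fE : ip X (n i) = cosh s * sinh t by rewrite tE mulrC divfK // gt_eqF.
have X_E := frame_expand X c3_foot (n3 i) (c3_w n i j k) foot_foot (nn i)
  (w_w n ij ik jk) foot_n foot_w (etrans (ipC _ _) (w_l n i j k)).
rewrite X3 scale0r addr0 -sE fE in X_E.
have A0 : 0 < - ip X o.
  by rewrite oppr_gt0; apply: timelike_ip_lt0; apply: hyp_timelike => //; exact: hyp_foot.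
have A2 : ip X o ^+ 2 = 1 + (cosh s * sinh t) ^+ 2 + sinh s ^+ 2.
  have [XX _] := hX.
  have : ip X X = - ip X o * ip X o + (cosh s * sinh t) * ip X (n i) + sinh s * ip X w.
    by rewrite {2}X_E !ipDr !ipZr.
  by rewrite XX fE -sE => e; rewrite !expr2; lra.
have AE : - ip X o = cosh s * cosh t.
  apply/eqP; rewrite -(eqrXn2 (n := 2)) ?(ltW A0) ?mulr_ge0 ?ltW //; apply/eqP.
  by rewrite sqrrN A2 !exprMn !sinh2E; ring.
by exists t, s; rewrite {1}X_E AE /at_ /line scalerDr !scalerA.
Qed.

Lemma refl_at_l t s : refl (n i) (at_ t s) = at_ (- t) s.
Proof.
by rewrite /refl at_l c3_at /at_ /line coshN sinhN; apply: minkP; rewrite !cE; ring.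
Qed.

Lemma refl_at_r t s : refl (n j) (at_ t s) = at_ (- t - 2 * d) s.
Proof.
rewrite /refl at_r c3_at n_foot /at_ /line.
have e : cosh d * cosh d - sinh d * sinh d - 1 = 0.
  by have := cosh2Bsinh2 d; rewrite !expr2 => ->; rewrite subrr.
have -> : cosh (- t - 2 * d) = cosh t + 2 * sinh (t + d) * sinh d.
  rewrite -coshN opprB opprK mulr_natl mulr2n addrC !coshD !sinhD; apply/subr0_eq.
  transitivity (cosh t * (cosh d * cosh d - sinh d * sinh d - 1)); first by ring.
  by rewrite e mulr0.
have -> : sinh (- t - 2 * d) = sinh t - 2 * sinh (t + d) * cosh d.
  rewrite -[LHS]opprK -sinhN opprB opprK mulr_natl mulr2n addrC !sinhD !coshD.
  apply/subr0_eq.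
  transitivity (sinh t * (cosh d * cosh d - sinh d * sinh d - 1)); first by ring.
  by rewrite e mulr0.
by apply: minkP; rewrite !cE; ring.
Qed.

End Third.
End Pair.
End Axes.

(** * Words in the three reflections and ping-pong *)

Section ReflectionGroup.
Variables (R : realType) (n : three_lines R).
Notation mink := (mink R).
Let n3 i : c3 (n i) = 0. Proof. exact: nrm_c3. Qed.
Let nn i : ip (n i) (n i) = 1. Proof. exact: nrm_unit. Qed.
Implicit Types (X Y : mink) (i j k a b : 'I_3) (x y : H3 R) (s t u : seq 'I_3).

Definition mirror i x : H3 R := pt (refl (n i) (emb x)).
Local Notation r := mirror.
Local Notation f i x := (ip (emb x) (n i)).

Lemma emb_mirror i x : emb (r i x) = refl (n i) (emb x).
Proof. by rewrite ptK //; apply: hyp_refl => //; exact: hyp_emb. Qed.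

Lemma mirrorK i : involutive (r i).
Proof. by move=> x; apply: emb_inj; rewrite !emb_mirror reflK. Qed.

Lemma f_mirror i x : f i (r i x) = - f i x.
Proof. by rewrite emb_mirror /refl !ipE nn ip_e3l n3; ring. Qed.

Lemma mirror_fix i x : c3 (emb x) = 0 -> f i x = 0 -> r i x = x.
Proof.
move=> x3 fx; apply: emb_inj; rewrite emb_mirror /refl x3 fx.
by apply: minkP; rewrite !cE; ring.
Qed.

Lemma ip_mirror_orth i x Y : c3 Y = 0 -> ip Y (n i) = 0 -> ip (emb (r i x)) Y = ip (emb x) Y.
Proof. by move=> Y3 Yn; rewrite emb_mirror /refl !ipE ip_e3l Y3 (ipC (n i)) Yn; ring. Qed.

Definition ev s : H3 R -> H3 R := foldr (fun i g => r i \o g) id s.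

Lemma ev_cat s t x : ev (s ++ t) x = ev s (ev t x).
Proof. by elim: s => //= a s ->. Qed.

Lemma ev_rev s x : ev (rev s) (ev s x) = x.
Proof.
elim: s x => //= a s IH x; rewrite rev_cons -cats1 ev_cat /= mirrorK; exact: IH.
Qed.

Lemma c3_ev s x : c3 (emb (ev s x)) = (-1) ^+ size s * c3 (emb x).
Proof.
elim: s => [|a s IH] /=; first by rewrite mul1r.
by rewrite emb_mirror c3_refl // IH exprS; ring.
Qed.

Lemma c3_ev0 s x : c3 (emb x) = 0 -> c3 (emb (ev s x)) = 0.
Proof. by move=> x3; rewrite c3_ev x3 mulr0. Qed.

Lemma odd_fix_c3 s x : odd (size s) -> ev s x = x -> c3 (emb x) = 0.
Proof.
move=> os ex; have := c3_ev s x; rewrite ex -signr_odd os /= expr1; lra.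
Qed.

Lemma ip_ev s x y : ip (emb (ev s x)) (emb (ev s y)) = ip (emb x) (emb y).
Proof. by elim: s => //= a s IH; rewrite !emb_mirror ip_refl. Qed.

Definition reduced s := sorted (fun a b => a != b) s.

(** Equal neighbours cancel in pairs, so the parity survives. *)
Lemma reduce s : exists t, [/\ reduced t, ev t = ev s & odd (size t) = odd (size s)].
Proof.
elim: s => [|a s [[|b t] [rt et ot]]]; first by exists [::].
  by exists [:: a]; split => //=; [rewrite -et|rewrite -ot].
have [ab|ab] := eqVneq a b.
  exists t; split; first exact: path_sorted rt.
    by apply/funext => x; rewrite /= -et ab /= mirrorK.
  by rewrite /= -ot /= negbK.
by exists [:: a, b & t]; split => //=; [rewrite ab|rewrite -et|rewrite -ot].
Qed.

Definition chamber x := c3 (emb x) = 0 /\ forall i, f i x <= 0.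

(** A point on or beyond the line [b] is strictly inside [a != b], so reflecting it in [a] brings it
    strictly beyond [a]. A single letter gives only a weak inequality, as a point of the chamber may
    lie on the line [a]. *)
Lemma pingpong a s x : chamber x -> reduced (a :: s) ->
  0 <= f a (ev (a :: s) x) /\ (s != [::] -> 0 < f a (ev (a :: s) x)).
Proof.
move=> [x3 fx]; elim: s a => [|b s IH] a /=.
  by rewrite f_mirror; split => //; have := fx a; lra.
move=> /andP[ab /IH[h _]]; rewrite f_mirror.
have := f_sum_lt0 n ab (hyp_emb (ev (b :: s) x)); rewrite /= in h * => h'.
by split => [|_]; lra.
Qed.

(** An odd word remains nonempty after reduction; ping-pong puts its fixed point on or beyond the
    line of the leading letter, and the chamber is on the other side. *)
Lemma chamber_odd_fix s x : chamber x -> odd (size s) -> ev s x = x ->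
  exists i, f i x = 0.
Proof.
move=> cx os ex; have [[|a t] [rt et ot]] := reduce s; first by rewrite -ot in os.
have [h1 h2] := pingpong cx rt; exists a; have [_ /(_ a) h3] := cx.
by apply: le_anti; rewrite h3 -ex -et h1.
Qed.

Section Triple.
Variables i j k : 'I_3.
Hypotheses (ij : i != j) (ik : i != k) (jk : j != k).
Local Notation w := (wn n i j k).
Local Notation d := (dst n i j).

Lemma third a : a != i -> a != j -> a = k.
Proof.
move=> ai aj; have := max_card (mem [:: a; i; j; k]); rewrite card_ord.
have [//|ak] := eqVneq a k.
by rewrite (card_uniqP _) //= !inE !negb_or ai aj ak ij ik jk.
Qed.

Lemma ip_w_mirror a x : a \in [:: i; j] -> ip (emb (r a x)) w = ip (emb x) w.
Proof.
rewrite !inE => aij; apply: ip_mirror_orth; first exact: c3_w.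
by case/orP: aij => /eqP->; rewrite ?w_l ?w_r.
Qed.

(* The last reflection moving the point out of the half-plane of [n k] leaves it
   on the negative side of [w]; the other two reflections preserve [ip _ w]. *)
Lemma orbit_w_le0 s x : chamber x -> ip (emb x) w <= 0 -> ip (emb (ev s x)) w <= 0.
Proof.
move=> cx wx; have [t [+ <- _]] := reduce s.
elim: t => [//|a t IH] rt.
have [ai|ai] := boolP (a \in [:: i; j]).
  by rewrite /= ip_w_mirror // IH //; exact: path_sorted rt.
have ak : a = k by apply: third; apply: contraNneq ai => ->; rewrite !inE eqxx ?orbT.
have [+ _] := pingpong cx rt; rewrite ak => h.
by apply: ltW; apply: (w_beyond ij ik jk (hyp_emb _) h).
Qed.

Lemma emb_mirror_at_l x (t s : R) : emb x = at_ n i j k t s -> emb (r i x) = at_ n i j k (- t) s.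
Proof. by move=> e; rewrite emb_mirror e refl_at_l. Qed.

Lemma emb_mirror_at_r x (t s : R) :
  emb x = at_ n i j k t s -> emb (r j x) = at_ n i j k (- t - 2 * d) s.
Proof. by move=> e; rewrite emb_mirror e refl_at_r. Qed.

(* Beyond the wall, [chamber] is the strip [- d <= t <= 0] between the lines [n i] and
   [n j], a fundamental domain for the group generated by their two reflections. *)
Lemma strip_reduction x : c3 (emb x) = 0 -> 0 < ip (emb x) w ->
  exists u, {subset u <= [:: i; j]} /\ chamber (ev u x).
Proof.
move=> x3 wx; have [t [s e]] := atP n ij ik jk (hyp_emb x) x3.
have d0 := dst_gt0 n ij.
have in_strip : forall y tau, emb y = at_ n i j k tau s -> - d <= tau <= 0 -> chamber y.
  move=> y tau ey /andP[t1 t2]; split; first by rewrite ey c3_at.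
  move=> a; have [->|ai] := eqVneq a i.
    by rewrite ey at_l pmulr_rle0 ?cosh_gt0 // leNgt sinh_gt0 -leNgt.
  have [->|aj] := eqVneq a j.
    rewrite ey at_r // oppr_le0 mulr_ge0 ?(ltW (cosh_gt0 _)) // sinh_ge0; lra.
  rewrite (third ai aj); apply: ltW; apply: (f_third_lt0 ij ik jk (hyp_emb _)).
  by rewrite ey at_w // -(at_w n ij ik jk t) -e ltW.
(* The induction runs on the number of strips of width [d] that cover the segment from 0 to [t]. *)
have tN : `|t| <= (Num.bound (`|t| / d))%:R * d.
  rewrite -ler_pdivrMr // ltW //; apply: archi_boundP.
  by rewrite divr_ge0 // ltW.
move: (Num.bound _) tN => N; rewrite ler_norml.
elim: N x t {x3 wx} e => [|N IH] x t e /andP[t1 t2].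
  by exists [::]; split => //; apply: (in_strip _ _ e); apply/andP; split; lra.
(* A reflection in [n i], if needed, makes the coordinate nonpositive. If it is still below [- d],
   the reflection in [n j] takes it to [- tau - 2 * d], for which the bound [N * d] holds. *)
have [y [u [tau [su yE ey tau1 tau2]]]] : exists y u tau, [/\ {subset u <= [:: i; j]},
    y = ev u x, emb y = at_ n i j k tau s, - (N.+1%:R * d) <= tau & tau <= 0].
  have [t0|t0] := leP t 0; first by exists x, [::], t.
  exists (r i x), [:: i], (- t); split; rewrite ?(emb_mirror_at_l e) //; try lra.
  by move=> a; rewrite !inE => ->.
have [td|td] := leP (- d) tau.
  by exists u; rewrite -yE; split => //; apply: (in_strip _ _ ey); rewrite td.
have N0 : (0 < N)%N.
  rewrite lt0n; apply: contraTneq td => N0; move: tau1; rewrite N0 mul1r => ?.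
  by rewrite -leNgt.
have N1 : 1 <= N%:R :> R by rewrite ler1n.
have dN : d <= N%:R * d by rewrite ler_peMl // ltW.
rewrite -natr1 mulrDl mul1r in tau1.
have [|v [sv cv]] := IH _ _ (emb_mirror_at_r ey); first by apply/andP; split; lra.
exists (v ++ j :: u); split; last by rewrite ev_cat /= -yE.
move=> a; rewrite mem_cat inE => /orP[/sv//|/orP[/eqP->|/su//]].
by rewrite !inE eqxx orbT.
Qed.

Lemma ip_w_ev u x : {subset u <= [:: i; j]} -> ip (emb (ev u x)) w = ip (emb x) w.
Proof.
elim: u => //= a u IH su; rewrite ip_w_mirror; last by apply: su; rewrite inE eqxx.
by apply: IH => b bu; apply: su; rewrite inE bu orbT.
Qed.

(** Conjugating the word by [u] moves its fixed point into the chamber and keeps it odd, so the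
    point lies on one of the three lines; beyond the wall this cannot be [n k]. *)
Lemma odd_fix_beyond s x : odd (size s) -> ev s x = x -> 0 < ip (emb x) w ->
  exists u a, [/\ ~~ odd (size u), a \in [:: i; j], c3 (emb (ev u x)) = 0,
    f a (ev u x) = 0 & ip (emb (ev u x)) w = ip (emb x) w].
Proof.
move=> os ex wx; have x3 := odd_fix_c3 os ex.
have [u [su cu]] := strip_reduction x3 wx.
have [|||a fa] := @chamber_odd_fix (u ++ s ++ rev u) (ev u x).
- exact: cu.
- by rewrite !size_cat size_rev addnCA addnn oddD os odd_double.
- by rewrite !ev_cat ev_rev ex.
have wu : ip (emb (ev u x)) w = ip (emb x) w by exact: ip_w_ev.
have aij : a \in [:: i; j].
  apply: contraT; rewrite !inE negb_or => /andP[ai aj].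
  have := f_third_lt0 (n := n) ij ik jk (hyp_emb (ev u x)).
  by rewrite wu => /(_ (ltW wx)); rewrite -(third ai aj) fa ltxx.
have u3 : c3 (emb (ev u x)) = 0 by exact: c3_ev0.
(* The reflection in [a] fixes the point reached, so it can be added to [u] to make the word
   even. *)
have [ou|ou] := boolP (odd (size u)); last by exists u, a.
by exists (a :: u), a; rewrite /= (mirror_fix u3 fa) negbK.
Qed.

End Triple.
End ReflectionGroup.

(** * Ideal points and the convex hull *)

Section IdealPoints.
Variable R : realType.
Notation mink := (mink R).
Implicit Types (x y z : H3 R) (X Y V N : mink) (p q : sphere R) (gamma : R -> H3 R).

(* The null vector over an ideal point, normalized by [c0 = 1]. *)
Definition null p : mink :=
  if p is Some (a +i* b)%C then
    let s := 1 + a ^+ 2 + b ^+ 2 in (1, 2 * a / s, 2 * b / s, (s - 2) / s)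
  else (1, 0, 0, 1).

Lemma c0_null p : c0 (null p) = 1.
Proof. by case: p => [[a b]|]. Qed.

Lemma null_null p : ip (null p) (null p) = 0.
Proof.
case: p => [[a b]|]; rewrite /null /ip !cT; last by ring.
by field; rewrite gt_eqF // -addrA ltr_pwDl ?addr_ge0 ?sqr_ge0.
Qed.

(** In the ball of vectors [emb x / c0 (emb x)], twice this number is the squared Euclidean distance
    to the boundary point [null p] plus the square of [(c0 (emb x))^-1]; so it tends to 0 as [x]
    tends to [p]. *)
Definition gap p x : R := - ip (emb x) (null p) / c0 (emb x).

Lemma c0_emb_gt0 x : 0 < c0 (emb x).
Proof. by case: (hyp_emb x). Qed.

Lemma gap_some a b x : gap (Some (a +i* b)%C) x =
  2 * (Normc.normc (hz x - (a +i* b)%C) ^+ 2 + ht x ^+ 2) /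
  ((1 + a ^+ 2 + b ^+ 2) * (1 + hx x ^+ 2 + hy x ^+ 2 + ht x ^+ 2)).
Proof.
have t0 := ht_gt0 x.
have s0 (u v : R) : 0 < 1 + u ^+ 2 + v ^+ 2 by rewrite -addrA ltr_pwDl ?addr_ge0 ?sqr_ge0.
have r0 : 0 < 1 + hx x ^+ 2 + hy x ^+ 2 + ht x ^+ 2 by rewrite ltr_wpDr ?sqr_ge0.
rewrite (_ : hz x - _ = ((hx x - a) +i* (hy x - b))%C) // sqr_normc.
rewrite /gap /null /ip /emb !cT; field.
rewrite !gt_eqF //=.
Qed.

Lemma gap_none x : gap None x = 2 / (1 + (Normc.normc (hz x) ^+ 2 + ht x ^+ 2)).
Proof.
have t0 := ht_gt0 x.
have r0 : 0 < 1 + hx x ^+ 2 + hy x ^+ 2 + ht x ^+ 2.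
  by rewrite -!addrA ltr_pwDl ?addr_ge0 ?sqr_ge0.
rewrite normc_hz2 /gap /null /ip /emb !cT; field.
by rewrite !addrA !gt_eqF.
Qed.

Lemma cvg_ideal_gap T (F : set_system T) (FF : Filter F) (u : T -> H3 R) p :
  cvg_ideal F u p -> forall e : R, 0 < e -> \forall t \near F, gap p (u t) < e.
Proof.
case: p => [[a b]|] h e e0.
  have e2 : 0 < e / 2 by rewrite divr_gt0.
  refine (filterS _ (cvgr0_norm_lt _ h _ e2)) => t /ltr_normlW lt_t.
  rewrite gap_some.
  have s1 (v w : R) : 1 <= 1 + v ^+ 2 + w ^+ 2 by rewrite -addrA lerDl addr_ge0 ?sqr_ge0.
  have r1 : 1 <= 1 + hx (u t) ^+ 2 + hy (u t) ^+ 2 + ht (u t) ^+ 2.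
    by have := s1 (hx (u t)) (hy (u t)); have := sqr_ge0 (ht (u t)); lra.
  have D1 := mulr_ege1 (s1 a b) r1.
  rewrite ltr_pdivrMr; last exact: lt_le_trans D1.
  apply: (@lt_le_trans _ _ e); first by move: lt_t; lra.
  by rewrite ler_peMr // ltW.
refine (filterS _ ((cvgryPgt _).1 h (2 / e))) => t lt_t.
rewrite gap_none ltr_pdivrMr; last first.
  by rewrite ltr_pwDl // addr_ge0 ?sqr_ge0.
by move: lt_t; rewrite ltr_pdivrMr // mulrDr mulr1 mulrC; lra.
Qed.

Definition norm2 Y : R := c0 Y ^+ 2 + c1 Y ^+ 2 + c2 Y ^+ 2 + c3 Y ^+ 2.

Lemma cauchy3 (a b c u v t : R) :
  (a * u + b * v + c * t) ^+ 2 <= (a ^+ 2 + b ^+ 2 + c ^+ 2) * (u ^+ 2 + v ^+ 2 + t ^+ 2).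
Proof.
rewrite -subr_ge0.
have -> : (a ^+ 2 + b ^+ 2 + c ^+ 2) * (u ^+ 2 + v ^+ 2 + t ^+ 2) - (a * u + b * v + c * t) ^+ 2
  = (a * v - b * u) ^+ 2 + (a * t - c * u) ^+ 2 + (b * t - c * v) ^+ 2 by ring.
by rewrite !addr_ge0 ?sqr_ge0.
Qed.

Lemma gap_bound p x Y :
  (ip (emb x) Y / c0 (emb x) - ip (null p) Y) ^+ 2 <= 2 * gap p x * norm2 Y /\
  (c0 (emb x))^-1 ^+ 2 <= 2 * gap p x.
Proof.
have [XX X0] := hyp_emb x; have N0 := c0_null p; have NN := null_null p.
rewrite /gap; move: (emb x) (null p) XX X0 N0 NN => X N XX X0 N0 NN.
have Xn : c0 X != 0 by rewrite gt_eqF.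
pose a := c1 X / c0 X; pose b := c2 X / c0 X; pose c := c3 X / c0 X.
have gE : - ip X N / c0 X = 1 - (a * c1 N + b * c2 N + c * c3 N).
  by rewrite /a /b /c /ip N0; field.
have xx : a ^+ 2 + b ^+ 2 + c ^+ 2 = 1 - (c0 X)^-1 ^+ 2.
  have -> : a ^+ 2 + b ^+ 2 + c ^+ 2 = 1 + ip X X * (c0 X)^-1 ^+ 2.
    by rewrite /a /b /c /ip; field.
  by rewrite XX; ring.
have nn : c1 N ^+ 2 + c2 N ^+ 2 + c3 N ^+ 2 = 1.
  by move: NN; rewrite /ip N0; lra.
have key : (a - c1 N) ^+ 2 + (b - c2 N) ^+ 2 + (c - c3 N) ^+ 2 + (c0 X)^-1 ^+ 2
   = 2 * (- ip X N / c0 X).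
  have -> : (c0 X)^-1 ^+ 2 = 1 - (a ^+ 2 + b ^+ 2 + c ^+ 2) by rewrite xx; ring.
  rewrite gE.
  transitivity (1 + (c1 N ^+ 2 + c2 N ^+ 2 + c3 N ^+ 2) - 2 * (a * c1 N + b * c2 N + c * c3 N)).
    by ring.
  by rewrite nn; ring.
split; last first.
  rewrite -key lerDr.
  by rewrite !addr_ge0 ?sqr_ge0.
have -> : ip X Y / c0 X - ip N Y =
  (a - c1 N) * c1 Y + (b - c2 N) * c2 Y + (c - c3 N) * c3 Y.
  by rewrite /a /b /c /ip N0; field.
apply: (le_trans (cauchy3 _ _ _ _ _ _)).
rewrite -key; apply: ler_pM; rewrite ?addr_ge0 ?sqr_ge0 //.
  by rewrite lerDl sqr_ge0.
by rewrite /norm2; have := sqr_ge0 (c0 Y); lra.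
Qed.

Lemma norm2_ge0 Y : 0 <= norm2 Y.
Proof. by rewrite /norm2 !addr_ge0 ?sqr_ge0. Qed.

(** After division by [c0], the product with [Y] extends continuously to ideal points, while any
    constant [C] becomes negligible. *)
Lemma cvg_ideal_ip T (F : set_system T) (FF : Filter F) (u : T -> H3 R) p Y C :
  cvg_ideal F u p -> forall e : R, 0 < e -> \forall t \near F,
  `|ip (emb (u t)) Y / c0 (emb (u t)) - ip (null p) Y| < e /\ C / c0 (emb (u t)) < e.
Proof.
move=> h e e0.
pose K := 2 * norm2 Y + 2 * C ^+ 2 + 1.
have N0 := norm2_ge0 Y; have C0 := sqr_ge0 C.
have K0 : 0 < K by rewrite /K; lra.
have d0 : 0 < e ^+ 2 / K by rewrite divr_gt0 ?exprn_gt0.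
refine (filterS _ (cvg_ideal_gap FF h d0)) => t.
rewrite ltr_pdivlMr // => gK.
have [h1 h2] := gap_bound p (u t) Y.
have g0 : 0 <= gap p (u t).
  by have := le_trans (sqr_ge0 _) h2; rewrite pmulr_rge0.
split.
  rewrite -ltr_sqr ?nnegrE ?(ltW e0) // real_normK ?num_real //.
  apply: (le_lt_trans h1); apply: le_lt_trans gK.
  by rewrite /K !mulrDr mulr1; have := mulr_ge0 g0 C0; lra.
apply: ltr_sqr_pos => //; rewrite exprMn; apply: le_lt_trans gK.
have := ler_wpM2l C0 h2 => h3; apply: (le_trans h3).
rewrite /K; move: g0 N0; move: (gap _ _) (norm2 _) => g N g0 N0.
by have := mulr_ge0 g0 N0; lra.
Qed.

Lemma cvg_ideal_bounded T (F : set_system T) (FF : ProperFilter F) (u : T -> H3 R) p Y C :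
  cvg_ideal F u p -> (forall t, ip (emb (u t)) Y <= C) -> ip (null p) Y <= 0.
Proof.
move=> h uC; rewrite leNgt; apply/negP => Y0.
have e0 : 0 < ip (null p) Y / 2 by rewrite divr_gt0.
have [t [/ltr_normlP[h1 _] h2]] := filter_ex (@cvg_ideal_ip T F _ u p Y C h _ e0).
rewrite opprB in h1.
have : ip (emb (u t)) Y / c0 (emb (u t)) <= C / c0 (emb (u t)).
  by rewrite ler_pM2r ?invr_gt0 ?c0_emb_gt0.
by move: h1 h2; lra.
Qed.

End IdealPoints.

(** * Ends of geodesics *)

Section Ends.
Variable R : realType.
Notation mink := (mink R).
Implicit Types (x y z : H3 R) (X Y V N : mink) (p q : sphere R) (gamma : R -> H3 R).

Lemma coshDsinh t : cosh t + sinh t = expR t :> R.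
Proof. by rewrite coshE sinhE; field. Qed.

Lemma coshBsinh t : cosh t - sinh t = expR (- t) :> R.
Proof. by rewrite coshE sinhE; field. Qed.

Lemma cvg_ideal_comp S T (F : set_system T) (F' : set_system S) (u : T -> H3 R)
    (g : S -> T) p :
  cvg_ideal F u p -> g @ F' --> F -> cvg_ideal F' (u \o g) p.
Proof.
case: p => [a|] h gF; rewrite /cvg_ideal /=.
  exact: (cvg_comp _ _ gF h).
exact: (cvg_comp _ _ gF h).
Qed.

(** If [eta] were positive, [ip _ Y] would eventually exceed [expR t * eta / 4], while [c0] is at
    most [expR t * K]; the quotient would stay above [eta / (4 * K)], although its limit is not
    positive. *)
Lemma forward_end_le0 gamma X V q Y : (forall t, emb (gamma t) = line X V t) ->
  cvg_ideal +oo gamma q -> ip (null q) Y <= 0 -> ip (X + V) Y <= 0.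
Proof.
move=> gE cq qY; rewrite leNgt; apply/negP; set eta := ip _ _ => eta0.
pose zeta : R := `|ip (X - V) Y|; pose K : R := `|c0 (X + V)| + `|c0 (X - V)| + 1.
have K0 : 0 < K by rewrite ltr_wpDl // addr_ge0.
have z0 : 0 <= zeta by exact: normr_ge0.
have e0 : 0 < eta / (4 * K) by rewrite divr_gt0 ?mulr_gt0.
have [t [[[/ltr_normlP[_ h1] _] /= t0] /= tz]] := filter_ex (filterI (filterI
  (@cvg_ideal_ip _ _ +oo _ gamma q Y 0 cq _ e0) (nbhs_pinfty_gt (num_real 0)))
  (nbhs_pinfty_gt (num_real (2 * zeta / eta)))).
have E1 : 1 + t <= expR t by exact: expR_ge1Dx.
have E2 : 0 < expR (- t) <= 1 by rewrite expR_gt0 expR_le1 oppr_le0 ltW.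
have dec : ip (emb (gamma t)) Y = (expR t * eta + expR (- t) * ip (X - V) Y) / 2.
  by rewrite gE ip_line -coshDsinh -coshBsinh /eta !ipE; field.
have c0dec : c0 (emb (gamma t)) = (expR t * c0 (X + V) + expR (- t) * c0 (X - V)) / 2.
  by rewrite gE /line !cE -coshDsinh -coshBsinh; field.
have [E0 E2'] := andP E2.
have c0K : c0 (emb (gamma t)) <= expR t * K.
  rewrite c0dec /K.
  have a1 := ler_wpM2l (ltW (expR_gt0 t)) (ler_norm (c0 (X + V))).
  have a2 := ler_wpM2l (ltW E0) (ler_norm (c0 (X - V))).
  have a3 : expR (- t) * `|c0 (X - V)| <= expR t * `|c0 (X - V)|.
    by apply: ler_wpM2r => //; lra.
  have a4 := mulr_ge0 (ltW (expR_gt0 t)) (normr_ge0 (c0 (X + V))).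
  have a5 := mulr_ge0 (ltW (expR_gt0 t)) (normr_ge0 (c0 (X - V))).
  by have := expR_gt0 t; lra.
have C0 := c0_emb_gt0 (gamma t).
have phi_lt : ip (emb (gamma t)) Y < expR t * eta / 4.
  have : ip (emb (gamma t)) Y / c0 (emb (gamma t)) < eta / (4 * K) by lra.
  rewrite ltr_pdivrMr // => h; apply: (lt_le_trans h).
  have := ler_wpM2l (ltW e0) c0K.
  have -> : eta / (4 * K) * (expR t * K) = expR t * eta / 4 by field; rewrite gt_eqF.
  done.
have a6 : - zeta <= expR (- t) * ip (X - V) Y.
  have : `|expR (- t) * ip (X - V) Y| <= zeta.
    by rewrite normrM (gtr0_norm E0) ler_piMl.
  by rewrite ler_norml => /andP[].
have : 2 * zeta < expR t * eta.
  by rewrite -ltr_pdivrMr //; lra.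
by move: phi_lt; rewrite dec; lra.
Qed.

(** [X + V] and [X - V] are null vectors over the two ends, and each point of the geodesic is a
    positive combination of them. *)
Lemma geodesic_ideal_le0 gamma p q Y : geodesic gamma ->
  cvg_ideal -oo gamma p -> cvg_ideal +oo gamma q ->
  ip (null p) Y <= 0 -> ip (null q) Y <= 0 -> forall t, ip (emb (gamma t)) Y <= 0.
Proof.
move=> /geodesicE[V [f gE]] cp cq pY qY t; set X := emb (gamma 0) in f gE.
have h1 := forward_end_le0 gE cq qY.
have gE' s : emb ((gamma \o -%R) s) = line X (- V) s.
  by rewrite /= gE /line coshN sinhN scaleNr scalerN.
have h2 : ip (X - V) Y <= 0.
  apply: (forward_end_le0 gE' _ pY); apply: (cvg_ideal_comp cp).
  by apply/cvgNry; rewrite opprK; exact: cvg_id.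
have -> : ip (emb (gamma t)) Y = (expR t * ip (X + V) Y + expR (- t) * ip (X - V) Y) / 2.
  by rewrite gE ip_line -coshDsinh -coshBsinh !ipE; field.
by have := mulr_ge0_le0 (expR_ge0 t) h1; have := mulr_ge0_le0 (expR_ge0 (- t)) h2; lra.
Qed.

Lemma null_direction N : c3 N = 0 -> c0 N != 0 ->
  (c1 N / c0 N) ^+ 2 + (c2 N / c0 N) ^+ 2 = 1 ->
  null (Some ((c1 N / c0 N) +i* (c2 N / c0 N))%C) = (c0 N)^-1 *: N.
Proof.
move=> N3 n0 ab; rewrite /null -addrA ab (_ : 1 + 1 = 2) //.
by apply: minkP; rewrite ?(c0Z, c1Z, c2Z, c3Z) ?cT ?N3; field.
Qed.

Lemma line_end gamma X V : frame X V -> c3 X = 0 -> c3 V = 0 ->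
  (forall t, emb (gamma t) = line X V t) -> exists q, cvg_ideal +oo gamma q.
Proof.
move=> f X3 V3 gE; have [hX VV XV] := f; have [XX X0] := hX.
set N := X + V.
have N3 : c3 N = 0 by rewrite /N c3D X3 V3 addr0.
have NN : ip N N = 0 by rewrite /N !ipE XX VV XV (ipC V) XV; ring.
have XN : ip X N = -1 by rewrite /N ipDr XX XV addr0.
have N0 : 0 < c0 N.
  have [h|//|h] := ltgtP (c0 N) 0.
    have := @timelike_causal_lt0 _ X (- N) (hyp_timelike hX).
    rewrite ipNl !ipNr NN XN !oppr0 lexx c0N oppr_gt0 opprK => /(_ isT h); lra.
  have : ip X N = 0; last by rewrite XN => /eqP; rewrite oppr_eq0 oner_eq0.
  have sq0 (a b : R) : a ^+ 2 + b ^+ 2 = 0 -> a = 0 /\ b = 0.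
    move/eqP; rewrite paddr_eq0 ?sqr_ge0 // !sqrf_eq0.
    by move=> /andP[/eqP -> /eqP ->].
  have [|n1 n2] := sq0 (c1 N) (c2 N); first by move: NN; rewrite /ip h N3; lra.
  by rewrite /ip h n1 n2 N3; ring.
(* The end is the null direction [N] scaled to [c0 = 1]; it lies on the unit circle because
   [c3 N = 0]. *)
pose a := c1 N / c0 N; pose b := c2 N / c0 N.
have ab : a ^+ 2 + b ^+ 2 = 1.
  have -> : a ^+ 2 + b ^+ 2 = 1 + ip N N / c0 N ^+ 2.
    by rewrite /a /b /ip N3; field; rewrite gt_eqF.
  by rewrite NN mul0r addr0.
have nullE : null (Some (a +i* b)%C) = (c0 N)^-1 *: N.
  by apply: null_direction => //; rewrite gt_eqF.
exists (Some (a +i* b)%C); rewrite /cvg_ideal.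
pose K := 2 / c0 N.
have K0 : 0 < K by rewrite divr_gt0.
apply: (@squeeze_cvgr _ _ _ _ (fun=> 0) (fun t => K * expR (- t))).
- near=> t; apply/andP; split; first by rewrite addr_ge0 ?sqr_ge0.
  have g3 : c3 (emb (gamma t)) = 0 by rewrite gE c3_line.
  have r1 : hx (gamma t) ^+ 2 + hy (gamma t) ^+ 2 + ht (gamma t) ^+ 2 = 1.
    by rewrite -normc_hz2; apply/planePE.
  have := gap_some a b (gamma t).
  rewrite (_ : 1 + a ^+ 2 + b ^+ 2 = 2); last by lra.
  rewrite (_ : 1 + _ + _ + _ = 2); last by lra.
  rewrite /gap nullE ipZr gE ip_line XN (_ : ip V N = 1); last first.
    by rewrite /N ipDr VV (ipC V) XV add0r.
  have C1 := hyp_c0_ge1 (hyp_emb (gamma t)); rewrite gE in C1.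
  have -> : - ((c0 N)^-1 * (cosh t * -1 + sinh t * 1)) = expR (- t) / c0 N.
    by rewrite -coshBsinh; field; rewrite gt_eqF.
  set D := _ + _ => DE.
  have -> : D = K * expR (- t) / c0 (line X V t).
    have -> : D = 2 * (2 * D / (2 * 2)) by field.
    by rewrite -DE /K; ring.
  have L0 : 0 < c0 (line X V t) by lra.
  have KE : 0 <= K * expR (- t) by rewrite mulr_ge0 ?expR_ge0 // ltW.
  have goal : K * expR (- t) / c0 (line X V t) <= K * expR (- t).
    by rewrite ler_pdivrMr // ler_peMr.
  exact: goal.
- exact: cvg_cst.
- rewrite -(mulr0 K); apply: cvgMr; exact: cvgr_expR.
Unshelve. all: by end_near.
Qed.

(** The iterates of [T] carry [gamma 0] to the points [gamma (m * l)], which are distinct because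
    [l] is positive. *)
Lemma translation_end (G : set (H3 R -> H3 R)) (T : H3 R -> H3 R) gamma X V l :
  frame X V -> c3 X = 0 -> c3 V = 0 -> (forall t, emb (gamma t) = line X V t) ->
  0 < l -> (forall t, T (gamma t) = gamma (t + l)) -> (forall m, G (iter m T)) ->
  exists2 q, limit_set G q & cvg_ideal +oo gamma q.
Proof.
move=> f X3 V3 gE l0 Tg GT; have [q cq] := line_end f X3 V3 gE.
have geo := geodesic_line f gE.
have iterE m : iter m T (gamma 0) = gamma (m%:R * l).
  by elim: m => [|m IH] /=; rewrite ?mul0r // IH Tg -natr1 mulrDl mul1r.
exists q => //; exists (gamma 0), (fun m => iter m T); split => //.
  move=> m m' /(congr1 (fun g => g (gamma 0))); rewrite !iterE => e.
  have := geo (m%:R * l) (m'%:R * l); rewrite e.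
  rewrite hdistxx.
  move=> /esym/eqP; rewrite normr_eq0 -mulrBl mulf_eq0 (gt_eqF l0) orbF subr_eq0.
  by rewrite eqr_nat => /eqP.
have -> : (fun m => iter m T (gamma 0)) = gamma \o (fun m : nat => m%:R * l).
  by apply/funext => m; rewrite iterE.
apply: (cvg_ideal_comp cq).
exact: (cvg_comp _ _ (@cvgr_idn R) (gt0_cvgMly l0 (@cvg_id _ (+oo : set_system R)))).
Qed.

End Ends.

(** * Half-spaces that contain the hull *)

Section HullGeneral.
Variable R : realType.
Notation mink := (mink R).
Implicit Types (x y z : H3 R) (X O Y W : mink) (G : set (H3 R -> H3 R)).

Lemma hconvex_hull G : hconvex (hull G).
Proof.
move=> x y hx hy z xyz K cK gK; apply: (cK x y) => //; [exact: hx|exact: hy].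
Qed.

Lemma hull_halfspace G Y : (forall p, limit_set G p -> ip (null p) Y <= 0) ->
  forall x, hull G x -> ip (emb x) Y <= 0.
Proof.
move=> hY x hx; apply: (hx [set y | ip (emb y) Y <= 0]) => [y z y0 z0 t /segmentE[a [b [a0 b0 e]]]|gamma p q geo hp hq cp cq].
  by rewrite /= e !ipE; have := mulr_ge0_le0 a0 y0; have := mulr_ge0_le0 b0 z0; lra.
by move=> _ [t _ <-] /=; apply: (geodesic_ideal_le0 geo cp cq); exact: hY.
Qed.

Lemma ip_orth_cauchy X U W : timelike X -> ip X U = 0 -> ip X W = 0 -> 0 < ip W W ->
  ip U W ^+ 2 <= ip U U * ip W W.
Proof.
move=> tX XU XW W0.
have := ip_orth_ge0 (W := U - (ip U W / ip W W) *: W) tX.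
rewrite !ipE XU XW (ipC W U) => h; have {}h := h ltac:(ring).
have -> : ip U U * ip W W = ip U W ^+ 2 + ip W W *
   (ip U U - ip U W / ip W W * ip U W - ip U W / ip W W * (ip U W - ip U W / ip W W * ip W W)).
  by field; rewrite gt_eqF.
by rewrite lerDl mulr_ge0 ?(ltW W0) //; lra.
Qed.

(* If [O] is not beyond the plane with unit normal [W], then [X] is at distance
   at most [d(X, O)] beyond it. *)
Lemma ip_le_hyp X O W : hyp X -> hyp O -> ip W W = 1 -> ip O W <= 0 ->
  ip X W <= - ip X O.
Proof.
move=> hX hO WW OW; have [[XX _] [OO _]] := (hX, hO).
have C1 := hyp_ip_leN1 hX hO; rewrite leNgt; apply/negP => lt.
have tX := hyp_timelike hX.
have pW : 0 < ip (W + ip X W *: X) (W + ip X W *: X).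
  by rewrite !ipE WW XX (ipC W X); have := sqr_ge0 (ip X W); lra.
(* Cauchy-Schwarz for the components of [O] and [W] orthogonal to [X], where the form is positive
   definite. *)
have := ip_orth_cauchy (U := O + ip X O *: X) (W := W + ip X W *: X) tX _ _ pW.
rewrite !ipE XX WW OO (ipC W X) (ipC O X) => h; have {}h := h ltac:(ring) ltac:(ring).
move: h C1 lt OW; move: (ip X O) (ip X W) (ip O W) => C a b h C1 lt OW.
have : a * b * C >= 0 by rewrite mulr_le0 //; [rewrite mulr_ge0_le0 //; lra|lra].
by have := sqr_ge0 b; nra.
Qed.

Lemma bounded_limit_set G Y : (forall x, exists C, forall g, G g -> ip (emb (g x)) Y <= C) ->
  forall p, limit_set G p -> ip (null p) Y <= 0.
Proof.
move=> hC p [x [u [Gu _ cu]]]; have [C hx] := hC x.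
by apply: (cvg_ideal_bounded _ cu) => m; apply: hx; exact: Gu.
Qed.

End HullGeneral.

(** * The hull of the group of even words and its walls *)

Section Hull.
Variables (R : realType) (n : three_lines R).
Notation mink := (mink R).
Let n3 i : c3 (n i) = 0. Proof. exact: nrm_c3. Qed.
Implicit Types (X Y : mink) (i j k : 'I_3) (x y : H3 R) (s : seq 'I_3).

Definition even_group : set (H3 R -> H3 R) :=
  [set g | exists2 s, ~~ odd (size s) & g = ev n s].
Local Notation G := even_group.

(** Even words preserve [c3], which is therefore bounded in both directions on each orbit. *)
Lemma hull_planeP x : hull G x -> c3 (emb x) = 0.
Proof.
have c3G g y : G g -> c3 (emb (g y)) = c3 (emb y).
  by case=> s os ->; rewrite c3_ev -signr_odd (negPf os) mul1r.
move=> hx; apply: le_anti; apply/andP; split.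
  rewrite -ip_e3; apply: hull_halfspace hx; apply: bounded_limit_set => y.
  by exists (c3 (emb y)) => g Gg; rewrite ip_e3 c3G.
rewrite -oppr_le0 -ip_e3 -ipNr; apply: hull_halfspace hx; apply: bounded_limit_set => y.
by exists (- c3 (emb y)) => g Gg; rewrite ipNr ip_e3 c3G.
Qed.

Section Triple.
Variables i j k : 'I_3.
Hypotheses (ij : i != j) (ik : i != k) (jk : j != k).
Local Notation w := (wn n i j k).
Local Notation o := (foot n i j).
Local Notation d := (dst n i j).
Local Notation gam t := (pt (line o (n i) t)).

Let emb_gam t : emb (gam t) = line o (n i) t.
Proof. by rewrite emb_pt_line //; exact: frame_foot. Qed.

Lemma chamber_foot : chamber n (pt o) /\ ip (emb (pt o)) w = 0.
Proof.
have e : emb (pt o) = o by rewrite ptK //; exact: hyp_foot.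
have ow : ip o w = 0 by rewrite foot_w.
rewrite /chamber e c3_foot; split=> //; split=> // a.
have [->|ai] := eqVneq a i; first by rewrite foot_n.
have [->|aj] := eqVneq a j; first by rewrite foot_n' // oppr_le0 ltW // sinh_dst_gt0.
rewrite (third ij ik jk ai aj); apply: ltW; apply: (f_third_lt0 ij ik jk (hyp_foot n ij)).
by rewrite ow.
Qed.

(** The foot [o] is in the chamber and on the wall, so its orbit never passes beyond the wall. The
    image of [y] stays at the fixed distance d(y, o) from the image of [o], which bounds how far it
    can pass. *)
Lemma hull_w_le0 x : hull G x -> ip (emb x) w <= 0.
Proof.
apply: hull_halfspace; apply: bounded_limit_set => y.
have [co ow] := chamber_foot.
exists (- ip (emb y) (emb (pt o))) => _ [s os ->].
rewrite -(ip_ev n s); apply: ip_le_hyp; [exact: hyp_emb|exact: hyp_emb|exact: w_w|].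
by apply: orbit_w_le0 => //; rewrite ow.
Qed.

Lemma mirror_gam_l t : mirror n i (gam t) = gam (- t).
Proof.
apply: emb_inj; rewrite emb_mirror !emb_gam.
have := refl_at_l n i j k t 0; rewrite /at_ !cosh0 !sinh0 !scale1r !scale0r !addr0; exact.
Qed.

Lemma mirror_gam_r t : mirror n j (gam t) = gam (- t - 2 * d).
Proof.
apply: emb_inj; rewrite emb_mirror !emb_gam.
have := refl_at_r n ij k t 0; rewrite /at_ !cosh0 !sinh0 !scale1r !scale0r !addr0; exact.
Qed.

Lemma axisP x : c3 (emb x) = 0 -> ip (emb x) w = 0 -> exists t, x = gam t.
Proof.
move=> x3 xw; have [t [s e]] := atP n ij ik jk (hyp_emb x) x3.
have s0 : s = 0 by apply: sinh_inj; rewrite -(at_w n ij ik jk t) -e xw sinh0.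
by exists t; apply: emb_inj; rewrite emb_gam e s0 /at_ cosh0 sinh0 scale1r scale0r addr0.
Qed.

(** The words [[:: i; j]] and [[:: j; i]] translate along the wall by [2 * d] in opposite
    directions, so both ends of the wall are limit points. *)
Lemma axis_hull x : c3 (emb x) = 0 -> ip (emb x) w = 0 -> hull G x.
Proof.
move=> x3 xw; have d0 := dst_gt0 n ij; have d20 : 0 < 2 * d by lra.
have f : frame o (n i) := frame_foot n ij.
have [t ->] := axisP x3 xw.
have iterG u : ~~ odd (size u) -> forall m, G (iter m (ev n u)).
  move=> ou m; exists (flatten (nseq m u)).
    elim: m => //= m IH; rewrite size_cat oddD (negPf ou) (negPf IH); done.
  elim: m => //= m IH; apply/funext => y; rewrite /= ev_cat IH; done.
have [q hq cq] : exists2 q, limit_set G q & cvg_ideal +oo (fun t => gam t) q.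
  apply: (translation_end f _ _ emb_gam d20 _ (iterG [:: i; j] isT)) => // [|s].
    exact: c3_foot.
  by rewrite /= mirror_gam_r mirror_gam_l; congr (pt (line _ _ _)); ring.
have [p hp cp] : exists2 p, limit_set G p & cvg_ideal +oo (fun t => gam (- t)) p.
  apply: (@translation_end _ _ _ _ o (- n i) _ _ _ _ _ d20 _ (iterG [:: j; i] isT)) => [||| s|s].
  - by have [? ? on] := f; split; rewrite ?ipNl ?ipNr ?opprK // on oppr0.
  - exact: c3_foot.
  - by rewrite c3N n3 oppr0.
  - by rewrite emb_gam /line coshN sinhN scaleNr scalerN.
  - by rewrite /= mirror_gam_l mirror_gam_r; congr (pt (line _ _ _)); ring.
move=> K _; apply => //; [exact: geodesic_pt f|exact: hp|exact: hq| |exact: cq|by exists t].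
have -> : (fun t => gam t) = (fun t => gam (- t)) \o -%R.
  by apply/funext => s; rewrite /= opprK.
by apply: (cvg_ideal_comp cp); apply/cvgNry; exact: cvg_id.
Qed.

End Triple.
End Hull.

(** * Normal lines to [planeP] *)

Section NormalLines.
Variable R : realType.
Notation mink := (mink R).
Local Notation e3 := (e3 R).
Implicit Types (x y : H3 R) (X Y V W : mink) (gamma delta : R -> H3 R).

Lemma is_derive_hyperbolic (p q : R) :
  is_derive (0 : R) 1 (fun t => cosh t * p + sinh t * q) q.
Proof.
have h1 := is_derive_cosh (0 : R); have h2 := is_derive_sinh (0 : R).
rewrite sinh0 in h1; rewrite cosh0 in h2.
have -> : (fun t => cosh t * p + sinh t * q) = p *: @cosh R + q *: @sinh R.
  by apply/funext => t; rewrite mulrC [sinh t * q]mulrC.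
apply: (is_derive_eq (is_deriveD (is_deriveZ p h1) (is_deriveZ q h2))).
by rewrite /GRing.scale /=; ring.
Qed.

Lemma derive1_quotient (p q a b : R) : p != 0 ->
  derive1 (fun t => (cosh t * a + sinh t * b) / (cosh t * p + sinh t * q)) 0 =
  (b * p - a * q) / p ^+ 2.
Proof.
move=> p0; rewrite derive1E.
have h1 := is_derive_hyperbolic a b; have h2 := is_derive_hyperbolic p q.
have n0 : cosh 0 * p + sinh 0 * q != 0 by rewrite cosh0 sinh0 mul1r mul0r addr0.
have h3 := @is_deriveV R (fun t => cosh t * p + sinh t * q) 0 _ _ n0 h2.
have h4 := is_deriveM h1 h3.
rewrite (_ : (fun t => _) = (fun t : R => cosh t * a + sinh t * b) *
  (fun t : R => (cosh t * p + sinh t * q)^-1)) //.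
rewrite (@derive_val _ _ _ _ _ _ _ h4) cosh0 sinh0 /GRing.scale /=.
by rewrite !mul1r !mul0r !addr0; field.
Qed.

Lemma derive1_line gamma X V : frame X V -> (forall t, emb (gamma t) = line X V t) ->
  let p := c0 X - c3 X in let q := c0 V - c3 V in
  [/\ p != 0, derive1 (@hx R \o gamma) 0 = (c1 V * p - c1 X * q) / p ^+ 2,
    derive1 (@hy R \o gamma) 0 = (c2 V * p - c2 X * q) / p ^+ 2
    & derive1 (@ht R \o gamma) 0 = - q / p ^+ 2].
Proof.
move=> f gE p q; have g0 : emb (gamma 0) = X.
  by rewrite gE /line cosh0 sinh0 scale1r scale0r addr0.
have p0 : p != 0 by rewrite /p -g0 c0Bc3_emb invr_eq0 gt_eqF ?ht_gt0.
have pE t : c0 (emb (gamma t)) - c3 (emb (gamma t)) = cosh t * p + sinh t * q.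
  by rewrite gE /line !cE /p /q; ring.
have c1E t : c1 (emb (gamma t)) = cosh t * c1 X + sinh t * c1 V by rewrite gE /line !cE.
have c2E t : c2 (emb (gamma t)) = cosh t * c2 X + sinh t * c2 V by rewrite gE /line !cE.
split => //.
- rewrite -derive1_quotient //; congr (derive1 _ 0); apply/funext => t.
  by rewrite /= hxE pE c1E.
- rewrite -derive1_quotient //; congr (derive1 _ 0); apply/funext => t.
  by rewrite /= hyE pE c2E.
- have h := is_derive_hyperbolic p q.
  have n0 : cosh 0 * p + sinh 0 * q != 0 by rewrite cosh0 sinh0 mul1r mul0r addr0.
  have h3 := @is_deriveV R (fun t => cosh t * p + sinh t * q) 0 _ _ n0 h.
  rewrite derive1E (_ : _ \o _ = fun t : R => (cosh t * p + sinh t * q)^-1); last first.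
    by apply/funext => t; rewrite /= htE pE.
  by rewrite (@derive_val _ _ _ _ _ _ _ h3) cosh0 sinh0 mul1r mul0r addr0 /GRing.scale /= mulNr mulrC mulNr.
Qed.

(** Conformality: the Euclidean product of the velocities is [ip V W / p ^+ 2], where [p] is the
    inverse height of the common point. *)
Lemma perp_at0P gamma delta X V W : frame X V -> frame X W ->
  (forall t, emb (gamma t) = line X V t) -> (forall t, emb (delta t) = line X W t) ->
  perp_at0 gamma delta <-> ip V W = 0.
Proof.
move=> fV fW gE dE; have [hX VV XV] := fV; have [_ _ XW] := fW; have [XX _] := hX.
have [p0 gx gy gt] := derive1_line fV gE; have [_ dx dy dt] := derive1_line fW dE.
rewrite /perp_at0 gx gy gt dx dy dt.
move: p0 XX XV XW; set p := c0 X - c3 X => p0 XX XV XW.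
set D := _ + _.
have -> : D = ip V W / p ^+ 2.
  have xx : c1 X ^+ 2 + c2 X ^+ 2 + 1 = p * (c0 X + c3 X).
    by move: XX; rewrite /ip /p; lra.
  have xv : c1 X * c1 V + c2 X * c2 V = c0 X * c0 V - c3 X * c3 V.
    by move: XV; rewrite /ip; lra.
  have xw : c1 X * c1 W + c2 X * c2 W = c0 X * c0 W - c3 X * c3 W.
    by move: XW; rewrite /ip; lra.
  transitivity ((p ^+ 2 * (c1 V * c1 W + c2 V * c2 W)
     - p * ((c0 W - c3 W) * (c1 X * c1 V + c2 X * c2 V)
            + (c0 V - c3 V) * (c1 X * c1 W + c2 X * c2 W))
     + (c0 V - c3 V) * (c0 W - c3 W) * (c1 X ^+ 2 + c2 X ^+ 2 + 1)) / p ^+ 4).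
    by rewrite /D; field.
  rewrite xx xv xw; transitivity (p ^+ 2 * ip V W / p ^+ 4); last by field.
  by congr (_ / _); rewrite /ip /p; ring.
split => [/eqP|->]; last by rewrite mul0r.
by rewrite mulf_eq0 invr_eq0 sqrf_eq0 (negPf p0) orbF => /eqP.
Qed.

Lemma frame_e3 X : hyp X -> c3 X = 0 -> frame X e3.
Proof. by move=> hX X3; split; rewrite ?ip_e3e3 ?ip_e3. Qed.

Lemma normal_lineP x gamma : normal_line x gamma <->
  c3 (emb x) = 0 /\ forall t, emb (gamma t) = line (emb x) e3 t.
Proof.
split=> [[/planePE x3 geo g0 perp ext]|[x3 gE]]; last first.
  have f := frame_e3 (hyp_emb x) x3.
  have g0 : gamma 0 = x.
    by apply: emb_inj; rewrite gE /line cosh0 sinh0 scale1r scale0r addr0.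
  split => //; [exact/planePE|exact: geodesic_line f gE| |].
    move=> delta gd dP d0; have [W [fW dE]] := geodesicE gd.
    rewrite d0 in fW dE; apply/(perp_at0P f fW gE dE).
    have /planePE : planeP (delta 1) by apply: dP; exists 1.
    rewrite ip_e3l dE /line !cE x3 mulr0 add0r => /eqP.
    by rewrite mulf_eq0 gt_eqF ?sinh_gt0 //= => /eqP.
  move=> t t0; apply/exteriorPE; rewrite gE /line !cE x3 mulr0 add0r.
  by rewrite mulr_gt0 ?sinh_gt0 // /e3 !cT.
split => //; have [V [f gE]] := geodesicE geo; rewrite g0 in f gE.
have [hX VV XV] := f.
have V3 : 0 < c3 V.
  have /exteriorPE := ext 1 ltr01.
  by rewrite gE /line !cE x3 mulr0 add0r pmulr_rgt0 // sinh_gt0.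
(* [U] is the part of the velocity tangent to [planeP]. If it were nonzero, the geodesic of [planeP]
   in its direction would not be orthogonal to [gamma]. *)
pose U := V - c3 V *: e3.
have U3 : c3 U = 0 by rewrite /U !cE /e3 !cT; ring.
have XU : ip (emb x) U = 0 by rewrite /U !ipE XV ip_e3 x3; ring.
have VU : ip V U = ip U U.
  by rewrite {2}/U ipDl ipNl ipZl ip_e3l U3 mulr0 subr0.
suff U0 : U = 0.
  have VE : V = c3 V *: e3 by apply/eqP; rewrite -subr_eq0; apply/eqP.
  suff V1 : c3 V = 1 by move=> t; rewrite gE VE V1 scale1r.
  move: VV; rewrite VE ipZl ipZr ip_e3e3 mulr1 -VE -expr2 => /eqP.
  by rewrite sqrf_eq1 => /orP[/eqP //|/eqP e]; move: V3; rewrite e; lra.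
apply/eqP/negPn/negP => Un0.
have UU := ip_orth_gt0 (hyp_timelike hX) XU Un0.
pose W := (Num.sqrt (ip U U))^-1 *: U.
have s0 : 0 < Num.sqrt (ip U U) by rewrite sqrtr_gt0.
have fW : frame (emb x) W.
  split=> //; rewrite /W ipZr ?XU ?mulr0 // ipZl mulrA -invfM -expr2 sqr_sqrtr ?(ltW UU) //.
  by rewrite mulVf // gt_eqF.
have dE := fun t => emb_pt_line t fW.
have W3 : c3 W = 0 by rewrite /W c3Z U3 mulr0.
have := perp _ (geodesic_pt fW).
have h1 : range (fun t => pt (line (emb x) W t)) `<=` @planeP R.
  by move=> _ [t _ <-]; apply/planePE; rewrite dE c3_line.
have h2 : pt (line (emb x) W 0) = x.
  by apply: emb_inj; rewrite dE /line cosh0 sinh0 scale1r scale0r addr0.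
move=> /(_ h1 h2) /(perp_at0P f fW gE dE); rewrite /W ipZr VU => /eqP.
by rewrite mulf_eq0 invr_eq0 !gt_eqF.
Qed.

Lemma normal_shiftP (s : R) (M : set (H3 R)) y : normal_shift s M y <->
  exists x, [/\ M x, c3 (emb x) = 0 & emb y = cosh s *: emb x + sinh s *: e3].
Proof.
split=> [[x [gamma [Mx /normal_lineP[x3 gE] ->]]]|[x [Mx x3 yE]]].
  by exists x; split => //; rewrite gE.
have f := frame_e3 (hyp_emb x) x3.
exists x, (fun t => pt (line (emb x) e3 t)); split => //.
  by apply/normal_lineP; split => // t; exact: emb_pt_line.
by apply: emb_inj; rewrite emb_pt_line.
Qed.

End NormalLines.

(** * Continuity and connectedness *)

Section Continuity.
Variable R : realType.
Notation mink := (mink R).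
Implicit Types (x y : H3 R) (X Y V W : mink).

Lemma continuous_H3_val : continuous (set_val : H3 R -> R * R * R).
Proof. exact: (@initial_continuous (H3 R) (R * R * R)%type set_val). Qed.

Lemma continuous_hx : continuous (@hx R).
Proof.
move=> x; apply: (continuous_comp (f := fun x : H3 R => (set_val x).1) (g := fst)).
  by apply: (continuous_comp (g := fst)); [exact: continuous_H3_val|exact: cvg_fst].
exact: cvg_fst.
Qed.

Lemma continuous_hy : continuous (@hy R).
Proof.
move=> x; apply: (continuous_comp (f := fun x : H3 R => (set_val x).1) (g := snd)).
  by apply: (continuous_comp (g := fst)); [exact: continuous_H3_val|exact: cvg_fst].
exact: cvg_snd.
Qed.

Lemma continuous_ht : continuous (@ht R).
Proof.
by move=> x; apply: (continuous_comp (g := snd)); [exact: continuous_H3_val|exact: cvg_snd].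
Qed.

Lemma continuous_ip Y : continuous (fun x : H3 R => ip (emb x) Y).
Proof.
move=> x.
have cX := @continuous_hx x; have cY := @continuous_hy x; have ct := @continuous_ht x.
have t0 : ht x != 0 by rewrite gt_eqF ?ht_gt0.
have cV : {for x, continuous (fun x => (ht x)^-1)} by apply: continuousV.
have cV2 : {for x, continuous (fun x => (2 * ht x)^-1)}.
  by apply: continuousV; [rewrite mulf_neq0|apply: continuousM; [exact: cst_continuous|]].
have r2 : {for x, continuous (fun x => hx x ^+ 2 + hy x ^+ 2 + ht x ^+ 2)}.
  have sq (g : H3 R -> R) : {for x, continuous g} -> {for x, continuous (fun x => g x ^+ 2)}.
    by move=> cg; exact: (continuousM cg cg).
  by apply: continuousD; [apply: continuousD|]; exact: sq.
have cst a : {for x, continuous (fun _ : H3 R => a : R)} by exact: cst_continuous.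
have e : (fun x => ip (emb x) Y) = fun x =>
    hx x * (ht x)^-1 * c1 Y + hy x * (ht x)^-1 * c2 Y
    + (hx x ^+ 2 + hy x ^+ 2 + ht x ^+ 2 - 1) * (2 * ht x)^-1 * c3 Y
    - (1 + (hx x ^+ 2 + hy x ^+ 2 + ht x ^+ 2)) * (2 * ht x)^-1 * c0 Y.
  by apply/funext => y; rewrite /ip /emb !cT.
rewrite e.
exact: (continuousB (continuousD (continuousD
  (continuousM (continuousM cX cV) (cst _)) (continuousM (continuousM cY cV) (cst _)))
  (continuousM (continuousM (continuousB r2 (cst 1)) cV2) (cst _)))
  (continuousM (continuousM (continuousD (cst 1) r2) cV2) (cst _))).
Qed.

Lemma continuous_H3 (f : R -> H3 R) :
  continuous (fun t => c0 (emb (f t))) -> continuous (fun t => c1 (emb (f t))) ->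
  continuous (fun t => c2 (emb (f t))) -> continuous (fun t => c3 (emb (f t))) ->
  continuous f.
Proof.
move=> f0 f1 f2 f3; apply: (@continuous_comp_initial (H3 R) R (R * R * R)%type set_val f) => t.
have c03 : {for t, continuous (fun t => (c0 (emb (f t)) - c3 (emb (f t)))^-1)}.
  apply: continuousV; last by apply: continuousB; [exact: f0|exact: f3].
  by rewrite c0Bc3_emb invr_eq0 gt_eqF ?ht_gt0.
rewrite (_ : _ \o _ = fun t => (c1 (emb (f t)) / (c0 (emb (f t)) - c3 (emb (f t))),
   c2 (emb (f t)) / (c0 (emb (f t)) - c3 (emb (f t))), (c0 (emb (f t)) - c3 (emb (f t)))^-1)).
  have c1' := continuousM (@f1 t) c03; have c2' := continuousM (@f2 t) c03.
  exact: (cvg_pair (cvg_pair c1' c2') c03).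
apply/funext => u /=; rewrite -hxE -hyE -htE /hx /hy /ht.
by case: (set_val (f u)) => [[]].
Qed.

Lemma connected_sign (A : set (H3 R)) (phi : H3 R -> R) x y :
  connected A -> continuous phi -> (forall z, A z -> phi z != 0) ->
  A x -> A y -> 0 < phi x -> 0 < phi y.
Proof.
move=> cA cphi nz Ax Ay px; rewrite ltNge; apply/negP => py.
have cI : connected (phi @` A).
  by apply: connected_continuous_connected => //; exact: continuous_subspaceT.
have /connected_intervalP/(_ (phi y) (phi x)) := cI.
have im z : A z -> (phi @` A) (phi z) by move=> Az; exists z.
move=> /(_ (im _ Ay) (im _ Ax) 0); rewrite py (ltW px) => /(_ isT)[z Az z0].
by have := nz z Az; rewrite z0 eqxx.
Qed.

Lemma connected_path (f : R -> H3 R) (I : interval R) :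
  continuous f -> connected (f @` [set` I]).
Proof.
move=> cf; apply: connected_continuous_connected; last exact: continuous_subspaceT.
exact/connected_intervalP/interval_is_interval.
Qed.

Lemma closure_ip_le0 (A : set (H3 R)) Y : (forall x, A x -> ip (emb x) Y <= 0) ->
  forall x, closure A x -> ip (emb x) Y <= 0.
Proof.
move=> AY x /(closureS (B := [set x | ip (emb x) Y <= 0]) AY).
have cl : closed [set x : H3 R | ip (emb x) Y <= 0].
  apply: (@preimage_closed _ _ (fun x => ip (emb x) Y) [set t | t <= 0]).
    by move=> z _; exact: continuous_ip.
  exact: closed_le.
by move/(closure_id _).1 : cl => <-.
Qed.

Lemma continuous_line X V : continuous (fun t => c0 (line X V t)) /\
  continuous (fun t => c1 (line X V t)) /\
  continuous (fun t => c2 (line X V t)) /\ continuous (fun t => c3 (line X V t)).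
Proof.
have key (a b : R) : continuous (fun t : R => cosh t * a + sinh t * b).
  move=> t; have ca : {for t, continuous (fun _ : R => a)} by exact: cst_continuous.
  have cb : {for t, continuous (fun _ : R => b)} by exact: cst_continuous.
  exact: (continuousD (continuousM (@continuous_cosh R t) ca)
                      (continuousM (@continuous_sinh R t) cb)).
split; [|split; [|split]].
- rewrite (_ : (fun t => c0 _) = fun t => cosh t * c0 X + sinh t * c0 V); first exact: key.
  by apply/funext => t; rewrite /line c0D !c0Z.
- rewrite (_ : (fun t => c1 _) = fun t => cosh t * c1 X + sinh t * c1 V); first exact: key.
  by apply/funext => t; rewrite /line c1D !c1Z.
- rewrite (_ : (fun t => c2 _) = fun t => cosh t * c2 X + sinh t * c2 V); first exact: key.
  by apply/funext => t; rewrite /line c2D !c2Z.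
- rewrite (_ : (fun t => c3 _) = fun t => cosh t * c3 X + sinh t * c3 V); first exact: key.
  by apply/funext => t; rewrite /line c3D !c3Z.
Qed.

Lemma continuous_pt_line X V : frame X V -> continuous (fun t => pt (line X V t)).
Proof.
move=> f; have e t := emb_pt_line t f; have [l0 [l1 [l2 l3]]] := continuous_line X V.
by apply: continuous_H3; under eq_fun do rewrite e.
Qed.

End Continuity.

(** * Walls, strips and rays *)

Section WallGeometry.
Variables (R : realType) (n : three_lines R).
Notation mink := (mink R).
Local Notation e3 := (e3 R).
Let n3 i : c3 (n i) = 0. Proof. exact: nrm_c3. Qed.
Let nn i : ip (n i) (n i) = 1. Proof. exact: nrm_unit. Qed.
Implicit Types (X Y : mink) (x y z : H3 R).

Lemma ler_cosh (a b : R) : 0 <= a -> 0 <= b -> (cosh a <= cosh b) = (a <= b).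
Proof.
move=> a0 b0; have sa : 0 <= sinh a by rewrite sinh_ge0.
have sb : 0 <= sinh b by rewrite sinh_ge0.
rewrite -(ler_pXn2r (n := 2)) ?nnegrE ?(ltW (cosh_gt0 _)) //.
rewrite (leNgt a b) -ltr_sinh -leNgt -[RHS](ler_pXn2r (n := 2)) ?nnegrE //.
by rewrite !sinh2E lerD2r.
Qed.

Variables i j k : 'I_3.
Hypotheses (ij : i != j) (ik : i != k) (jk : j != k).
Local Notation w := (wn n i j k).
Local Notation o := (foot n i j).
Local Notation d := (dst n i j).

Definition wall : set (H3 R) := [set x | c3 (emb x) = 0 /\ ip (emb x) w = 0].

Let ww : ip w w = 1 := w_w n ij ik jk.
Let w3 : c3 w = 0 := c3_w n i j k.
Let fo : frame o (n i) := frame_foot n ij.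

(** Applied to a linear function invariant under a translation: it must vanish on the axis. *)
Lemma periodic_hyperbolic (a b l : R) : l != 0 ->
  (forall t, cosh (t + l) * a + sinh (t + l) * b = cosh t * a + sinh t * b) ->
  a = 0 /\ b = 0.
Proof.
move=> l0 h; have h1 := h 0; have h2 := h (- l).
rewrite !add0r cosh0 sinh0 in h1; rewrite addNr cosh0 sinh0 coshN sinhN in h2.
have sl : sinh l != 0 by apply: contra_neq l0; rewrite -[in X in _ = X](@sinh0 R) => /sinh_inj.
have b0 : b = 0 by apply: (mulfI sl); lra.
have s2 : 0 < sinh l ^+ 2 by rewrite lt_def sqrf_eq0 sl sqr_ge0.
have c1 : cosh l - 1 != 0.
  by apply/eqP => e; move: s2; rewrite sinh2E (_ : cosh l = 1) ?expr1n ?subrr ?ltxx //; lra.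
by split => //; apply: (mulfI c1); move: h1; rewrite b0; lra.
Qed.

(** The product preserves [ip _ e3] and [ip _ w], so along an axis both are periodic and hence zero.
    Conversely the product translates the wall by [2 * d]. *)
Lemma axis_mirror2 : axis (mirror n i \o mirror n j) = wall.
Proof.
have d0 := dst_gt0 n ij.
apply/seteqP; split => x /=.
  move=> [gamma [l [geo l0 tr [t _ <-]]]].
  have [V [f gE]] := geodesicE geo; set X := emb (gamma 0) in f gE.
  have inv Y : (forall Z, ip (refl (n i) (refl (n j) Z)) Y = ip Z Y) ->
      forall t, ip (emb (gamma t)) Y = 0.
    move=> hY; have [|a0 b0] := @periodic_hyperbolic (ip X Y) (ip V Y) l (negbT (gt_eqF l0)).
      by move=> s; rewrite -!ip_line -!gE -tr /= !emb_mirror hY.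
    by move=> s; rewrite gE ip_line a0 b0; ring.
  split; first by rewrite -ip_e3 inv // => Z; rewrite !ip_e3 !c3_refl // opprK.
  rewrite inv // => Z; rewrite !ip_refl_swap //.
  have refl_w a : ip w (n a) = 0 -> refl (n a) w = w.
    by move=> h; rewrite /refl h w3 !mulr0 !scale0r !subr0.
  by rewrite (refl_w i) ?w_l // (refl_w j) ?w_r.
move=> [x3 xw]; have [t ->] := axisP ij ik jk x3 xw.
exists (fun t => pt (line o (n i) t)), (2 * d); split.
- exact: geodesic_pt fo.
- by lra.
- move=> s; rewrite /= mirror_gam_r // mirror_gam_l //.
  by congr (pt (line _ _ _)); ring.
- by exists t.
Qed.

Section Equidistant.
Variables (W : H3 R -> H3 R) (s : R).
Hypotheses (axW : axis W = wall) (s0 : 0 < s).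


(** The orthogonal projection to the Lorentz plane that contains the wall. *)
Definition par X := X - ip X w *: w - c3 X *: e3.

Lemma ip_par X Y : c3 Y = 0 -> ip Y w = 0 -> ip (par X) Y = ip X Y.
Proof. by move=> Y3 Yw; rewrite /par !ipE ip_e3l Y3 (ipC w) Yw; ring. Qed.

Lemma par_w X : ip (par X) w = 0.
Proof. by rewrite /par !ipE ip_e3l w3 ww; ring. Qed.

Lemma par_c3 X : c3 (par X) = 0.
Proof. by rewrite /par !cE w3 /e3 !cT; ring. Qed.

Lemma par_par X : ip (par X) (par X) = ip X X - ip X w ^+ 2 - c3 X ^+ 2.
Proof.
by rewrite {2}/par !ipDr !ipNr !ipZr par_w ip_e3 par_c3 /par !ipDl !ipNl !ipZl (ipC w) ip_e3l; ring.
Qed.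

Lemma timelike_par x : timelike (par (emb x)).
Proof.
have [XX _] := hyp_emb x.
have := sqr_ge0 (ip (emb x) w); have := sqr_ge0 (c3 (emb x)) => h1 h2.
apply: (timelike_same_cone (hyp_timelike (hyp_emb x))); first by rewrite par_par XX; lra.
rewrite /par !ipDr !ipNr !ipZr ip_e3 XX.
by move: h1 h2; rewrite !expr2; lra.
Qed.

(* The foot on the axis of the perpendicular from [x]. *)
Definition proj x : H3 R := pt (normalize (par (emb x))).

Lemma emb_proj x : emb (proj x) = normalize (par (emb x)).
Proof. by rewrite ptK //; apply: hyp_normalize; exact: timelike_par. Qed.

Lemma wall_proj x : wall (proj x).
Proof.
by rewrite /wall /= emb_proj /normalize c3Z par_c3 ipZl par_w !mulr0.
Qed.

(** The squared cosh of the distance to the wall. *)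
Definition depth2 x : R := 1 + ip (emb x) w ^+ 2 + c3 (emb x) ^+ 2.

Lemma depth2E x : - ip (par (emb x)) (par (emb x)) = depth2 x.
Proof. by rewrite par_par; case: (hyp_emb x) => -> _; rewrite /depth2; ring. Qed.

Lemma depth2_gt0 x : 0 < depth2 x.
Proof.
by rewrite /depth2 -addrA ltr_pwDl // addr_ge0 ?sqr_ge0.
Qed.

Lemma emb_par x : par (emb x) = Num.sqrt (depth2 x) *: emb (proj x).
Proof.
rewrite emb_proj /normalize depth2E scalerA mulfV ?scale1r //.
by rewrite gt_eqF // sqrtr_gt0 depth2_gt0.
Qed.

(** Points of the axis see [x] only through [par], so the cosh of their distance to [x] is that of
    their distance to [proj x] times a constant factor. *)
Lemma dist_set_wall x : dist_set x (axis W) = hdist x (proj x).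
Proof.
have q0 : 0 < Num.sqrt (depth2 x) by rewrite sqrtr_gt0 depth2_gt0.
have ipy y : wall y -> ip (emb x) (emb y) = Num.sqrt (depth2 x) * ip (emb (proj x)) (emb y).
  by move=> [y3 yw]; rewrite -(ip_par _ y3 yw) emb_par ipZl.
have lbx : lbound [set hdist x y | y in axis W] (hdist x (proj x)).
  move=> _ [y + <-]; rewrite axW => wy.
  rewrite -ler_cosh ?hdist_ge0 // !cosh_hdist (ipy _ wy) (ipy _ (wall_proj x)).
  rewrite -!mulrN ler_pM2l //.
  have [-> _] := hyp_emb (proj x); rewrite opprK lerNr.
  exact: hyp_ip_leN1 (hyp_emb _) (hyp_emb _).
have inx : [set hdist x y | y in axis W] (hdist x (proj x)).
  by exists (proj x) => //; rewrite axW; exact: wall_proj.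
apply/eqP; rewrite eq_le; apply/andP; split.
  by apply: ge_inf => //; exists (hdist x (proj x)).
by apply: lb_le_inf => //; exists (hdist x (proj x)).
Qed.

Lemma equidistantP x :
  equidistant W s x <-> ip (emb x) w ^+ 2 + c3 (emb x) ^+ 2 = sinh s ^+ 2.
Proof.
rewrite /equidistant /= dist_set_wall.
have e : cosh (hdist x (proj x)) = Num.sqrt (depth2 x).
  rewrite cosh_hdist; have [y3 yw] := wall_proj x.
  rewrite -(ip_par _ y3 yw) emb_par ipZl; case: (hyp_emb (proj x)) => -> _.
  by rewrite mulrN1 opprK.
have e2 : cosh (hdist x (proj x)) ^+ 2 = depth2 x.
  by rewrite e sqr_sqrtr // ltW // depth2_gt0.
split=> [<-|h]; first by rewrite sinh2E e2 /depth2; ring.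
apply: cosh_inj; rewrite ?hdist_ge0 ?(ltW s0) //; apply/eqP.
rewrite -(eqrXn2 (n := 2)) ?(ltW (cosh_gt0 _)) // e2; apply/eqP.
by move: h; rewrite sinh2E /depth2; lra.
Qed.

Lemma shift_wallP (t : R) x : normal_shift t (axis W) x <->
  ip (emb x) w = 0 /\ c3 (emb x) = sinh t.
Proof.
rewrite axW; split=> [/normal_shiftP[y [[y3 yw] _ xE]]|[xw x3]].
  by rewrite xE !ipE ip_e3l w3 yw !cE y3 /e3 !cT; split; ring.
have ct := cosh_gt0 t; have cn0 : cosh t != 0 by rewrite gt_eqF.
have [XX X0] := hyp_emb x.
pose Y := (cosh t)^-1 *: (emb x - sinh t *: e3).
have hY : hyp Y.
  split; last by rewrite c0Z mulr_gt0 ?invr_gt0 // c0D c0N c0Z /e3 cT mulr0 subr0.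
  have e : ip (emb x - sinh t *: e3) (emb x - sinh t *: e3) = - cosh t ^+ 2.
    rewrite ipDl !ipDr !ipNl !ipNr !ipZl !ipZr XX ip_e3 ip_e3l ip_e3e3 x3.
    by have := cosh2Bsinh2 t; lra.
  by rewrite /Y ipZl ipZr e; field.
apply/normal_shiftP; exists (pt Y); rewrite /wall /= ptK // /Y c3Z ipZl c3D c3N c3Z ipDl ipNl ipZl.
rewrite xw ip_e3l w3 x3 /e3 cT mulr1 subrr !mulr0 subr0 mulr0; split => //.
by rewrite scalerA mulfV // scale1r subrK.
Qed.

End Equidistant.
End WallGeometry.

(** * The two strips of a tube, and the rays on a line *)

Section StripsAndRays.
Variables (R : realType) (n : three_lines R).
Notation mink := (mink R).
Local Notation e3 := (e3 R).
Let n3 i : c3 (n i) = 0. Proof. exact: nrm_c3. Qed.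
Implicit Types (X Y : mink) (x y z : H3 R).
Local Notation G := (even_group n).
Variables i j k : 'I_3.
Hypotheses (ij : i != j) (ik : i != k) (jk : j != k).
Local Notation w := (wn n i j k).
Local Notation w' := (wn n i k j).
Local Notation o := (foot n i j).
Local Notation o' := (foot n i k).
Let kj : k != j. Proof. by rewrite eq_sym. Qed.
Let ww : ip w w = 1. Proof. exact: w_w. Qed.
Let w3 : c3 w = 0. Proof. exact: c3_w. Qed.
Let o3 : c3 o = 0. Proof. exact: c3_foot. Qed.
Let ow : ip o w = 0. Proof. exact: foot_w. Qed.
Let fo : frame o (n i). Proof. exact: frame_foot. Qed.
Let fw : frame o w. Proof. by split => //; exact: hyp_foot. Qed.

Lemma foot'_w : ip o' w < 0.
Proof.
apply: (w_disjoint ik ij kj (hyp_foot n ik)); first exact: foot_n.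
by rewrite foot_w.
Qed.

Lemma foot_w' : ip o w' < 0.
Proof.
by apply: (w_disjoint ij ik jk (hyp_foot n ij)); [exact: foot_n|rewrite ow].
Qed.

Let emb_o : emb (pt o) = o. Proof. by rewrite ptK //; exact: hyp_foot. Qed.
Let emb_o' : emb (pt o') = o'. Proof. by rewrite ptK //; exact: hyp_foot. Qed.

Lemma hull_foot : hull G (pt o).
Proof. by apply: (axis_hull ij ik jk); rewrite emb_o. Qed.

Lemma hull_foot' : hull G (pt o').
Proof. by apply: (axis_hull ik ij kj); rewrite emb_o' ?c3_foot ?foot_w. Qed.

(* The hull contains the wall of [i, k], along which [ip _ w] tends to [-oo]. *)
Lemma hull_deep (a : R) : 0 < a -> exists2 z, hull G z & ip (emb z) w = - a.
Proof.
move=> a0; have b0 := foot'_w; set b := ip o' w in b0.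
(* Along the other wall [ip _ w] is [b * cosh t] with [b < 0], so this [t] reaches depth at least
   [a]; the maximum keeps the value in the range of cosh. *)
have [|t t0 tE] := @cosh_surj R (Num.max 1 (a / - b)); first by rewrite le_max lexx.
pose y := pt (line o' (n i) t).
have fy : frame o' (n i) := frame_foot n ik.
have yE : emb y = line o' (n i) t by exact: emb_pt_line.
have hy : hull G y.
  apply: (axis_hull ik ij kj); rewrite yE ?c3_line ?c3_foot //.
  by rewrite ip_line foot_w (ipC (n i)) w_l; ring.
have yw : ip (emb y) w <= - a.
  rewrite yE ip_line (ipC (n i)) w_l mulr0 addr0 -/b tE.
  have : a / - b <= Num.max 1 (a / - b) by rewrite le_max lexx orbT.
  by rewrite ler_pdivrMr ?oppr_gt0 // mulrN; lra.
have oy : hdist (pt o) y != 0.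
  by apply/eqP => /hdist_eq0 e; move: yw; rewrite -e emb_o ow; lra.
have [V f] := line_through oy; set D := hdist _ _ in oy *; rewrite emb_o in f * => yV.
have D0 : 0 < D by rewrite lt_def oy hdist_ge0.
have sD : 0 < sinh D by rewrite sinh_gt0.
move: yw; rewrite yV ip_line ow mulr0 add0r => yw.
have Vw : ip V w < 0 by rewrite -(pmulr_rlt0 _ sD); lra.
(* The depth along the segment from [o], which lies on the wall, is a multiple of sinh, so exactly
   [a] is attained at [t']. *)
have [t' t'E] := sinh_surj (- a / ip V w).
have t'V : sinh t' * ip V w = - a by rewrite t'E divfK // lt_eqF.
have t'0 : 0 < t' by rewrite -sinh_gt0 t'E nmulr_rgt0 ?invr_lt0 ?oppr_lt0.
have t'D : t' <= D.
  rewrite leNgt -ltr_sinh -leNgt -(ler_nM2r Vw); lra.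
exists (pt (line o V t')); last by rewrite emb_pt_line // ip_line ow mulr0 add0r.
have yE' : y = pt (line o V D) by apply: emb_inj; rewrite emb_pt_line.
have oE : pt o = pt (line o V 0) by rewrite /line cosh0 sinh0 scale1r scale0r addr0.
apply: (hconvex_hull hull_foot hy); rewrite yE' oE; apply: segment_line => //.
by rewrite (ltW t'0).
Qed.

Section Strip.
Variables (W : H3 R -> H3 R) (s : R).
Hypotheses (axW : axis W = wall n i j k) (s0 : 0 < s).
Local Notation S := (sinh s).

Let ss : 0 < S. Proof. by rewrite sinh_gt0. Qed.

Let tube x := ip (emb x) w ^+ 2 + c3 (emb x) ^+ 2 = S ^+ 2.

Let edges := normal_shift s (axis W) `|` normal_shift (- s) (axis W).

Lemma edgesP x : edges x <-> tube x /\ ip (emb x) w = 0.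
Proof.
split=> [[|] /(shift_wallP axW)[xw x3]|[tx xw]].
- by rewrite /tube xw x3; split => //; ring.
- by rewrite /tube xw x3 sinhN; split => //; ring.
have := tx; rewrite /tube xw expr0n add0r => /eqP; rewrite eqf_sqr => /orP[]/eqP x3.
  by left; apply/(shift_wallP axW).
by right; apply/(shift_wallP axW); rewrite sinhN.
Qed.

Let strips := equidistant W s `\` edges.

Lemma stripsP x : strips x <-> tube x /\ ip (emb x) w != 0.
Proof.
split=> [[/(equidistantP ij ik jk axW s0) tx /edgesP nx]|[tx /eqP nx]].
  by split => //; apply/eqP => xw; apply: nx.
by split; [exact/(equidistantP ij ik jk axW s0)|move/edgesP => []].
Qed.

(* The strip [ip _ w < 0] of the tube is parametrized by [t], along the axis, and
   [u], with [ip _ w = - S / cosh u] and [c3 = S * sinh u / cosh u]. *)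
Definition strip_pt (t u : R) : mink :=
  cosh s *: line o (n i) t - (S / cosh u) *: w + (S * sinh u / cosh u) *: e3.

Lemma strip_ptE t u : [/\ ip (strip_pt t u) w = - (S / cosh u),
  c3 (strip_pt t u) = S * sinh u / cosh u & hyp (strip_pt t u)].
Proof.
have cu := cosh_gt0 u; have cn0 : cosh u != 0 by rewrite gt_eqF.
have l3 : c3 (line o (n i) t) = 0 by rewrite c3_line.
have lw : ip (line o (n i) t) w = 0 by rewrite ip_line ow (ipC (n i)) w_l; ring.
have hl := hyp_line t fo.
rewrite /strip_pt; move: (line _ _ _) l3 lw hl => l l3 lw hl; have [ll _] := hl.
have e0 : ip e3 w = 0 by rewrite ip_e3l.
have A : ip (cosh s *: l - (S / cosh u) *: w + (S * sinh u / cosh u) *: e3)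
    (cosh s *: l - (S / cosh u) *: w + (S * sinh u / cosh u) *: e3) = -1.
  rewrite !ipDl !ipDr !ipNl !ipNr !ipZl !ipZr ll lw (ipC w l) lw ww ip_e3e3 !ip_e3 !ip_e3l l3 w3.
  transitivity (- cosh s ^+ 2 + S ^+ 2 / cosh u ^+ 2 * (1 + sinh u ^+ 2)); first by field.
  by rewrite !sinh2E; field.
split.
- by rewrite !ipDl !ipNl !ipZl lw ww e0; ring.
- by rewrite !c3D !c3N !c3Z l3 w3 /e3 cT; ring.
split => //; suff [] : timelike (cosh s *: l - (S / cosh u) *: w + (S * sinh u / cosh u) *: e3) by [].
apply: (timelike_same_cone (hyp_timelike hl)); first by rewrite A ltrN10.
rewrite !ipDr !ipNr !ipZr ll lw ip_e3 l3.
by have := cosh_gt0 s; lra.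
Qed.

Let hyperbola (a b : R) : a != 0 -> a ^+ 2 + b ^+ 2 = S ^+ 2 ->
  1 + (b / - a) ^+ 2 = (S / - a) ^+ 2.
Proof. by move=> a0 e; rewrite !expr_div_n -e; field. Qed.

Lemma strip_pt_surj x : tube x -> ip (emb x) w < 0 -> exists t u, emb x = strip_pt t u.
Proof.
move=> tx xw; have [y3 yw] := wall_proj n ij ik jk x.
have [t yE] := axisP ij ik jk y3 yw.
have [u uE] := sinh_surj (c3 (emb x) / - ip (emb x) w).
have xn0 : ip (emb x) w != 0 by rewrite lt_eqF.
have cu0 := cosh_gt0 u; have cun : cosh u != 0 by rewrite gt_eqF.
have cuE : cosh u = S / - ip (emb x) w.
  have h0 : 0 < S / - ip (emb x) w by rewrite divr_gt0 ?oppr_gt0.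
  apply/eqP; rewrite -(eqrXn2 (n := 2)) ?(ltW cu0) ?(ltW h0) //; apply/eqP.
  have -> : cosh u ^+ 2 = 1 + sinh u ^+ 2 by rewrite sinh2E; ring.
  by rewrite uE; exact: hyperbola.
have d2 : depth2 n i j k x = cosh s ^+ 2.
  by have := sinh2E s; rewrite /depth2 -tx; lra.
have parE : par n i j k (emb x) = cosh s *: line o (n i) t.
  rewrite (emb_par n ij ik jk) d2 sqrtr_sqr gtr0_norm ?cosh_gt0 // yE emb_pt_line //.
have Sn0 : S != 0 by rewrite gt_eqF.
exists t, u; rewrite /strip_pt -parE /par.
have Scu : S / cosh u = - ip (emb x) w by rewrite cuE invf_div mulrC divfK.
have -> : S * sinh u / cosh u = c3 (emb x).
  by rewrite mulrAC Scu uE mulrC divfK // oppr_eq0.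
rewrite Scu.
by rewrite scaleNr opprK addrAC subrK subrK.
Qed.

Let spt t u := pt (strip_pt t u).

Let emb_spt t u : emb (spt t u) = strip_pt t u.
Proof. by rewrite ptK //; case: (strip_ptE t u). Qed.

Lemma strip_spt t u : strips (spt t u).
Proof.
have [e1 e2 _] := strip_ptE t u; have cu := cosh_gt0 u.
have cn0 : cosh u != 0 by rewrite gt_eqF.
apply/stripsP; rewrite /tube emb_spt e1 e2; split; last first.
  by rewrite oppr_eq0 mulf_neq0 ?invr_eq0 // gt_eqF.
transitivity (S ^+ 2 / cosh u ^+ 2 * (1 + sinh u ^+ 2)); first by field.
by rewrite (sinh2E u) addrC subrK divfK // sqrf_eq0.
Qed.

Let cst_cts (a : R) : continuous (fun _ : R => a).
Proof. by move=> t; exact: cst_continuous. Qed.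

Lemma continuous_spt_t u : continuous (fun t => spt t u).
Proof.
have [l0 [l1 [l2 l3]]] := continuous_line o (n i).
pose Z := - (S / cosh u) *: w + (S * sinh u / cosh u) *: e3.
have e t : emb (spt t u) = cosh s *: line o (n i) t + Z.
  by rewrite emb_spt /strip_pt /Z scaleNr addrA.
have key (g : R -> R) (a b : R) : continuous g -> continuous (fun t => a * g t + b).
  move=> cg t.
  exact: (continuousD (continuousM (@cst_cts a t) (@cg t)) (@cst_cts b t)).
apply: continuous_H3.
- rewrite (_ : (fun t => c0 _) = fun t => cosh s * c0 (line o (n i) t) + c0 Z); first exact: key.
  by apply/funext => t; rewrite e c0D c0Z.
- rewrite (_ : (fun t => c1 _) = fun t => cosh s * c1 (line o (n i) t) + c1 Z); first exact: key.
  by apply/funext => t; rewrite e c1D c1Z.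
- rewrite (_ : (fun t => c2 _) = fun t => cosh s * c2 (line o (n i) t) + c2 Z); first exact: key.
  by apply/funext => t; rewrite e c2D c2Z.
- rewrite (_ : (fun t => c3 _) = fun t => cosh s * c3 (line o (n i) t) + c3 Z); first exact: key.
  by apply/funext => t; rewrite e c3D c3Z.
Qed.

Lemma continuous_spt_u t : continuous (fun u => spt t u).
Proof.
pose Z := cosh s *: line o (n i) t.
have e u : emb (spt t u) = Z + (cosh u)^-1 *: (- S *: w + sinh u *: (S *: e3)).
  rewrite emb_spt /strip_pt -/Z; move: Z w e3 => Z1 Z2 Z3.
  by apply: minkP; rewrite !cE; ring.
have key (a p q : R) : continuous (fun u => a + (cosh u)^-1 * (p + sinh u * q)).
  move=> u; have cV : {for u, continuous (fun u => (cosh u)^-1)}.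
    by apply: continuousV; [rewrite gt_eqF // cosh_gt0|exact: continuous_cosh].
  exact: (continuousD (@cst_cts a u) (continuousM cV
    (continuousD (@cst_cts p u) (continuousM (@continuous_sinh R u) (@cst_cts q u))))).
apply: continuous_H3.
- rewrite (_ : (fun u => c0 _) = fun u => c0 Z + (cosh u)^-1 *
    (c0 (- S *: w) + sinh u * c0 (S *: e3))); first exact: key.
  by apply/funext => u; rewrite e c0D (c0Z (cosh u)^-1) c0D (c0Z (sinh u)).
- rewrite (_ : (fun u => c1 _) = fun u => c1 Z + (cosh u)^-1 *
    (c1 (- S *: w) + sinh u * c1 (S *: e3))); first exact: key.
  by apply/funext => u; rewrite e c1D (c1Z (cosh u)^-1) c1D (c1Z (sinh u)).
- rewrite (_ : (fun u => c2 _) = fun u => c2 Z + (cosh u)^-1 *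
    (c2 (- S *: w) + sinh u * c2 (S *: e3))); first exact: key.
  by apply/funext => u; rewrite e c2D (c2Z (cosh u)^-1) c2D (c2Z (sinh u)).
- rewrite (_ : (fun u => c3 _) = fun u => c3 Z + (cosh u)^-1 *
    (c3 (- S *: w) + sinh u * c3 (S *: e3))); first exact: key.
  by apply/funext => u; rewrite e c3D (c3Z (cosh u)^-1) c3D (c3Z (sinh u)).
Qed.

Let path_component (f : R -> H3 R) (A : set (H3 R)) a b : continuous f -> (forall t, A (f t)) ->
  connected_component A (f a) (f b).
Proof.
move=> cf Af; apply: (@connected_component_max _ A (f @` [set` `]-oo, +oo[])).
- by exists a.
- by move=> _ [t _ <-].
- exact: connected_path.
- by exists b.
Qed.

Lemma inner_strip_meets_hull x : strips x -> ip (emb x) w < 0 ->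
  (connected_component strips x `&` hull G) !=set0.
Proof.
move=> /stripsP[tx _] xw; have [t [u xE]] := strip_pt_surj tx xw.
have {xE} -> : x = spt t u by apply: emb_inj; rewrite emb_spt.
(* The hull lies in [planeP], where the inner strip of the tube is at depth exactly [sinh s]; the
   strip coordinates then give a path from [x] to [z]. *)
have [z hz zw] := hull_deep ss; have z3 := hull_planeP hz.
have tz : tube z by rewrite /tube zw z3; ring.
have [t' [u' zE]] := strip_pt_surj tz ltac:(by rewrite zw oppr_lt0).
have u'0 : u' = 0.
  have [_ + _] := strip_ptE t' u'; rewrite -zE z3 => /esym/eqP.
  rewrite !mulf_eq0 invr_eq0 (gt_eqF ss) (gt_eqF (cosh_gt0 _)) orbF /= => /eqP.
  by rewrite -[X in _ = X](@sinh0 R) => /sinh_inj.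
exists z; split => //; have -> : z = spt t' 0 by apply: emb_inj; rewrite emb_spt zE u'0.
apply: (@connected_component_trans _ _ (spt t 0)).
  apply: (path_component (f := fun v => spt t v)) => [|v]; first exact: continuous_spt_u.
  exact: strip_spt.
apply: (path_component (f := fun v => spt v 0)) => [|v]; first exact: continuous_spt_t.
exact: strip_spt.
Qed.

Lemma outer_strip_avoids_hull x : strips x -> 0 < ip (emb x) w ->
  connected_component strips x `&` hull G = set0.
Proof.
move=> sx xw; apply/seteqP; split=> // z [cz hz].
have := hull_w_le0 ij ik jk hz; rewrite leNgt => /negP; apply.
apply: (@connected_sign _ (connected_component strips x) (fun y => ip (emb y) w) x) => //.
- exact: component_connected.
- exact: continuous_ip.
- by move=> y /connected_component_sub /stripsP[].
- exact: connected_component_refl.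
Qed.

Lemma RecP x : Rec G W s x <-> tube x /\ 0 <= ip (emb x) w.
Proof.
split.
  case=> [/edgesP[tx ->]//|[sx dis]].
  have [tx xw] := (stripsP x).1 sx; split => //; rewrite leNgt; apply/negP => neg.
  by have [z] := inner_strip_meets_hull sx neg; rewrite dis.
move=> [tx]; rewrite le_eqVlt => /orP[/eqP xw|xw].
  by left; apply/edgesP.
have sx : strips x by apply/stripsP; rewrite gt_eqF.
by right; split => //; exact: outer_strip_avoids_hull.
Qed.

End Strip.

Definition mirror_line : set (H3 R) := [set x | c3 (emb x) = 0 /\ ip (emb x) (n i) = 0].
Local Notation L := mirror_line.

Let emb_line t : emb (pt (line o w t)) = line o w t.
Proof. exact: emb_pt_line. Qed.

Lemma mirror_lineP x : L x <-> exists t, x = pt (line o w t).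
Proof.
split=> [[x3 xn]|[t ->]]; last first.
  by split; rewrite emb_line ?c3_line // ip_line foot_n w_l; ring.
have [t [u e]] := atP n ij ik jk (hyp_emb x) x3.
have t0 : t = 0.
  apply: sinh_inj; rewrite sinh0; apply: (mulfI (negbT (gt_eqF (cosh_gt0 u)))).
  by rewrite mulr0 -(at_l n i j k) -e.
exists u; apply: emb_inj; rewrite emb_line e t0 /at_ /line cosh0 sinh0 scale1r scale0r addr0.
done.
Qed.

Lemma line_w t : ip (line o w t) w = sinh t.
Proof. by rewrite ip_line ow ww; ring. Qed.

(** Between its two walls the line is the segment from [o'] to [o], whose ends are in the hull. A
    parameter below [t2] would lie beyond the wall [w'], as the formula for [ip (line o w t) w']
    shows. *)
Lemma mirror_line_hull x : L x -> ip (emb x) w <= 0 -> ip (emb x) w' <= 0 -> hull G x.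
Proof.
move=> /mirror_lineP[t ->]; rewrite emb_line line_w => t0; have {}t0 : t <= 0.
  by rewrite leNgt -sinh_gt0 -leNgt.
have [|t2 o'E] := (mirror_lineP (pt o')).1; first by split; rewrite emb_o' ?c3_foot ?foot_n.
have o'E' : o' = line o w t2 by rewrite -emb_o' o'E emb_line.
have t20 : sinh t2 < 0 by rewrite -line_w -o'E' foot'_w.
move=> tw'; have oE : pt o = pt (line o w 0) by rewrite /line cosh0 sinh0 scale1r scale0r addr0.
apply: (hconvex_hull hull_foot' hull_foot); rewrite oE o'E; apply: segment_line => //.
rewrite t0 andbT leNgt; apply/negP => tt2.
have e2 : cosh t2 * ip o w' + sinh t2 * ip w w' = 0 by rewrite -ip_line -o'E' foot_w.
have pos : 0 < sinh (t2 - t) by rewrite sinh_gt0 subr_gt0.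
have : 0 < ip o w' * sinh (t2 - t) / sinh t2.
  by rewrite nmulr_rgt0 ?invr_lt0 // nmulr_rlt0 // foot_w'.
have -> : ip o w' * sinh (t2 - t) / sinh t2 = ip (line o w t) w'.
  have n2 : sinh t2 != 0 by rewrite lt_eqF.
  rewrite ip_line sinhB.
  have -> : ip w w' = - (cosh t2 * ip o w') / sinh t2.
    by apply: (mulfI n2); rewrite [RHS]mulrC divfK //; lra.
  by field.
by rewrite ltNge tw'.
Qed.

Let Lout := L `\` hull G.

Lemma mirror_line_outP x : Lout x <-> L x /\ (0 < ip (emb x) w \/ 0 < ip (emb x) w').
Proof.
split=> [[Lx nx]|[Lx xw]]; split => //.
  have [h|h] := ltP 0 (ip (emb x) w); first by left.
  by right; rewrite ltNge; apply/negP => h'; apply: nx; exact: mirror_line_hull.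
move=> hx; have := hull_w_le0 ij ik jk hx; have := hull_w_le0 ik ij kj hx.
by case: xw => ?; lra.
Qed.

(** Outside the hull the line has a part beyond [w], whose closure reaches [o] on the axis, and a
    part beyond [w']. The closure of the latter satisfies [0 <= ip _ w'], so by [w_disjoint] it
    misses the axis. *)
Lemma rayP W x : axis W = wall n i j k ->
  ray G L W x <-> L x /\ 0 < ip (emb x) w.
Proof.
move=> axW; rewrite /ray /= -/Lout; split; last first.
  move=> [Lx xw]; split; first by apply/mirror_line_outP; split => //; left.
  have [t xE] := (mirror_lineP x).1 Lx.
  have cts := continuous_pt_line fw.
  have t0 : 0 < t by move: xw; rewrite xE emb_line line_w sinh_gt0.
  have sub : (fun t => pt (line o w t)) @` [set` `]0, +oo[] `<=` connected_component Lout x.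
    apply: connected_component_max; last exact: connected_path.
      by exists t; rewrite //= in_itv /= t0.
    move=> _ [u + <-]; rewrite /= in_itv /= andbT => u0; apply/mirror_line_outP; split.
      by apply/mirror_lineP; exists u.
    by left; rewrite emb_line line_w sinh_gt0.
  exists (pt o); split; last by rewrite axW /wall /= emb_o.
  apply: (closureS sub) => U nU.
  have oE : pt o = pt (line o w 0) by rewrite /line cosh0 sinh0 scale1r scale0r addr0.
  have : nbhs (0 : R) ((fun t => pt (line o w t)) @^-1` U).
    by apply: cts; rewrite -oE.
  move=> /nbhs_ballP[e /= e0 be].
  exists (pt (line o w (e / 2))); split.
    by exists (e / 2); rewrite //= in_itv /= andbT divr_gt0.
  apply: be; rewrite /ball /= sub0r normrN gtr0_norm ?divr_gt0 //; lra.
move=> [Lx [z [cz]]]; rewrite axW => -[z3 zw].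
have [[x3 xn] xw] := (mirror_line_outP x).1 Lx; split => //; case: xw => // xw'.
have pos y : connected_component Lout x y -> 0 < ip (emb y) w'.
  move=> cy; apply: (@connected_sign _ (connected_component Lout x) (fun y => ip (emb y) w') x) => //.
  - exact: component_connected.
  - exact: continuous_ip.
  - move=> v /connected_component_sub /mirror_line_outP[[v3 vn] [h|h]]; last by rewrite gt_eqF.
    by rewrite lt_eqF //; apply: (w_disjoint ij ik jk (hyp_emb v) vn); exact: ltW.
  - exact: connected_component_refl.
have zw' : 0 <= ip (emb z) w'.
  rewrite -oppr_le0 -ipNr; apply: (closure_ip_le0 _ cz) => y /pos h.
  by rewrite ipNr oppr_le0 ltW.
have zn : ip (emb z) (n i) = 0.
  apply: le_anti; apply/andP; split.
    by apply: (closure_ip_le0 _ cz) => y /connected_component_sub /mirror_line_outP[[_ ->]].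
  rewrite -oppr_le0 -ipNr; apply: (closure_ip_le0 _ cz) => y.
  by move=> /connected_component_sub /mirror_line_outP[[_ yn] _]; rewrite ipNr yn oppr0.
have := w_disjoint ik ij kj (hyp_emb z) zn zw'; rewrite zw ltxx; done.
Qed.

Lemma ray_Rec W s : axis W = wall n i j k -> 0 < s ->
  ray G L W `&` Rec G W s = [set pt (line o w s)].
Proof.
move=> axW s0; apply/seteqP; split=> x.
  move=> [/(rayP _ axW)[Lx xw] /(RecP axW s0)[tx _]].
  have [[x3 _] [t xE]] := (Lx, (mirror_lineP x).1 Lx).
  move: tx xw; rewrite x3 expr0n addr0 xE emb_line line_w => /eqP.
  rewrite eqf_sqr => /orP[/eqP/sinh_inj->//|/eqP->]; rewrite oppr_gt0 => h.
  by move: h; rewrite sinh_lt0 ltNge (ltW s0).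
move=> ->; have ss : 0 < sinh s by rewrite sinh_gt0.
have Lp : L (pt (line o w s)) by apply/mirror_lineP; exists s.
split; first by apply/(rayP _ axW); rewrite emb_line line_w.
apply/(RecP axW s0); rewrite emb_line line_w c3_line // expr0n addr0; split => //.
exact: ltW.
Qed.

End StripsAndRays.

(** * Stopping generators *)

Section StoppingLines.
Variable R : realType.
Notation mink := (mink R).
Implicit Types (X Y V : mink) (x y z : H3 R) (L D : set (H3 R)) (H : H3 R -> H3 R).

Definition normal_of L (n : mink) := [/\ c3 n = 0, ip n n = 1
  & L = [set x | c3 (emb x) = 0 /\ ip (emb x) n = 0]].

Lemma line_normal L H : hline L -> L `<=` @planeP R -> half_turn L H ->
  exists n, normal_of L n /\ forall x, emb (H x) = refl n (emb x).
Proof.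
move=> [gamma geo LE] LP hH; have [V [f gE]] := geodesicE geo.
set X := emb (gamma 0) in f gE; have [hX VV XV] := f; have [XX X0] := hX.
have g3 t : c3 (emb (gamma t)) = 0 by apply/planePE/LP; rewrite LE; exists t.
have X3 : c3 X = 0 := g3 0.
have V3 : c3 V = 0.
  have := g3 1; rewrite gE /line c3D !c3Z X3 mulr0 add0r => /eqP.
  by rewrite mulf_eq0 gt_eqF ?sinh_gt0 //= => /eqP.
have gpt t : gamma t = pt (line X V t) by apply: emb_inj; rewrite emb_pt_line.
have XVL t : L (pt (line X V t)) by rewrite LE -gpt; exists t.
exists (cross X V); split; last exact: (half_turn_refl hH f X3 V3 XVL).
have Xn := ip_crossl X V; have Vn := ip_crossr X V.
have nn : ip (cross X V) (cross X V) = 1 by rewrite ip_cross // XX VV XV; ring.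
split => //; apply/seteqP; split => x.
  by rewrite LE => -[t _ <-] /=; rewrite g3 gE ip_line Xn Vn; split => //; ring.
move=> [x3 xn]; rewrite LE.
have xE := frame_expand (emb x) X3 V3 (c3_cross X V) XX VV nn XV Xn Vn.
rewrite x3 xn !scale0r !addr0 in xE.
have [t tE] := sinh_surj (ip (emb x) V).
have A0 : 0 < - ip (emb x) X.
  by rewrite oppr_gt0; apply: timelike_ip_lt0; apply: hyp_timelike => //; exact: hyp_emb.
have A2 : ip (emb x) X ^+ 2 = 1 + sinh t ^+ 2.
  have [xx _] := hyp_emb x.
  have : ip (emb x) (emb x) = - ip (emb x) X * ip (emb x) X + sinh t * ip (emb x) V.
    by rewrite {2}xE ipDr !ipZr tE.
  by rewrite xx -tE => e; rewrite !expr2; lra.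
have AE : - ip (emb x) X = cosh t.
  apply/eqP; rewrite -(eqrXn2 (n := 2)) ?(ltW A0) ?(ltW (cosh_gt0 t)) //; apply/eqP.
  by rewrite sqrrN A2 sinh2E; ring.
by exists t => //; apply: emb_inj; rewrite gE xE AE /line tE.
Qed.

Lemma normal_ofN L n : normal_of L n -> normal_of L (- n).
Proof.
move=> [n3 nn LE]; split; rewrite ?c3N ?n3 ?oppr0 //; first by rewrite ipNl ipNr opprK.
by rewrite LE; apply/seteqP; split => x /= [x3 xn]; split; rewrite ?ipNr ?xn ?oppr0 //;
  apply: oppr_inj; rewrite oppr0 -ipNr.
Qed.

Lemma reflN n X : refl (- n) X = refl n X.
Proof. by rewrite /refl ipNr mulrN scaleNr scalerN opprK. Qed.

(** A connected set that misses [L] stays on one side of it, which selects the sign of the normal;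
    [refl] does not depend on this sign. *)
Lemma outer_normal L H D : hline L -> L `<=` @planeP R -> half_turn L H ->
  D `<=` @planeP R -> D !=set0 -> connected D -> D `&` L = set0 ->
  exists n, [/\ normal_of L n, forall x, emb (H x) = refl n (emb x)
    & forall x, closure D x -> ip (emb x) n <= 0].
Proof.
move=> hL LP hH DP [x0 Dx0] cD DL; have [m [mL Hm]] := line_normal hL LP hH.
have nz n : normal_of L n -> forall x, D x -> ip (emb x) n != 0.
  move=> [_ _ LE] x Dx; apply/eqP => xn.
  have : (D `&` L) x by split => //; rewrite LE; split => //; apply/planePE; exact: DP.
  by rewrite DL.
have key n : normal_of L n -> ip (emb x0) n < 0 -> forall x, closure D x -> ip (emb x) n <= 0.
  move=> nL x0n; apply: closure_ip_le0 => x Dx; rewrite -oppr_ge0 -ipNr; apply: ltW.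
  apply: (connected_sign cD (continuous_ip (Y := - n)) _ Dx0 Dx); last by rewrite ipNr oppr_gt0.
  exact: nz (normal_ofN nL).
have [h|h|h] := ltgtP (ip (emb x0) m) 0.
- by exists m; split => //; exact: key.
- exists (- m); split; first exact: normal_ofN.
    by move=> x; rewrite reflN.
  by apply: key; [exact: normal_ofN|rewrite ipNr oppr_lt0].
- by have := nz m mL x0 Dx0; rewrite h eqxx.
Qed.

Lemma timelike_or_opp X : ip X X < 0 -> timelike X \/ timelike (- X).
Proof.
move=> XX; have [h|h|h] := ltgtP (c0 X) 0; [right|left|exfalso].
- by split; rewrite ?ipNl ?ipNr ?opprK // c0N oppr_gt0.
- by split.
- move: XX; rewrite /ip h; have := sqr_ge0 (c1 X); have := sqr_ge0 (c2 X).
  by have := sqr_ge0 (c3 X); lra.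
Qed.

Lemma hyperbolic_le0 (a b : R) : (forall t, cosh t * a + sinh t * b <= 0) -> b ^+ 2 <= a ^+ 2.
Proof.
move=> h; have a0 : a <= 0 by have := h 0; rewrite cosh0 sinh0; lra.
have bound (c : R) : (forall t, cosh t * a + sinh t * c <= 0) -> c <= - a.
  move=> hc; rewrite leNgt; apply/negP => lt.
  have d0 : 0 < c + a by lra.
  (* At [sinh t = M] one has [cosh t <= M + 1], and since [a <= 0] the value there is at least
     [M * (c + a) + a = 1]. *)
  pose M := (1 - a) / (c + a); have M0 : 0 < M by rewrite divr_gt0 //; lra.
  have [t tE] := sinh_surj M.
  have ct : cosh t <= M + 1.
    rewrite -(ler_pXn2r (n := 2)) ?nnegrE ?(ltW (cosh_gt0 t)) //; last by lra.
    by have := sinh2E t; rewrite tE; lra.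
  have := hc t; rewrite tE.
  have : (M + 1) * a <= cosh t * a by exact: ler_wnM2r.
  have : M * (c + a) = 1 - a by rewrite divfK // gt_eqF.
  lra.
have b1 := bound b h.
have b2 : - b <= - a.
  by apply: bound => t; have := h (- t); rewrite coshN sinhN; lra.
have h1 : 0 <= - a - b by lra.
have h2 : 0 <= - a + b by lra.
by have := mulr_ge0 h1 h2; lra.
Qed.

(** As [M] does not cross [L], [hyperbolic_le0] and the expansion of [n] in a frame of [M] give
    [1 <= ip n m ^+ 2]. Beyond the excluded value 1 there is a common perpendicular, and the sides
    on which its feet lie decide the sign of [ip n m]. *)
Lemma normals_timelike L M n m : normal_of L n -> normal_of M m ->
  (forall x, M x -> ip (emb x) n <= 0) -> (forall x, L x -> ip (emb x) m <= 0) ->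
  M !=set0 -> ip n m ^+ 2 <> 1 -> timelike (n + m).
Proof.
move=> [n3 nn LE] [m3 mm ME] Mn Lm [x Mx] c1.
have [x3 xm] : c3 (emb x) = 0 /\ ip (emb x) m = 0 by move: Mx; rewrite ME.
have [hX] := hyp_emb x; have [XX _] := hyp_emb x => X0.
set X := emb x in x3 xm hX XX X0.
pose V := cross X m.
have V3 : c3 V = 0 by [].
have XV : ip X V = 0 := ip_crossl X m.
have mV : ip m V = 0 := ip_crossr X m.
have VV : ip V V = 1 by rewrite ip_cross // XX mm xm; ring.
have f : frame X V by split => //; split.
have c2 : ip V n ^+ 2 <= ip X n ^+ 2.
  apply: hyperbolic_le0 => t; rewrite -ip_line -emb_pt_line //; apply: Mn; rewrite ME.
  by split; rewrite emb_pt_line ?c3_line // ip_line xm (ipC V) mV; ring.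
have nE := frame_expand n x3 V3 m3 XX VV mm XV xm (etrans (ipC _ _) mV).
have n2 : ip n n = - ip n X ^+ 2 + ip n V ^+ 2 + ip n m ^+ 2.
  by rewrite {2}nE n3 scale0r addr0 !ipDr !ipZr; ring.
have {}c1 : 0 < ip n m ^+ 2 - 1.
  rewrite lt_def subr_eq0; apply/andP; split; first exact/eqP.
  by move: n2; rewrite nn (ipC n X) (ipC n V); lra.
(* Up to sign and scale, [u - ip u v *: v] is the foot of the common perpendicular on [K]. If it
   were past-pointing, its opposite would give a point of [K] on the positive side of [u]. *)
have cone (u v : mink) (K : set (H3 R)) : normal_of K v -> c3 u = 0 -> ip u u = 1 ->
    ip u v ^+ 2 = ip n m ^+ 2 -> (forall y, K y -> ip (emb y) u <= 0) ->
    timelike (u - ip u v *: v).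
  move=> [v3 vv KE] u3 uu uv Ku.
  have UU : ip (u - ip u v *: v) (u - ip u v *: v) = 1 - ip u v ^+ 2.
    by rewrite !ipE uu vv (ipC v u); ring.
  have [//|tN] : timelike (u - ip u v *: v) \/ timelike (- (u - ip u v *: v)).
    by apply: timelike_or_opp; rewrite UU uv; lra.
  have hN := hyp_normalize tN; exfalso.
  have s0 : 0 < (Num.sqrt (- ip (- (u - ip u v *: v)) (- (u - ip u v *: v))))^-1.
    by rewrite invr_gt0 sqrtr_gt0 oppr_gt0; case: tN.
  have : ip (emb (pt (normalize (- (u - ip u v *: v))))) u <= 0.
    apply: Ku; rewrite KE; split; rewrite ptK // /normalize; move: (Num.sqrt _)^-1 => q.
      by rewrite c3Z c3N c3D c3N c3Z u3 v3; ring.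
    by rewrite ipZl ipNl ipDl ipNl ipZl vv; ring.
  rewrite ptK // /normalize; move: (Num.sqrt _)^-1 s0 => q q0.
  rewrite ipZl pmulr_rle0 // ipNl ipDl ipNl ipZl uu (ipC v u).
  by move: c1; rewrite -uv expr2; lra.
have t1 : timelike (n - ip n m *: m) by apply: (cone _ _ M).
have t2 : timelike (m - ip n m *: n).
  by rewrite (ipC n m); apply: (cone _ _ L) => //; rewrite (ipC m n).
have := timelike_ip_lt0 t1 t2.
rewrite !ipE nn mm (ipC m n) => lt.
have nm0 : ip n m < 0.
  have e : ip n m * (ip n m ^+ 2 - 1) < 0 by move: lt; rewrite expr2; lra.
  by move: e; rewrite pmulr_llt0.
have cN1 : ip n m < -1.
  rewrite ltNge; apply/negP => ge.
  have h : (ip n m + 1) * (ip n m - 1) <= 0 by rewrite mulr_ge0_le0 //; lra.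
  by move: c1; rewrite expr2; lra.
split; first by rewrite !ipE nn mm (ipC m n); lra.
have [_ p1] := t1; have [_ p2] := t2.
(* The two future-pointing vectors above add up to [(1 - ip n m) *: (n + m)]. *)
have : 0 < (1 - ip n m) * c0 (n + m).
  by move: p1 p2; rewrite !c0D !c0N !c0Z; lra.
by rewrite pmulr_rgt0 //; lra.
Qed.

End StoppingLines.

(** * Inverses and the orbit space *)

Section Quotient.
Variable R : realType.
Implicit Types (G : set (H3 R -> H3 R)) (x y : H3 R) (f g h : H3 R -> H3 R).

Lemma inv_mapE f g : f \o g = id -> g \o f = id -> inv_map f = g.
Proof.
move=> fg gf; apply/funext => x.
have fK y : g (f y) = y by exact: (congr1 (fun u => u y) gf).
have gK y : f (g y) = y by exact: (congr1 (fun u => u y) fg).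
have inj : {in [set: H3 R] &, injective f}.
  by move=> a b _ _ /(congr1 g); rewrite !fK.
by rewrite -[in LHS](gK x) /inv_map pinvKV // inE.
Qed.

Lemma qproj_eqP G x y : qproj G x = qproj G y <-> gorbit G x = gorbit G y.
Proof.
split=> [/(congr1 (fun Q => sval Q))//|e].
exact: (eq_sig_hprop (fun _ => @Prop_irrelevance _)).
Qed.

Lemma qproj_act G g x : is_group G -> G g -> qproj G (g x) = qproj G x.
Proof.
move=> [_ Gcomp Ginv] Gg; apply/qproj_eqP/seteqP; split=> [_ [h Gh <-]|_ [h Gh <-]].
  by exists (h \o g) => //; exact: Gcomp.
have [g' Gg' [_ g'g]] := Ginv g Gg.
exists (h \o g'); first exact: Gcomp.
by rewrite /=; congr h; exact: (congr1 (fun u => u x) g'g).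
Qed.

Lemma qproj_eq_ex G x y : is_group G -> qproj G x = qproj G y -> exists2 g, G g & g y = x.
Proof.
move=> [G1 _ _] /qproj_eqP e; have : gorbit G x x by exists id.
by rewrite e => -[g Gg gy]; exists g.
Qed.

End Quotient.

(** * Even words as the given group, and fixed points on the pieces of the surface *)

Section Walls.
Variables (R : realType) (n : three_lines R).
Implicit Types (i j k a b : 'I_3) (x : H3 R).
Local Notation G := (even_group n).

Lemma wn_sym i j k : wn n j i k = wn n i j k.
Proof.
have e : raw n j i k = raw n i j k.
  rewrite /raw (cC n j i).
  by move: (_ *: n i) (_ *: n j) (_ *: n k) => a b c; rewrite (addrC b).
by rewrite !wnE e.
Qed.

Lemma wall_sym i j k : wall n j i k = wall n i j k.
Proof. by rewrite /wall wn_sym. Qed.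

Lemma mirror_mirror i : mirror n i \o mirror n i = id.
Proof. by apply/funext => x; exact: mirrorK. Qed.

(** The point of the line [n i] at signed distance [s] beyond the wall of [i] and [j]; exchanging
    [i] and [j] gives the other such point at the same wall. *)
Definition wall_pt i j k (s : R) : H3 R := pt (line (foot n i j) (wn n i j k) s).

Lemma wall_ptP i j k s x : i != j -> i != k -> j != k -> 
  c3 (emb x) = 0 -> ip (emb x) (n i) = 0 -> ip (emb x) (wn n i j k) = sinh s ->
  x = wall_pt i j k s.
Proof.
move=> ij ik jk x3 xi xw.
have [t xE] := (mirror_lineP n ij ik jk x).1 (conj x3 xi).
have fw : frame (foot n i j) (wn n i j k).
  by split; [exact: hyp_foot|exact: w_w|exact: foot_w].
suff <- : t = s by [].
by apply: sinh_inj; rewrite -xw xE (ptK (hyp_line t fw)) (line_w n ij ik jk).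
Qed.

Definition i0 : 'I_3 := Ordinal (isT : 0 < 3)%N.
Definition i1 : 'I_3 := Ordinal (isT : 1 < 3)%N.
Definition i2 : 'I_3 := Ordinal (isT : 2 < 3)%N.

Lemma ord3_cases (P : 'I_3 -> Prop) : P i0 -> P i1 -> P i2 -> forall i, P i.
Proof.
move=> p0 p1 p2 [[|[|[|//]]] lt3]; [move: p0|move: p1|move: p2].
- by rewrite (_ : i0 = Ordinal lt3) //; exact: val_inj.
- by rewrite (_ : i1 = Ordinal lt3) //; exact: val_inj.
- by rewrite (_ : i2 = Ordinal lt3) //; exact: val_inj.
Qed.

Lemma ev_catE s t : ev n (s ++ t) = ev n s \o ev n t.
Proof. by apply/funext => x; rewrite ev_cat. Qed.

Lemma even_group_generated (H : set (H3 R -> H3 R)) (A B : H3 R -> H3 R) :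
  is_group H -> generate H A B ->
  A = mirror n i0 \o mirror n i1 -> B = mirror n i0 \o mirror n i2 -> H = G.
Proof.
move=> [H1 Hcomp Hinv] [HA HB Hgen] AE BE.
have rr := mirror_mirror.
have rrx i x : mirror n i (mirror n i x) = x by exact: mirrorK.
have invE a b : inv_map (mirror n a \o mirror n b) = mirror n b \o mirror n a.
  by apply: inv_mapE; apply/funext => x; rewrite /= !rrx.
apply/seteqP; split=> g.
  move=> /Hgen[wd ->]; elim: wd => [|l wd [s os sE]]; first by exists [::].
  have [t [st tE]] : exists t, size t = 2 /\ eval_letter A B l = ev n t.
    case: l => [[] []]; rewrite /eval_letter /= ?AE ?BE ?invE.
    - by exists [:: i1; i0].
    - by exists [:: i0; i1].
    - by exists [:: i2; i0].
    - by exists [:: i0; i2].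
  exists (t ++ s); first by rewrite size_cat oddD st.
  by rewrite /= -/(eval_word A B wd) sE tE ev_catE.
have H0 : forall a, H (mirror n i0 \o mirror n a).
  by apply: ord3_cases; rewrite ?rr -?AE -?BE.
have Hrev a : H (mirror n a \o mirror n i0).
  have [h Hh [e1 e2]] := Hinv _ (H0 a).
  suff -> : mirror n a \o mirror n i0 = h by [].
  apply/funext => x; set y := mirror n a (mirror n i0 x).
  have : h ((mirror n i0 \o mirror n a) y) = y by exact: (congr1 (fun u => u y) e2).
  by rewrite {1}/y /comp (rrx a) (rrx i0) => hx; exact: esym hx.
(* Inserting the square of the reflection [i0] writes any pair of letters through the generators;
   even words are then consumed two letters at a time. *)
have H2 a b : H (mirror n a \o mirror n b).
  rewrite (_ : _ \o _ = (mirror n a \o mirror n i0) \o (mirror n i0 \o mirror n b)).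
    exact: Hcomp.
  by apply/funext => x; rewrite /= rrx.
move=> [s os ->]; have [m le_m] := ubnP (size s).
elim: m s le_m os => // m IH [|a [|b s]] //= le_m os.
rewrite -[_ \o _]/((mirror n a \o mirror n b) \o ev n s); apply: Hcomp; first exact: H2.
by apply: IH; [exact: leq_trans (leqnSn _) _|move: os; rewrite negbK].
Qed.

Lemma fixed_Rec i j k W (s : R) g x : i != j -> i != k -> j != k ->
  is_group G -> axis W = wall n i j k -> 0 < s ->
  G g -> forall a, mirror n a (g x) = x -> Rec G W s x ->
  qproj G x = qproj G (wall_pt i j k s) \/ qproj G x = qproj G (wall_pt j i k s).
Proof.
move=> ij ik jk grp axW s0 [u ou ->] a fx /(RecP ij ik jk axW s0)[tube w0].
have oau : odd (size (a :: u)) by rewrite /= ou.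
have x3 := odd_fix_c3 oau fx.
have ss : 0 < sinh s by rewrite sinh_gt0.
have xw : ip (emb x) (wn n i j k) = sinh s.
  move: tube; rewrite x3 expr0n addr0 => /eqP; rewrite eqf_sqr => /orP[/eqP//|/eqP e].
  by move: w0; rewrite e oppr_ge0 leNgt ss.
have xw0 : 0 < ip (emb x) (wn n i j k) by rewrite xw.
have [v [b [ov bij v3 vb vw]]] := odd_fix_beyond ij ik jk oau fx xw0.
(* Here the evenness of [v] matters: only even words leave the projection unchanged. *)
have <- : qproj G (ev n v x) = qproj G x by apply: qproj_act => //; exists v.
move: bij; rewrite !inE => /orP[] /eqP bE; rewrite bE in vb; [left|right]; congr qproj.
  exact: wall_ptP ij ik jk v3 vb (etrans vw xw).
have ji : j != i by rewrite eq_sym.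
apply: (wall_ptP ji jk ik v3 vb); rewrite (wn_sym i j k); exact: etrans vw xw.
Qed.

Lemma fixed_shift (M : set (H3 R)) (s : R) g x a : sinh s != 0 ->
  G g -> mirror n a (g x) = x -> ~ normal_shift s M x.
Proof.
move=> s0 [u ou ->] fx /normal_shiftP[y [_ y3 xE]].
have oau : odd (size (a :: u)) by rewrite /= ou.
have := odd_fix_c3 oau fx; rewrite xE c3D !c3Z y3 mulr0 add0r => /eqP.
by rewrite mulf_eq0 (negPf s0) /= /e3 cT oner_eq0.
Qed.

End Walls.

(** * The fixed points of the involution for three given lines *)

Section Core.
Variables (R : realType) (n : three_lines R) (s : R).
Hypothesis s0 : 0 < s.
Local Notation G := (even_group n).

Let s_neq0 : sinh s != 0. Proof. by rewrite gt_eqF // sinh_gt0. Qed.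
Let sN_neq0 : sinh (- s) != 0. Proof. by rewrite sinhN oppr_eq0. Qed.

(** The first letters P, Q, R stand for the lines [L], [LA], [LB], the second letters A, B, C for
    the axes of [A], [B], [A^-1 B]. *)
Let PA := wall_pt n i0 i1 i2 s.
Let PB := wall_pt n i0 i2 i1 s.
Let QA := wall_pt n i1 i0 i2 s.
Let QC := wall_pt n i1 i2 i0 s.
Let RB := wall_pt n i2 i0 i1 s.
Let RC := wall_pt n i2 i1 i0 s.

Lemma mirror_wall_pt i j k : i != j -> i != k -> j != k ->
  mirror n i (wall_pt n i j k s) = wall_pt n i j k s.
Proof.
move=> ij ik jk; have [_ pn] : mirror_line n i (wall_pt n i j k s).
  by apply/(mirror_lineP n ij ik jk); exists s.
have [p3 _] : mirror_line n i (wall_pt n i j k s).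
  by apply/(mirror_lineP n ij ik jk); exists s.
exact: mirror_fix.
Qed.

Lemma surface_fixed (A B C : H3 R -> H3 R) (j : orbit_space G -> orbit_space G) :
  is_group G -> (forall i, induces G (mirror n i) j) ->
  axis A = wall n i0 i1 i2 -> axis B = wall n i0 i2 i1 -> inv_map A \o B = C ->
  axis C = wall n i1 i2 i0 ->
  [/\ ray G (mirror_line n i0) A `&` Rec G A s = [set PA],
    ray G (mirror_line n i1) A `&` Rec G A s = [set QA],
    ray G (mirror_line n i0) B `&` Rec G B s = [set PB] &
    ray G (mirror_line n i2) B `&` Rec G B s = [set RB]] /\
  [/\ ray G (mirror_line n i1) C `&` Rec G C s = [set QC] &
    ray G (mirror_line n i2) C `&` Rec G C s = [set RC]] /\
  [set qproj G PA; qproj G PB; qproj G QA; qproj G QC; qproj G RC; qproj G RB]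
    `<=` surface G A B s /\
  [set y | surface G A B s y /\ j y = y] =
    [set qproj G PA; qproj G PB; qproj G QA; qproj G QC; qproj G RC; qproj G RB].
Proof.
move=> grp jE axA axB CE axC.
have pA : ray G (mirror_line n i0) A `&` Rec G A s = [set PA] by exact: ray_Rec.
have qA : ray G (mirror_line n i1) A `&` Rec G A s = [set QA].
  by apply: (@ray_Rec R n i1 i0 i2) => //; rewrite axA wall_sym.
have pB : ray G (mirror_line n i0) B `&` Rec G B s = [set PB] by exact: ray_Rec.
have rB : ray G (mirror_line n i2) B `&` Rec G B s = [set RB].
  by apply: (@ray_Rec R n i2 i0 i1) => //; rewrite axB wall_sym.
have qC : ray G (mirror_line n i1) C `&` Rec G C s = [set QC] by exact: ray_Rec.
have rC : ray G (mirror_line n i2) C `&` Rec G C s = [set RC].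
  by apply: (@ray_Rec R n i2 i1 i0) => //; rewrite axC wall_sym.
have inR (M K : set (H3 R)) z : M `&` K = [set z] -> K z.
  by move=> e; have [] : (M `&` K) z by rewrite e.
have sub : [set qproj G PA; qproj G PB; qproj G QA; qproj G QC; qproj G RC; qproj G RB]
    `<=` surface G A B s.
  move=> _ [[[[[->|->]|->]|->]|->]|->]; rewrite /surface CE.
  - by left; left; right; exists PA => //; exact: inR pA.
  - by left; right; exists PB => //; exact: inR pB.
  - by left; left; right; exists QA => //; exact: inR qA.
  - by right; exists QC => //; exact: inR qC.
  - by right; exists RC => //; exact: inR rC.
  - by left; right; exists RB => //; exact: inR rB.
split; first by split.
split; first by split.
split=> //; apply/seteqP; split=> [y [Sy jy]|y Py]; last first.
  split; first exact: sub.
  have fixp i k l : i != k -> i != l -> k != l ->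
      j (qproj G (wall_pt n i k l s)) = qproj G (wall_pt n i k l s).
    by move=> ik il kl; rewrite (jE i) mirror_wall_pt.
  by case: Py => [[[[[->|->]|->]|->]|->]|->]; apply: fixp.
have [x Sx yE] : exists2 x, [\/ normal_shift s (hull G) x, normal_shift (- s) (hull G) x,
    Rec G A s x | Rec G B s x \/ Rec G C s x] & y = qproj G x.
  move: Sy; rewrite /surface CE => -[[[[[x h <-]|[x h <-]]|[x h <-]]|[x h <-]]|[x h <-]].
  - by exists x => //; constructor 1.
  - by exists x => //; constructor 2.
  - by exists x => //; constructor 3.
  - by exists x => //; constructor 4; left.
  - by exists x => //; constructor 4; right.
(* As the reflection [i0] induces [j], a fixed point of [j] lifts to a point [x] fixed by that
   reflection composed with an element of [G], an odd word. *)
rewrite yE in jy *; have [g Gg gx] : exists2 g, G g & g x = mirror n i0 x.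
  by apply: qproj_eq_ex grp _; rewrite -jE jy.
have fx : mirror n i0 (g x) = x by rewrite gx mirrorK.
case: Sx => [h|h|h|[h|h]].
- by case: (fixed_shift s_neq0 Gg fx h).
- by case: (fixed_shift sN_neq0 Gg fx h).
- have [->|->] := @fixed_Rec R n i0 i1 i2 A s g x isT isT isT grp axA s0 Gg i0 fx h.
  + by do 5 left.
  + by do 3 left; right.
- have [->|->] := @fixed_Rec R n i0 i2 i1 B s g x isT isT isT grp axB s0 Gg i0 fx h.
  + by do 4 left; right.
  + by right.
- have [->|->] := @fixed_Rec R n i1 i2 i0 C s g x isT isT isT grp axC s0 Gg i0 fx h.
  + by do 2 left; right.
  + by left; right.
Qed.

End Core.

(** * From the hypotheses of the theorem to three lines *)

Section Hypotheses.
Variable R : realType.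
Implicit Types (L M D : set (H3 R)) (f g h : H3 R -> H3 R) (X : mink R).

Lemma axis_neq_id g : axis g !=set0 -> g <> id.
Proof.
move=> [_ [gamma [l [geo l0 tr _]]]] gid.
have := geo 0 (0 + l); rewrite -tr gid geo !add0r oppr0 normr0 normrN => /esym/eqP.
by rewrite normr_eq0 gt_eqF.
Qed.

Lemma half_turns_ip G L M f h X Y : no_parabolic G -> half_turn L f -> half_turn M h ->
  normal_of L X -> normal_of M Y ->
  (forall x, emb (f x) = refl X (emb x)) -> (forall x, emb (h x) = refl Y (emb x)) ->
  G (f \o h) -> f \o h <> id -> ip X Y ^+ 2 <> 1.
Proof.
move=> Gpar [[a ra] _ _ _] [[b rb] _ _ _] [X3 XX _] [Y3 YY _] fE hE Gfh fh1 XY.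
have r := represents_comp ra rb; apply: (Gpar _ _ r Gfh).
by apply: (refl2_parabolic r _ fh1 X3 Y3 XX YY XY) => x; rewrite /= fE hE.
Qed.

Lemma three_lines_ex (X Y Z : mink R) :
  c3 X = 0 -> c3 Y = 0 -> c3 Z = 0 -> ip X X = 1 -> ip Y Y = 1 -> ip Z Z = 1 ->
  timelike (X + Y) -> timelike (X + Z) -> timelike (Y + Z) ->
  exists n : three_lines R, [/\ n i0 = X, n i1 = Y & n i2 = Z].
Proof.
move=> X3 Y3 Z3 XX YY ZZ XY XZ YZ; pose f (i : 'I_3) := nth X [:: X; Y; Z] i.
have f3 i : c3 (f i) = 0 by move: i; exact: ord3_cases.
have ff i : ip (f i) (f i) = 1 by move: i; exact: ord3_cases.
have ft i j : i != j -> timelike (f i + f j).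
  move: i j; apply: ord3_cases; apply: ord3_cases => //= _; rewrite /f /=;
    by rewrite // addrC.
by exists (ThreeLines f3 ff ft).
Qed.

End Hypotheses.

Theorem proposition7p2 (R : realType) (G : set (H3 R -> H3 R))
    (A B : H3 R -> H3 R) (L LA LB : set (H3 R))
    (HL HLA HLB : H3 R -> H3 R)
    (j : orbit_space G -> orbit_space G) (s : R) :
  fuchsian G -> free_of_rank_two G -> no_parabolic G ->
  stopping_generators G A B L LA LB HL HLA HLB ->
  induces G HL j -> induces G HLA j -> induces G HLB j ->
  0 < s ->
  exists p q pA qA pB qB : H3 R,
    [/\ ray G L A `&` Rec G A s = [set p],
        ray G LA A `&` Rec G A s = [set pA],
        ray G L B `&` Rec G B s = [set q] &
        ray G LB B `&` Rec G B s = [set qB]] /\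
    [/\ ray G LA (inv_map A \o B) `&` Rec G (inv_map A \o B) s = [set qA] &
        ray G LB (inv_map A \o B) `&` Rec G (inv_map A \o B) s = [set pB]] /\
    [set qproj G p; qproj G q; qproj G pA; qproj G qA; qproj G pB; qproj G qB]
      `<=` surface G A B s /\
    [set y | surface G A B s y /\ j y = y] =
      [set qproj G p; qproj G q; qproj G pA; qproj G qA; qproj G pB; qproj G qB].
Proof.
move=> [grp _ _] _ Gpar [[gen Aax Bax ABax] [Lline LP _ _] [LAline LAP LBline LBP]].
move=> [hHL hHLA hHLB AE BE] [D [DP D0 cD DF FE]] jL jLA jLB s0.
have F M : M `<=` frontierP D -> D `&` M = set0 /\ M `<=` closure D.
  move=> MF; split; last by move=> x /MF[].
  by apply/seteqP; split=> // x [Dx /MF Fx]; rewrite -DF.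
have [DL Lcl] : D `&` L = set0 /\ L `<=` closure D.
  by apply: F => x Lx; rewrite FE; left; left.
have [DLA LAcl] : D `&` LA = set0 /\ LA `<=` closure D.
  by apply: F => x Lx; rewrite FE; left; right.
have [DLB LBcl] : D `&` LB = set0 /\ LB `<=` closure D.
  by apply: F => x Lx; rewrite FE; right.
have [X [nX HLE clX]] := outer_normal Lline LP hHL DP D0 cD DL.
have [Y [nY HLAE clY]] := outer_normal LAline LAP hHLA DP D0 cD DLA.
have [Z [nZ HLBE clZ]] := outer_normal LBline LBP hHLB DP D0 cD DLB.
have HLK : HL \o HL = id by case: hHL.
have HLAK : HLA \o HLA = id by case: hHLA.
have HLKx x : HL (HL x) = x by exact: (congr1 (fun u => u x) HLK).
have HLAKx x : HLA (HLA x) = x by exact: (congr1 (fun u => u x) HLAK).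
have iAB : inv_map A \o B = HLA \o HLB.
  have -> : inv_map A = HLA \o HL.
    by rewrite AE; apply: inv_mapE; apply/funext => x /=; rewrite ?HLAKx ?HLKx // HLAKx.
  by rewrite BE; apply/funext => x /=; rewrite HLKx.
have [GA GB _] := gen.
have GC : G (HLA \o HLB).
  rewrite -iAB; have [_ Gcomp Ginv] := grp; have [A' GA' [e1 e2]] := Ginv _ GA.
  by rewrite (inv_mapE e1 e2); exact: Gcomp.
(* Otherwise [A = B], and their axes, which are nonempty, would not be disjoint. *)
have C1 : HLA \o HLB <> id.
  move=> e; have eAB : A = B.
    rewrite AE BE; apply/funext => x /=; congr HL.
    by rewrite -[HLB x]HLAKx; congr HLA; rewrite -[RHS]/((HLA \o HLB) x) e.
  by case: Aax => x ax; move: ABax; rewrite -eAB setIid => e0; rewrite e0 in ax.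
have ne (M : set (H3 R)) : hline M -> M !=set0 by move=> [g _ ->]; exists (g 0), 0.
have XY : timelike (X + Y).
  apply: (normals_timelike nX nY _ _ (ne _ LAline)).
  - by move=> x /LAcl/clX.
  - by move=> x /Lcl/clY.
  - apply: (half_turns_ip Gpar hHL hHLA nX nY HLE HLAE); rewrite -AE //.
    exact: axis_neq_id.
have XZ : timelike (X + Z).
  apply: (normals_timelike nX nZ _ _ (ne _ LBline)).
  - by move=> x /LBcl/clX.
  - by move=> x /Lcl/clZ.
  - apply: (half_turns_ip Gpar hHL hHLB nX nZ HLE HLBE); rewrite -BE //.
    exact: axis_neq_id.
have YZ : timelike (Y + Z).
  apply: (normals_timelike nY nZ _ _ (ne _ LBline)).
  - by move=> x /LBcl/clY.
  - by move=> x /LAcl/clZ.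
  - exact: (half_turns_ip Gpar hHLA hHLB nY nZ HLAE HLBE).
have [X3 XX LE] := nX; have [Y3 YY LAE] := nY; have [Z3 ZZ LBE] := nZ.
have [n [nX0 nY1 nZ2]] := three_lines_ex X3 Y3 Z3 XX YY ZZ XY XZ YZ.
have m0 : mirror n i0 = HL.
  by apply/funext => x; apply: emb_inj; rewrite emb_mirror nX0 HLE.
have m1 : mirror n i1 = HLA.
  by apply/funext => x; apply: emb_inj; rewrite emb_mirror nY1 HLAE.
have m2 : mirror n i2 = HLB.
  by apply/funext => x; apply: emb_inj; rewrite emb_mirror nZ2 HLBE.
have GE : G = even_group n by apply: (even_group_generated grp gen); rewrite m0 ?m1 ?m2.
have l0 : L = mirror_line n i0 by rewrite LE /mirror_line nX0.
have l1 : LA = mirror_line n i1 by rewrite LAE /mirror_line nY1.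
have l2 : LB = mirror_line n i2 by rewrite LBE /mirror_line nZ2.
have axA : axis A = wall n i0 i1 i2 by rewrite AE -m0 -m1; exact: axis_mirror2.
have axB : axis B = wall n i0 i2 i1 by rewrite BE -m0 -m2; exact: axis_mirror2.
have axC : axis (inv_map A \o B) = wall n i1 i2 i0.
  by rewrite iAB -m1 -m2; exact: axis_mirror2.
clear -n GE grp jL jLA jLB m0 m1 m2 l0 l1 l2 axA axB axC s0.
(* The type of [j] depends on [G], so [G] is substituted everywhere at once. *)
subst G; rewrite l0 l1 l2.
have jE : forall i, induces (even_group n) (mirror n i) j.
  by apply: ord3_cases; rewrite ?m0 ?m1 ?m2.
have := surface_fixed s0 grp jE axA axB erefl axC.
by move=> h; do 6 eexists; exact: h.
Qed.
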